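(* Fix $\theta\in\mathbb{R}^P$ and $\gamma\in\mathbb{R}^P$, and let $\sigma^{(n)}$ be a sequence of positive real numbers converging to a finite limit $\sigma>0$. Let $p_*=\max\{p_0(\theta),\mathcal O\}$. For $p_*\le p\le P$ let $$\delta^{(p)}=\begin{pmatrix}Q[p:p]^{-1}Q[p:\neg p]\\-I_{P-p}\end{pmatrix}\gamma[\neg p]$$ (with $\delta^{(P)}=0\in\mathbb{R}^P$ and, if necessary, $\delta^{(0)}=-\gamma$). Then $G^*_{n,\theta+\gamma/\sqrt n,\sigma^{(n)}}(t)$ and $G_{n,\theta+\gamma/\sqrt n,\sigma^{(n)}}(t)$ converge in total variation, as $n\to\infty$, to the cdf $$\Phi_{\infty,p_*}(t-A\delta^{(p_* )})\prod_{q=p_*+1}^P\Delta_{\sigma\xi_{\infty,q}}(\delta_q^{(q)}+\gamma_q,\,c_q\sigma\xi_{\infty,q})$$ $$+\sum_{p=p_*+1}^P\int_{z\le t-A\delta^{(p)}}\Big(1-\Delta_{\sigma\zeta_{\infty,p}}(\delta_p^{(p)}+\gamma_p+b_{\infty,p}z,\,c_p\sigma\xi_{\infty,p})\Big)\Phi_{\infty,p}(dz)\times\prod_{q=p+1}^P\Delta_{\sigma\xi_{\infty,q}}(\delta_q^{(q)}+\gamma_q,\,c_q\sigma\xi_{\infty,q}).$$ Moreover, the model selection probabilities $P_{n,\theta+\gamma/\sqrt n,\sigma^{(n)}}(\hat p=p)$ and $P_{n,\theta+\gamma/\sqrt n,\sigma^{(n)}}(\hat p^*=p)$ both converge to $\big(1-\Delta_{\sigma\xi_{\infty,p}}(\delta_p^{(p)}+\gamma_p,c_p\sigma\xi_{\infty,p})\big)\prod_{q=p+1}^P\Delta_{\sigma\xi_{\infty,q}}(\delta_q^{(q)}+\gamma_q,c_q\sigma\xi_{\infty,q})$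 if $p_*<p\le P$, to $\prod_{q=p_*+1}^P\Delta_{\sigma\xi_{\infty,q}}(\delta_q^{(q)}+\gamma_q,c_q\sigma\xi_{\infty,q})$ if $p=p_*$, and to $0$ if $\mathcal O\le p<p_*$.
   Context: Model: for each sample size $n>P\ge1$, $Y=X\theta+u$ with $X=X_n$ a non-stochastic $n\times P$ matrix of rank $P$, $u\sim N(0,\sigma^2I_n)$, $\theta\in\mathbb{R}^P$, $\sigma>0$; $P_{n,\theta,\sigma}$ is the corresponding probability measure. It is assumed that $Q=\lim_{n\to\infty}X'X/n$ exists and is non-singular. $A$ is a fixed non-stochastic $k\times P$ matrix of rank $k$, $1\le k\le P$; $\mathcal O$ is a fixed integer with $0\le\mathcal O<P$. Inequalities between vectors are componentwise; empty products equal one. The order of $\theta$ is $p_0(\theta)=\min\{p:0\le p\le P,\ \theta_{p+1}=\dots=\theta_P=0\}$. Notation: for a matrix $D$ with $P$ columns, $D[p]$ is the matrix of its first $p$ columns; for a $P$-vector $x$, $x[\neg p]$ consists of its last $P-p$ components; $x_i$ is the $i$-th component. Estimators: for $0\le p\le P$, $\tilde\theta(p)\in\mathbb{R}^P$ is the restricted least-squares estimator with first $p$ components $(X[p]'X[p])^{-1}X[p]'Y$ and last $P-p$ components zero ($\tilde\theta(0)=0$); $\tilde\theta_p(p)$ is its $p$-th component. $\hat\sigma^2=(n-P)^{-1}(Y-X\tilde\theta(P))'(Y-X\tilde\theta(P))$. For $0<p\le P$, $\xi_{n,p}=\big([(X[p]'X[p]/n)^{-1}]_{p,p}\big)^{1/2}$,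 $T_p=\sqrt n\,\tilde\theta_p(p)/(\hat\sigma\xi_{n,p})$ and $T^*_p=\sqrt n\,\tilde\theta_p(p)/(\sigma\xi_{n,p})$ (with the true $\sigma$); $T_0=T_0^*=0$. Critical values, not depending on $n$: $0<c_p<\infty$ for $\mathcal O<p\le P$ and $c_{\mathcal O}=0$. Model selectors: $\hat p=\max\{p:|T_p|\ge c_p,\ \mathcal O\le p\le P\}$ and $\hat p^*=\max\{p:|T^*_p|\ge c_p,\ \mathcal O\le p\le P\}$. Post-model-selection estimators: $\tilde\theta=\sum_{p=\mathcal O}^P\tilde\theta(p)\mathbf 1\{\hat p=p\}$, $\tilde\theta^*=\sum_{p=\mathcal O}^P\tilde\theta(p)\mathbf 1\{\hat p^*=p\}$. Cdfs (centered at the true parameter): $G_{n,\theta,\sigma}(t)=P_{n,\theta,\sigma}(\sqrt nA(\tilde\theta-\theta)\le t)$, $G^*_{n,\theta,\sigma}(t)=P_{n,\theta,\sigma}(\sqrt nA(\tilde\theta^*-\theta)\le t)$, $t\in\mathbb{R}^k$. Limit quantities: $Q$ is partitioned as $Q=\begin{pmatrix}Q[p:p]&Q[p:\neg p]\\Q[\neg p:p]&Q[\neg p:\neg p]\end{pmatrix}$ with $Q[p:p]$ of size $p\times p$. $\Phi_{\infty,p}$ is the cdf (and measure) on $\mathbb{R}^k$ of the centered Gaussian distribution with covariance matrix $\sigma^2A[p]Q[p:p]^{-1}A[p]'$ for $0<p\le P$, and of point mass at $0$ for $p=0$. For $1\le p\le P$: $C_\infty^{(p)}=A[p]Q[p:p]^{-1}e_p$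 with $e_p$ the $p$-th standard basis vector in $\mathbb{R}^p$; $\xi_{\infty,p}^2=(Q[p:p]^{-1})_{p,p}$; $b_{\infty,p}=C_\infty^{(p)\prime}(A[p]Q[p:p]^{-1}A[p]')^-$; $\zeta_{\infty,p}^2=\xi_{\infty,p}^2-b_{\infty,p}C_\infty^{(p)}$; $\xi_{\infty,p},\zeta_{\infty,p}\ge0$; $(\cdot)^-$ is a generalized inverse ($b_{\infty,p}z$ does not depend on its choice for $z$ in the column space of $A[p]$). $\Delta_s(a,b)=P(|M-a|<b)$ for $M\sim N(0,s^2)$, $s\ge0$ ($M=0$ if $s=0$, so $\Delta_0(a,b)=1$ if $|a|<b$ and $0$ otherwise). *)

(* Defs.v *)
From HB Require Import structures.
From mathcomp Require Import all_boot all_order all_algebra.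
From mathcomp Require Import all_classical all_reals all_analysis.

Set Implicit Arguments.
Unset Strict Implicit.
Unset Printing Implicit Defensive.

Import Order.TTheory GRing.Theory Num.Theory.
Import numFieldNormedType.Exports.

Local Open Scope classical_set_scope.
Local Open Scope ring_scope.

(* Matrices carry the sigma-algebra generated by their entries; over a
   realType this is the Borel sigma-algebra of R^(m x n). *)
Definition measure_matrix_display : measure_display -> measure_display.
Proof. exact. Qed.

Section measurable_matrix.
Context {d} {T : sigmaRingType d}.
Variables m n : nat.

Definition matrix_cylinder : set (set 'M[T]_(m, n)) :=
  [set B | exists i j (C : set T),
     measurable C /\ B = (fun M : 'M[T]_(m, n) => M i j) @^-1` C].

Let matrix_set0 : <<s matrix_cylinder >> set0.
Proof. exact: sigma_algebra0. Qed.

Let matrix_setC B : <<s matrix_cylinder >> B -> <<s matrix_cylinder >> (~` B).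
Proof. exact: sigma_algebraC. Qed.

Let matrix_bigcup (F : (set 'M[T]_(m, n))^nat) :
  (forall i, <<s matrix_cylinder >> (F i)) ->
  <<s matrix_cylinder >> (\bigcup_i (F i)).
Proof. exact: sigma_algebra_bigcup. Qed.

HB.instance Definition _ := @isMeasurable.Build (measure_matrix_display d)
  'M[T]_(m, n) <<s matrix_cylinder >> matrix_set0 matrix_setC matrix_bigcup.

Lemma measurable_entry i j :
  measurable_fun [set: 'M[T]_(m, n)] (fun M : 'M[T]_(m, n) => M i j).
Proof.
by move=> _ C mC; rewrite setTI; apply: sub_sigma_algebra; exists i, j, C.
Qed.

End measurable_matrix.

Lemma measurable_matrixP d d' (S : measurableType d) (T : measurableType d')
    m n (f : S -> 'M[T]_(m, n)) :
  (forall i j, measurable_fun setT (fun x => f x i j)) -> measurable_fun setT f.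
Proof.
move=> mf; pose G := @matrix_cylinder d' T m n.
apply: (@measurability _ _ _ _ setT f G) => //.
move=> _ [_ [i [j [C [mC ->]]]] <-].
by have := mf i j measurableT C mC; rewrite !setTI.
Qed.

Section gaussian.
Context {R : realType}.

Definition affine m n (a : 'cV[R]_m) (L : 'M[R]_(m, n)) (z : 'cV[R]_n) :
  'cV[R]_m := a + L *m z.

Lemma measurable_affine m n (a : 'cV[R]_m) (L : 'M[R]_(m, n)) :
  measurable_fun setT (affine a L).
Proof.
apply: measurable_matrixP => i j; rewrite /affine.
under eq_fun do rewrite !mxE.
apply: measurable_realfun.measurable_funD => //.
apply: measurable_sum => l; apply: measurable_realfun.measurable_funM => //.
exact: measurable_entry.
Qed.

HB.instance Definition _ m n (a : 'cV[R]_m) (L : 'M[R]_(m, n)) :=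
  isMeasurableFun.Build _ _ _ _ (affine a L) (measurable_affine a L).

Definition cV_cons n (x : measurableTypeR R * 'cV[R]_n) : 'cV[R]_(1 + n) :=
  col_mx (x.1 : R)%:M x.2.

Lemma measurable_cV_cons n : measurable_fun setT (@cV_cons n).
Proof.
apply: measurable_matrixP => i j; rewrite /cV_cons.
case: (split_ordP i) => i' ->.
  under eq_fun do rewrite col_mxEu !mxE (ord1 i') (ord1 j) eqxx mulr1n.
  exact: measurable_fst.
under eq_fun do rewrite col_mxEd.
exact: (measurableT_comp (measurable_entry _ _) measurable_snd).
Qed.

HB.instance Definition _ n :=
  isMeasurableFun.Build _ _ _ _ (@cV_cons n) (@measurable_cV_cons n).

(* Law of a vector of n independent N(0, 1) variables. *)
Fixpoint std_gaussian n : probability 'cV[R]_n R :=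
  if n is n'.+1 then
    distribution (normal_prob (0 : R) 1 \x std_gaussian n')%E (@cV_cons n')
  else \d_(0 : 'cV[R]_0).

(* N(a, S) on R^m is the law of a + L Z with Z standard Gaussian and L a square
   root L L' = S of the covariance matrix; the law is the same for every such
   L, so that S may be singular.  (L = 0 if S is not positive semidefinite.) *)
Definition cov_root m (S : 'M[R]_m) : 'M[R]_m :=
  xget 0 [set L : 'M[R]_m | L *m L^T = S].

Definition gaussian m (a : 'cV[R]_m) (S : 'M[R]_m) : probability 'cV[R]_m R :=
  distribution (std_gaussian m) (affine a (cov_root S)).

End gaussian.

Section cdf.
Context {R : realType} {k : nat}.

Definition lower_orthant (t : 'cV[R]_k) : set 'cV[R]_k :=
  [set z | forall i, z i 0 <= t i 0].

Definition mcdf (mu : probability 'cV[R]_k R) (t : 'cV[R]_k) : R :=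
  fine (mu (lower_orthant t)).

Definition tv_dist (mu nu : probability 'cV[R]_k R) : \bar R :=
  ereal_sup [set `|mu B - nu B|%E | B in measurable].

(* A distribution on R^k is determined by its cdf, so the measures below are
   the ones that correspond to the cdfs. *)
Definition cdf_cvg_tv (G : nat -> 'cV[R]_k -> R) (F : 'cV[R]_k -> R) : Prop :=
  exists (mu : nat -> probability 'cV[R]_k R) (nu : probability 'cV[R]_k R),
    [/\ \forall n \near \oo, mcdf (mu n) = G n,
        mcdf nu = F &
        tv_dist (mu n) nu @[n --> \oo] --> 0%E].

End cdf.

(* The numbers p, q below count regressors and components from 1, as usual in
   statistics, whereas ordinals and entry count from 0.  With entry equal to 0
   out of range, D[p], Q[p:p], ... need no proof of p <= P. *)
Section blocks.
Context {R : realType}.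

Definition entry m n (M : 'M[R]_(m, n)) (i j : nat) : R :=
  if (insub i, insub j) is (Some i', Some j') then M i' j' else 0.

(* Upper left block of M, completed with zeros if m < m' or n < n'. *)
Definition resize m n m' n' (M : 'M[R]_(m, n)) : 'M[R]_(m', n') :=
  \matrix_(i, j) entry M i j.

Definition component n (x : 'cV[R]_n) (p : nat) : R := entry x p.-1 0.

Definition first_cols m n p (D : 'M[R]_(m, n)) : 'M[R]_(m, p) := resize m p D.

Definition last_comps n p (x : 'cV[R]_n) : 'cV[R]_(n - p) :=
  \col_i entry x (p + i) 0.

(* Q[p:p] and Q[p:~p] *)
Definition block11 n p (Q : 'M[R]_n) : 'M[R]_p := resize p p Q.
Definition block12 n p (Q : 'M[R]_n) : 'M[R]_(p, n - p) :=
  \matrix_(i, j) entry Q i (p + j).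

(* M_{p,p} for p > 0 *)
Definition last_diag p (M : 'M[R]_p) : R := entry M p.-1 p.-1.

(* p-th standard basis vector of R^p *)
Definition last_basis p : 'cV[R]_p := \col_i (i.+1 == p)%:R.

Definition is_ginv m n (M : 'M[R]_(m, n)) (G : 'M[R]_(n, m)) : Prop :=
  M *m G *m M = M.

End blocks.

Section model.
Context {R : realType} {P : nat}.

(* min {p : 0 <= p <= P, theta_(p+1) = ... = theta_P = 0} *)
Definition theta_order (th : 'cV[R]_P) : nat :=
  [arg min_(p < (ord_max : 'I_P.+1) |
      [forall i : 'I_P, (p <= i) ==> (th i ord0 == 0%R)]) p]%N.

Section sample.
Context {n : nat} (X : 'M[R]_(n, P)).

(* P_{n,theta,sigma}(Y in E) for Y = X theta + u, u ~ N(0, sigma^2 I_n) *)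
Definition lm_prob (th : 'cV[R]_P) (sigma : R) (E : set 'cV[R]_n) : R :=
  fine (gaussian 0 (sigma ^+ 2)%:M [set u | E (X *m th + u)]).

Definition restricted_ls (p : nat) (y : 'cV[R]_n) : 'cV[R]_P :=
  let Xp := first_cols p X in
  resize P 1 (invmx (Xp^T *m Xp) *m Xp^T *m y).

Definition sigma_hat (y : 'cV[R]_n) : R :=
  let r := y - X *m restricted_ls P y in
  Num.sqrt ((n - P)%N%:R^-1 * (r^T *m r) 0 0).

Definition xi_n (p : nat) : R :=
  let Xp := first_cols p X in
  Num.sqrt (last_diag (invmx (n%:R^-1 *: (Xp^T *m Xp)))).

(* T_p for s = sigma_hat y, T*_p for s = sigma *)
Definition t_stat (s : R) (p : nat) (y : 'cV[R]_n) : R :=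
  if p == 0%N then 0
  else Num.sqrt n%:R * component (restricted_ls p y) p / (s * xi_n p).

Section selection.
Variables (o : nat) (c : nat -> R).

(* max {p : |T_p| >= c_p, o <= p <= P}; p = o qualifies because c_o = 0 *)
Definition select (s : R) (y : 'cV[R]_n) : nat :=
  (\max_(o <= p < P.+1 | (c p <= `|t_stat s p y|)%R) p)%N.

Definition p_hat (y : 'cV[R]_n) : nat := select (sigma_hat y) y.

Definition post_selection (sel : 'cV[R]_n -> nat) (y : 'cV[R]_n) : 'cV[R]_P :=
  \sum_(o <= p < P.+1) (sel y == p)%:R *: restricted_ls p y.

Definition pms_cdf k (A : 'M[R]_(k, P)) (th : 'cV[R]_P) (sigma : R)
    (sel : 'cV[R]_n -> nat) (t : 'cV[R]_k) : R :=
  lm_prob th sigma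
    [set y | lower_orthant t
               (Num.sqrt n%:R *: (A *m (post_selection sel y - th)))].

End selection.
End sample.
End model.

(* P(|M - a| < b) for M ~ N(0, s^2), where N(0, 0) is the point mass at 0
   (normal_prob is not meant for s = 0). *)
Definition Delta {R : realType} (s a b : R) : R :=
  let B := [set x : measurableTypeR R | `|(x : R) - a| < b] in
  if s == 0 then fine (\d_(0 : measurableTypeR R) B)
  else fine (normal_prob 0 s B).

Section limit.
Context {R : realType} {P k : nat}.
Variables (Q : 'M[R]_P) (A : 'M[R]_(k, P)) (ginv : 'M[R]_k -> 'M[R]_k).

(* A[p] Q[p:p]^-1 A[p]' *)
Definition cov_inf (p : nat) : 'M[R]_k :=
  first_cols p A *m invmx (block11 p Q) *m (first_cols p A)^T.

Definition Phi_inf (sigma : R) (p : nat) : probability 'cV[R]_k R :=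
  if p is 0 then \d_(0 : 'cV[R]_k) else gaussian 0 (sigma ^+ 2 *: cov_inf p).

Definition C_inf (p : nat) : 'cV[R]_k :=
  first_cols p A *m invmx (block11 p Q) *m last_basis p.

Definition xi_inf (p : nat) : R := Num.sqrt (last_diag (invmx (block11 p Q))).

Definition b_inf (p : nat) : 'rV[R]_k := (C_inf p)^T *m ginv (cov_inf p).

Definition zeta_inf (p : nat) : R :=
  Num.sqrt (xi_inf p ^+ 2 - (b_inf p *m C_inf p) 0 0).

Variable gam : 'cV[R]_P.

Definition delta (p : nat) : 'cV[R]_P :=
  resize P 1
    (col_mx (invmx (block11 p Q) *m block12 p Q) (- 1%:M) *m last_comps p gam).

Variables (sigma : R) (c : nat -> R).

Definition accept (q : nat) : R :=
  Delta (sigma * xi_inf q) (component (delta q) q + component gam q)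
        (c q * sigma * xi_inf q).

Definition limit_cdf (pstar : nat) (t : 'cV[R]_k) : R :=
  mcdf (Phi_inf sigma pstar) (t - A *m delta pstar)
    * \prod_(pstar.+1 <= q < P.+1) accept q
  + \sum_(pstar.+1 <= p < P.+1)
      (\int[Phi_inf sigma p]_(z in lower_orthant (t - A *m delta p))
         (1 - Delta (sigma * zeta_inf p)
                (component (delta p) p + component gam p + (b_inf p *m z) 0 0)
                (c p * sigma * xi_inf p)))
      * \prod_(p.+1 <= q < P.+1) accept q.

Definition limit_selection_prob (pstar p : nat) : R :=
  if (p < pstar)%N then 0
  else if p == pstar then \prod_(pstar.+1 <= q < P.+1) accept q
  else (1 - accept p) * \prod_(p.+1 <= q < P.+1) accept q.

End limit.

(* Main.v *)
(* With D the lower triangular matrix such that Q[p:p]^-1 = D' pid_p D for all p, the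
   t-statistics T* are the vector D_n X'Y / (sqrt n s), that is, a standard Gaussian
   vector plus a shift converging to D Q gamma / sigma and a drift that is zero beyond
   the order of theta and diverges at it.  The estimator of order p is linear in the
   first p statistics, and order p is selected when |T_p| >= c_p and |T_q| < c_q for
   q > p.  By independence of the statistics the law of the limit experiment is the
   stated mixture, the p-th term being split by the regression of T_p on A theta~(p).

   For total variation, an upper triangular linear map close to the identity carries
   the finite-sample experiment of order p exactly onto the limit one, and such a map
   changes the Gaussian measure little, uniformly in the event.  The two selection
   events then differ only if a statistic is near its critical value, if
   sigma_hat / sigma is far from 1, or if the statistics are large.  One-sided bounds
   suffice, since the total masses agree. *)
From HB Require Import structures.
Require Import Defs.
From mathcomp Require Import all_boot all_order all_algebra.
From mathcomp Require Import all_classical all_reals all_analysis.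
From mathcomp Require Import measurable_realfun.
From mathcomp Require Import ring lra zify.
Set Implicit Arguments.
Unset Strict Implicit.
Unset Printing Implicit Defensive.
Import Order.TTheory GRing.Theory Num.Theory.
Import numFieldNormedType.Exports.
Local Open Scope classical_set_scope.
Local Open Scope ring_scope.

(** * Gaussian integrals *)

(** Laws are compared on the statistics rather than on the estimators: the law of A theta~(p) may be
    degenerate, whereas the P statistics, centered, are exactly standard Gaussian for every n > P.
    Densities then need comparing in one coordinate at a time only, which is why the transporting
    map is triangular; it is upper triangular so that it can fix the coordinates after p, whose
    tests have to come out the same.

    Since the Gaussian law is an iterated product and [cov_root] an arbitrary root, everything rests
    on one fact: the law of L z depends on L L' alone. It comes from invariance under rotations of
    two coordinates, and the independence of uncorrelated linear forms is a consequence.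

    The estimate sigma_hat is a function of the squared norm of the noise and of the statistics, so
    exponential moments of the norm control it. Away from the bad events the inclusion of the limit
    selection event in the sample event is purely deterministic. *)

Section density.
Local Open Scope ereal_scope.
Context d (T : measurableType d) (R : realType).
Variables (mu nu : {measure set T -> \bar R}) (g : T -> R).
Hypotheses (mg : measurable_fun setT g) (g0 : forall x, (0 <= g x)%R).
Hypothesis nuE : forall B, measurable B -> nu B = \int[mu]_(x in B) (g x)%:E.

Import HBNNSimple.

Let ge0_integral_density_nnsfun (f : {nnsfun T >-> R}) :
  \int[nu]_x (f x)%:E = \int[mu]_x ((f x)%:E * (g x)%:E).
Proof.
under eq_integral do rewrite fimfunE -fsumEFin//.
rewrite ge0_integral_fsum//; last 2 first.
  - by move=> r; exact/measurable_EFinP/measurableT_comp.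
  - by move=> n x _; rewrite EFinM nnfun_muleindic_ge0.
under [RHS]eq_integral.
  move=> x xD; rewrite fimfunE -fsumEFin// ge0_mule_fsuml; last first.
    by move=> r; rewrite EFinM nnfun_muleindic_ge0.
  over.
rewrite [RHS]ge0_integral_fsum//; last 2 first.
  - move=> r; apply: emeasurable_funM; apply/measurable_EFinP => //.
    by apply/measurableT_comp.
  - by move=> n x _; rewrite mule_ge0 ?lee_fin//; rewrite -lee_fin EFinM nnfun_muleindic_ge0.
apply: eq_fsbigr => r rf.
have r0 : (0 <= r)%R by move: rf => /[!inE] -[t _ <-].
under eq_integral do rewrite EFinM.
under [RHS]eq_integral do rewrite EFinM -muleA.

have mI : measurable_fun setT (fun x => (\1_(f @^-1` [set r]) x)%:E : \bar R).
  exact/measurable_EFinP.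
have mIg : measurable_fun setT
    (fun x => (\1_(f @^-1` [set r]) x)%:E * (g x)%:E : \bar R).
  by apply: emeasurable_funM => //; exact/measurable_EFinP.
rewrite !ge0_integralZl//; last first.
  by move=> x _; rewrite mule_ge0 ?lee_fin//.
congr (_ * _); rewrite integral_indic// setIT nuE//.
under [RHS]eq_integral do rewrite muleC.
by rewrite integral_mkcond; apply: eq_integral => x _; rewrite epatch_indic.
Qed.

(** [nuE] covers indicators; linearity extends it to simple functions, and monotone convergence
    along [nnsfun_approx] to all nonnegative functions. *)
Lemma ge0_integral_density (f : T -> \bar R) :
  measurable_fun setT f -> (forall x, 0 <= f x) ->
  \int[nu]_x f x = \int[mu]_x (f x * (g x)%:E).
Proof.
move=> mf f0; pose h := nnsfun_approx measurableT mf.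
have cvgh x : (h n x)%:E @[n --> \oo] --> f x by exact: cvg_nnsfun_approx.
have ndh x : {homo (fun n => h n x) : a b / (a <= b)%N >-> (a <= b)%R}.
  by move=> a b ab; exact/lefP/nd_nnsfun_approx.
transitivity (limn (fun n => \int[nu]_x (h n x)%:E)).
  rewrite -monotone_convergence//=.
  - by apply: eq_integral => x _; apply/esym/cvg_lim.
  - by move=> n; exact/measurable_EFinP.
  - by move=> n x _; rewrite lee_fin.
  - by move=> x _ a b ab; rewrite lee_fin ndh.
under eq_fun do rewrite ge0_integral_density_nnsfun.
rewrite -monotone_convergence//=.
- apply: eq_integral => x _; apply/cvg_lim => //.
  exact: (cvgeZr _ (cvgh x)).
- by move=> n; apply: emeasurable_funM; exact/measurable_EFinP.
- by move=> n x _; rewrite mule_ge0 ?lee_fin//.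
- by move=> x _ a b ab; rewrite lee_wpmul2r ?lee_fin//; exact: ndh.
Qed.

End density.

Section affine_line.
Context {R : realType}.
Implicit Types a m x : R.
Local Notation mu := (@lebesgue_measure R).

Definition affine1 a m (x : measurableTypeR R) : measurableTypeR R :=
  a * (x : R) + m.

Lemma measurable_affine1 a m : measurable_fun setT (affine1 a m).
Proof. by apply: measurable_funD => //; apply: measurable_funM. Qed.

HB.instance Definition _ a m :=
  isMeasurableFun.Build _ _ _ _ (affine1 a m) (measurable_affine1 a m).

(** Uniqueness of Lebesgue measure: the image measure scaled by [|a|] gives every interval []u, v]]
    its length. For negative [a] the preimage is closed at the other end, which does not affect the
    length. *)
Lemma lebesgue_measure_affine1 a m (B : set (measurableTypeR R)) : a != 0 ->
  measurable B ->
  mu (affine1 a m @^-1` B) = (`|a|^-1%:E * mu B)%E.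
Proof.
move=> a0 mB; pose k : {nonneg R} := NngNum (normr_ge0 a).
have a1 : (`|a|^-1%:E * `|a|%:E = 1 :> \bar R)%E.
  by rewrite -EFinM mulVf// normr_eq0.
suff /(_ (measurable_affine1 a m)) -> :
    mu B = mscale k (pushforward mu (affine1 a m)) B.
  by rewrite /mscale/= muleA a1 mul1e.
move=> ?; apply: lebesgue_measure_unique => //= _ [[u v]] _ <-.
rewrite /mscale/= -[pushforward _ _ _]/(mu (affine1 a m @^-1` `]u, v])).
have [a_gt0|a_le0] := ltP 0 a.
  rewrite (_ : _ @^-1` _ = `](u - m) / a, (v - m) / a]%classic); last first.
    apply/seteqP; split => x /=; rewrite !in_itv/= /affine1.
      by rewrite ltr_pdivrMr// ler_pdivlMr// ltrBlDr lerBrDr mulrC.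
    by rewrite ltr_pdivrMr// ler_pdivlMr// ltrBlDr lerBrDr mulrC.
  rewrite !lebesgue_measure_itv/= !lte_fin ltr_pM2r ?invr_gt0// ltrD2r.
  case: ifPn => _; last by rewrite mule0.
  by rewrite -!EFinD -EFinM gtr0_norm//; congr EFin; field.
have a_lt0 : a < 0 by rewrite lt_neqAle a0.
rewrite (_ : _ @^-1` _ = `[(v - m) / a, (u - m) / a[%classic); last first.
  apply/seteqP; split => x /=; rewrite !in_itv/= /affine1.
    by rewrite ltr_ndivlMr// ler_ndivrMr// ltrBlDr lerBrDr mulrC andbC.
  by rewrite ltr_ndivlMr// ler_ndivrMr// ltrBlDr lerBrDr mulrC andbC.
rewrite !lebesgue_measure_itv/= !lte_fin ltr_nM2r ?invr_lt0// ltrD2r.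
case: ifPn => _; last by rewrite mule0.
by rewrite -!EFinD -EFinM ltr0_norm//; congr EFin; field.
Qed.

Lemma ge0_integral_affine1 a m (f : measurableTypeR R -> \bar R) : a != 0 ->
  measurable_fun setT f -> (forall x, 0 <= f x)%E ->
  (\int[mu]_x f (affine1 a m x) = `|a|^-1%:E * \int[mu]_x f x)%E.
Proof.
move=> a0 mf f0.
have k0 : 0 <= `|a|^-1 by rewrite invr_ge0.
pose k : {nonneg R} := NngNum k0.
have -> : (\int[mu]_x f (affine1 a m x))%E
    = (\int[pushforward mu (affine1 a m)]_x f x)%E.
  by rewrite ge0_integral_pushforward.
rewrite -(@ge0_integral_mscale _ _ _ mu setT measurableT k)//.
apply: eq_measure_integral => B mB _.
by rewrite /= /mscale/= -(lebesgue_measure_affine1 m).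
Qed.

Lemma ge0_integral_normal_prob m s (f : measurableTypeR R -> \bar R) :
  measurable_fun setT f -> (forall x, 0 <= f x)%E ->
  (\int[normal_prob m s]_x f x = \int[mu]_x (f x * (normal_pdf m s x)%:E))%E.
Proof.
move=> mf f0; apply: ge0_integral_density => //.
- exact: measurable_normal_pdf.
- exact: normal_pdf_ge0.
Qed.

Lemma normal_pdf_affine1 a m x : a != 0 ->
  `|a| * normal_pdf m a (affine1 a m x) = normal_pdf 0 1 x.
Proof.
move=> a0; rewrite !normal_pdfE ?oner_neq0// /normal_peak /normal_fun /affine1.
rewrite addrK subr0 mulrA; congr (_ * expR _); last by field.
rewrite expr1n mul1r -mulrnAr sqrtrM ?sqr_ge0// sqrtr_sqr invfM mulrA.
by rewrite divff ?normr_eq0// mul1r.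
Qed.

(** [a] may be negative, since the normal density depends on its scale through the square only. *)
Lemma ge0_integral_normal_affine1 a m (f : measurableTypeR R -> \bar R) :
  a != 0 -> measurable_fun setT f -> (forall x, 0 <= f x)%E ->
  (\int[normal_prob 0 1]_x f (affine1 a m x) = \int[normal_prob m a]_x f x)%E.
Proof.
move=> a0 mf f0; rewrite !ge0_integral_normal_prob//; last first.
  exact: measurableT_comp.
have a_gt0 : 0 < `|a| by rewrite normr_gt0.
under eq_integral do rewrite -(normal_pdf_affine1 m _ a0).
rewrite (ge0_integral_affine1 m (f := fun x =>
    (f x * (`|a| * normal_pdf m a x)%:E)%E))//.
- under eq_integral do rewrite EFinM muleCA.
  rewrite ge0_integralZl ?lee_fin//.
  + by rewrite muleA -EFinM mulVf ?gt_eqF// mul1e.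
  + apply: emeasurable_funM => //; apply/measurable_EFinP.
    exact: measurable_normal_pdf.
  + by move=> x _; rewrite mule_ge0// lee_fin normal_pdf_ge0.
- apply: emeasurable_funM => //; apply/measurable_EFinP.
  by apply: measurable_funM => //; exact: measurable_normal_pdf.
- by move=> x; rewrite mule_ge0// lee_fin mulr_ge0// normal_pdf_ge0.
Qed.

End affine_line.

(** * Rotation invariance in two coordinates *)

Section std_gaussian_theory.
Context {R : realType}.
Local Notation N := (normal_prob (0 : R) 1).
Local Notation mu := (@lebesgue_measure R).
Local Open Scope ereal_scope.
Local Notation T := (measurableTypeR R).

Lemma normal_prob_sqr1 (s : R) : (s ^+ 2 = 1)%R -> normal_prob 0%R s = N.
Proof.
move=> s1; have s0 : (s != 0)%R.
  by apply: contra_eq_neq s1 => ->; rewrite expr0n/= eq_sym oner_eq0.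
apply/funext => B; apply: eq_integral => x _.
by rewrite !normal_pdfE ?oner_neq0// /normal_peak /normal_fun s1 expr1n.
Qed.

Lemma ge0_integral_normal_sign (s : R) (f : T -> \bar R) : (s ^+ 2 = 1)%R ->
  measurable_fun setT f -> (forall x, 0 <= f x) ->
  \int[N]_x f (s * x)%R = \int[N]_x f x.
Proof.
move=> s1 mf f0; have s0 : (s != 0)%R.
  by apply: contra_eq_neq s1 => ->; rewrite expr0n/= eq_sym oner_eq0.
transitivity (\int[N]_x f (affine1 s 0 x)).
  by apply: eq_integral => x _; rewrite /affine1 addr0.
apply: etrans (ge0_integral_normal_affine1 0 s0 mf f0) _.
apply: eq_measure_integral => A _ _.
exact: (congr1 (fun h => h A) (normal_prob_sqr1 s1)).
Qed.

(** Both sides are the joint density of two standard normal variables with correlation [s], factored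
    by conditioning on one or on the other. *)
Lemma normal_pdf_rotation (c s u y : R) : (c != 0)%R -> (c ^+ 2 + s ^+ 2 = 1)%R ->
  (normal_pdf (s * y) c u * normal_pdf 0 1 y =
   normal_pdf 0 1 u * normal_pdf (s * u) c y)%R.
Proof.
move=> c0 cs; rewrite !normal_pdfE ?oner_neq0// /normal_fun.
set p := normal_peak c; set q := normal_peak 1.
rewrite mulrACA [RHS]mulrACA (mulrC p q) -!expRD; congr (_ * expR _)%R.
have s2 : (s ^+ 2 = 1 - c ^+ 2)%R by rewrite -cs; ring.
have E (a b : R) : (- (a - s * b) ^+ 2 / (c ^+ 2 *+ 2) +
    - (b - 0) ^+ 2 / (1 ^+ 2 *+ 2) =
    - (a ^+ 2 - 2 * s * a * b + b ^+ 2) / (c ^+ 2 *+ 2))%R.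
  rewrite -[X in (_ + X)%R](@mulfK _ (c ^+ 2 *+ 2)%R); last first.
    by rewrite mulrn_eq0/= sqrf_eq0.
  rewrite -mulrDl; congr (_ / _)%R.
  rewrite (_ : (a - s * b) ^+ 2 = a ^+ 2 - 2 * s * a * b + s ^+ 2 * b ^+ 2)%R; last by ring.
  by rewrite s2; field.
apply: (etrans (E u y)); rewrite [RHS]addrC; apply/esym/(etrans (E y u)).
by congr (_ / _)%R; ring.
Qed.

(** One variable is changed at a time. For fixed [y] the map from [x] to [c x + s y] turns N(0, 1)
    into N(s y, c^2); [normal_pdf_rotation] exchanges the roles of the coordinates, and a second
    affine change, now in [y], restores the product law. *)
Lemma ge0_integral_rotation (c s : R)
    (f : measurableTypeR R * measurableTypeR R -> \bar R) :
  (c ^+ 2 + s ^+ 2 = 1)%R -> measurable_fun setT f -> (forall x, 0 <= f x) ->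
  \int[N]_x \int[N]_y f ((c * x + s * y)%R, (c * y - s * x)%R) =
  \int[N]_x \int[N]_y f (x, y).
Proof.
move=> cs mf f0.
have mpdf m a : measurable_fun setT (fun x : T => (normal_pdf m a x)%:E).
  by apply/measurable_EFinP; exact: measurable_normal_pdf.
have swapN (g : T * T -> \bar R) :
    measurable_fun setT g -> (forall z, 0 <= g z) ->
    \int[N]_x \int[N]_y g (x, y) = \int[N]_y \int[N]_x g (x, y).
  exact: fubini_tonelli.
have swapmu (g : T * T -> \bar R) :
    measurable_fun setT g -> (forall z, 0 <= g z) ->
    \int[mu]_x \int[mu]_y g (x, y) = \int[mu]_y \int[mu]_x g (x, y).
  exact: fubini_tonelli.
have mlin a b : measurable_fun setT (fun z : T * T => (a * z.1 + b * z.2)%R : T).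
  by apply: measurable_funD; apply: measurable_funM => //.
have sl1 (g : T * T -> \bar R) (mg : measurable_fun setT g) x :
    measurable_fun setT (fun y => g (x, y)).
  by apply: (measurableT_comp mg); exact: measurable_fun_pair.
have sl2 (g : T * T -> \bar R) (mg : measurable_fun setT g) y :
    measurable_fun setT (fun x => g (x, y)).
  by apply: (measurableT_comp mg); exact: measurable_fun_pair.
(* A quarter turn: the affine change in [x] degenerates, but the map is a swap of the coordinates
   with a sign. *)
have [c0|c0] := eqVneq c 0%R.
  have s1 : (s ^+ 2 = 1)%R by move: cs; rewrite c0 expr0n/= add0r.
    pose g (z : T * T) := f (z.2, - s * z.1 + 0 * z.2)%R.
  have mg : measurable_fun setT g.
    by apply: (measurableT_comp mf); exact: measurable_fun_pair.
  have g0 z : 0 <= g z by exact: f0.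
  transitivity (\int[N]_x \int[N]_y g (x, y)).
    apply: eq_integral => x _.
    apply: etrans (ge0_integral_normal_sign s1 (sl1 _ mg x) (fun y => g0 (x, y))).
    apply: eq_integral => y _; rewrite c0 /g/=.
    by rewrite !mul0r add0r sub0r !addr0 mulNr.
  apply: etrans (swapN _ mg g0) _.
  apply: eq_integral => y _.
  have s1' : ((- s) ^+ 2 = 1)%R by rewrite sqrrN.
  apply: etrans (ge0_integral_normal_sign s1' (sl1 _ mf y) (fun x => f0 (y, x))).
  by apply: eq_integral => x _; rewrite /g/= mul0r addr0.
(* [g] reads [f] in the coordinates [u = c x + s y] and [y], in which the second rotated coordinate
   is [(y - s u) / c]. *)
pose g (z : T * T) : \bar R := f (z.1, (- (s / c) * z.1 + c^-1 * z.2)%R).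
have mg : measurable_fun setT g.
  by apply: (measurableT_comp mf); exact: measurable_fun_pair.
have g0 z : 0 <= g z by exact: f0.
transitivity (\int[N]_y \int[N]_x f (c * x + s * y, - s * x + c * y)%R).
  pose fr (z : T * T) := f (c * z.1 + s * z.2, - s * z.1 + c * z.2)%R.
  have mfr : measurable_fun setT fr.
    by apply: (measurableT_comp mf); exact: measurable_fun_pair.
  apply: etrans (swapN fr mfr (fun z => f0 _)).
  apply: eq_integral => x _; apply: eq_integral => y _.
  by rewrite /fr/= mulNr [(- _ + _)%R]addrC.
transitivity (\int[N]_y \int[normal_prob (s * y)%R c]_x g (x, y)).
  apply: eq_integral => y _.
  apply: etrans (ge0_integral_normal_affine1 _ c0 (sl2 _ mg y) (fun x => g0 (x, y))).
  apply: eq_integral => x _; rewrite /g /affine1/=; congr (f (_, _)).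
  have -> : (c^-1 * y = c^-1 * (c ^+ 2 + s ^+ 2) * y)%R by rewrite cs mulr1.
  by field.
pose h (z : T * T) := (normal_pdf (s * z.2) c z.1 * normal_pdf 0 1 z.2)%R.
pose h' (z : T * T) := (normal_pdf 0 1 z.1 * normal_pdf (s * z.1) c z.2)%R.
have hh' z : h z = h' z by exact: normal_pdf_rotation.
have h'0 z : (0 <= h' z)%R by rewrite mulr_ge0// normal_pdf_ge0.
have mh' : measurable_fun setT h'.
  apply: measurable_funM.
    by apply: (measurableT_comp (measurable_normal_pdf 0%R 1%R)).
  rewrite [X in measurable_fun _ X](_ : _ = fun z : T * T =>
      normal_pdf 0 c (- s * z.1 + 1 * z.2)%R); last first.
    apply/funext => z; rewrite !normal_pdfE// /normal_fun; congr (_ * expR _)%R.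
    by congr (_ / _)%R; ring.
  exact: (measurableT_comp (measurable_normal_pdf 0%R c) (mlin _ _)).
have mgh' : measurable_fun setT (fun z => g z * (h' z)%:E).
  by apply: emeasurable_funM => //; exact/measurable_EFinP.
have gh'0 z : 0 <= g z * (h' z)%:E by rewrite mule_ge0// lee_fin.
transitivity (\int[mu]_y \int[mu]_x (g (x, y) * (h' (x, y))%:E)).
  apply: etrans (ge0_integral_normal_prob _ _ _ _) _.
  - pose k (z : T * T) := g (c * z.1 + s * z.2, z.2)%R.
    have mk : measurable_fun setT k.
      by apply: (measurableT_comp mg); exact: measurable_fun_pair.
    rewrite [X in measurable_fun _ X](_ : _ = fun y => \int[N]_x k (x, y)).
      by apply: (measurable_fun_fubini_tonelli_G (m1 := N) k) => // z; exact: g0.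
    apply/funext => y; apply/esym.
    exact: (ge0_integral_normal_affine1 (s * y)%R c0 (sl2 _ mg y) (fun x => g0 (x, y))).
  - by move=> y; exact: integral_ge0.
  apply: eq_integral => y _.
  rewrite (ge0_integral_normal_prob _ _ (sl2 _ mg y) (fun x => g0 (x, y))).
  rewrite -ge0_integralZr//; last 3 first.
  - by apply: emeasurable_funM => //; exact: sl2.
  - by move=> x _; rewrite mule_ge0// lee_fin normal_pdf_ge0.
  - by rewrite lee_fin normal_pdf_ge0.
  by apply: eq_integral => x _; rewrite -hh' EFinM muleA.
apply: etrans (esym (swapmu _ mgh' gh'0)) _.
transitivity (\int[N]_x \int[normal_prob (s * x)%R c]_y g (x, y)).
  apply/esym; apply: etrans (ge0_integral_normal_prob _ _ _ _) _.
  - pose k (z : T * T) := g (z.1, c * z.2 + s * z.1)%R.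
    have mk : measurable_fun setT k.
      apply: (measurableT_comp mg); apply: measurable_fun_pair => //.
      by apply: measurable_funD; apply: measurable_funM.
    rewrite [X in measurable_fun _ X](_ : _ = fun x => \int[N]_y k (x, y)).
      by apply: (measurable_fun_fubini_tonelli_F (m2 := N) k) => // z; exact: g0.
    apply/funext => x; apply/esym.
    exact: (ge0_integral_normal_affine1 (s * x)%R c0 (sl1 _ mg x) (fun y => g0 (x, y))).
  - by move=> y; exact: integral_ge0.
  apply: eq_integral => y _.
  rewrite (ge0_integral_normal_prob _ _ (sl1 _ mg y) (fun x => g0 (y, x))).
  rewrite -ge0_integralZr//; last 3 first.
  - by apply: emeasurable_funM => //; exact: sl1.
  - by move=> x _; rewrite mule_ge0// lee_fin normal_pdf_ge0.
  - by rewrite lee_fin normal_pdf_ge0.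
  by apply: eq_integral => x _; rewrite EFinM muleA muleAC.
apply: eq_integral => x _.
apply/esym; apply: etrans (ge0_integral_normal_affine1 _ c0 (sl1 _ mg x) (fun y => g0 (x, y))).
apply: eq_integral => y _; rewrite /g /affine1/=; congr (f (_, _)).
by field.
Qed.

Lemma ge0_integral_std_gaussianS n (f : 'cV[R]_n.+1 -> \bar R) :
  measurable_fun setT f -> (forall x, 0 <= f x) ->
  \int[std_gaussian n.+1]_z f z =
  \int[N]_x \int[std_gaussian n]_z f (cV_cons (x, z)).
Proof.
move=> mf f0; rewrite ge0_integral_distribution// fubini_tonelli1//; last by move=> z; exact: f0.
exact: measurableT_comp.
Qed.

Lemma ge0_integral_std_gaussianS' n (f : 'cV[R]_n.+1 -> \bar R) :
  measurable_fun setT f -> (forall x, 0 <= f x) ->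
  \int[std_gaussian n.+1]_z f z =
  \int[std_gaussian n]_z \int[N]_x f (cV_cons (x, z)).
Proof.
move=> mf f0; rewrite ge0_integral_distribution// fubini_tonelli2//; last by move=> z; exact: f0.
exact: measurableT_comp.
Qed.

End std_gaussian_theory.

Section measurable_matrix_ops.
Context {R : realType}.

Lemma measurable_mulmx m n (L : 'M[R]_(m, n)) :
  measurable_fun setT (fun z : 'cV[R]_n => L *m z).
Proof.
apply: measurable_matrixP => i j; under eq_fun do rewrite mxE.
apply: measurable_sum => l; apply: measurable_funM => //.
exact: measurable_entry.
Qed.

Lemma measurable_addmx m (a : 'cV[R]_m) :
  measurable_fun setT (fun z : 'cV[R]_m => a + z).
Proof.
apply: measurable_matrixP => i j; under eq_fun do rewrite mxE.
by apply: measurable_funD => //; exact: measurable_entry.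
Qed.

Lemma measurable_col_mx m n (a : 'cV[R]_m) :
  measurable_fun setT (fun z : 'cV[R]_n => col_mx a z).
Proof.
apply: measurable_matrixP => i j; case: (split_ordP i) => i' ->.
  by under eq_fun do rewrite col_mxEu; exact: measurable_cst.
by under eq_fun do rewrite col_mxEd; exact: measurable_entry.
Qed.

Lemma measurable_cV_consl n (x : measurableTypeR R) :
  measurable_fun setT (fun z : 'cV[R]_n => cV_cons (x, z)).
Proof.
apply: (measurableT_comp (@measurable_cV_cons R n)).
exact: measurable_fun_pair.
Qed.

Lemma measurable_cV_consr n (z : 'cV[R]_n) :
  measurable_fun setT (fun x : measurableTypeR R => cV_cons (x, z)).
Proof.
apply: (measurableT_comp (@measurable_cV_cons R n)).
exact: measurable_fun_pair.
Qed.

End measurable_matrix_ops.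

Lemma block_cV_cons (R : realType) m n (a : R) (b : 'rV[R]_n) (c : 'cV[R]_m)
    (D : 'M[R]_(m, n)) (x : measurableTypeR R) (z : 'cV[R]_n) :
  (block_mx a%:M b c D : 'M[R]_(m.+1, n.+1)) *m cV_cons (x, z) =
  cV_cons (a * (x : R) + (b *m z) 0 0 : measurableTypeR R, (x : R) *: c + D *m z).
Proof.
rewrite (mul_block_col a%:M b c D ((x : R)%:M) z) /cV_cons/=.
by rewrite [c *m _]mul_mx_scalar -scalar_mxM [in LHS](mx11_scalar (b *m z)) -raddfD.
Qed.

Lemma block_cV_cons0 (R : realType) m n (a : R) (c : 'cV[R]_m)
    (D : 'M[R]_(m, n)) (x : measurableTypeR R) (z : 'cV[R]_n) :
  (block_mx a%:M 0 c D : 'M[R]_(m.+1, n.+1)) *m cV_cons (x, z) =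
  cV_cons (a * (x : R) : measurableTypeR R, (x : R) *: c + D *m z).
Proof. by rewrite block_cV_cons mul0mx mxE addr0. Qed.

(** * Laws of linear images of a Gaussian vector *)

Section gaussian_law.
Context {R : realType}.
Local Notation N := (normal_prob (0 : R) 1).
Local Notation T := (measurableTypeR R).
Local Open Scope ereal_scope.

Definition gaussian_invariant n (U : 'M[R]_n) := forall f : 'cV[R]_n -> \bar R,
  measurable_fun setT f -> (forall x, 0 <= f x) ->
  \int[std_gaussian n]_z f (U *m z) = \int[std_gaussian n]_z f z.

Lemma gaussian_invariantM n (U V : 'M[R]_n) :
  gaussian_invariant U -> gaussian_invariant V -> gaussian_invariant (U *m V).
Proof.
move=> iU iV f mf f0; rewrite -(iU _ mf f0) -(iV (fun z => f (U *m z)))//.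
  by apply: eq_integral => z _; rewrite mulmxA.
exact: (measurableT_comp mf (measurable_mulmx U)).
Qed.

Lemma gaussian_invariant_lift n (U : 'M[R]_n) : gaussian_invariant U ->
  @gaussian_invariant (1 + n) (block_mx 1%:M 0 0 U).
Proof.
move=> iU f mf f0; rewrite (ge0_integral_std_gaussianS mf f0).
apply: etrans (ge0_integral_std_gaussianS
  (measurableT_comp mf (measurable_mulmx _)) (fun z => f0 _)) _.
apply: eq_integral => x _.
apply: etrans (iU (fun z => f (cV_cons (x, z)))
  (measurableT_comp mf (measurable_cV_consl x)) (fun z => f0 _)).
apply: eq_integral => z _; congr (f _).
by rewrite block_cV_cons mul1r mul0mx mxE addr0 scaler0 add0r.
Qed.

Definition givens n (c s : R) : 'M[R]_(1 + (1 + n)) :=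
  block_mx c%:M (row_mx (- s)%:M 0)
           (col_mx s%:M 0) (block_mx c%:M 0 0 1%:M).

Lemma givens_orthogonal n (c s : R) : (c ^+ 2 + s ^+ 2 = 1)%R ->
  givens n c s *m (givens n c s)^T = 1%:M.
Proof.
move=> cs; rewrite /givens tr_block_mx tr_row_mx tr_col_mx tr_block_mx.
rewrite !trmx0 !tr_scalar_mx mulmx_block mul_row_col mul_mx_row mul_row_block.
rewrite mul_col_mx mul_block_col mul_col_row mulmx_block.
rewrite !mul0mx !mulmx0 !mulmx1 !addr0 !add0r -!scalar_mxM.
rewrite add_row_mx add_col_mx add_block_mx !addr0 ?add0r -!raddfD/=.
have -> : (c * c + - s * - s = 1)%R by rewrite -cs; ring.
have -> : (s * s + c * c = 1)%R by rewrite -cs; ring.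
have -> : (c * s + - s * c = 0)%R by ring.
have -> : (s * c + c * - s = 0)%R by ring.
by rewrite !raddf0 row_mx0 col_mx0 -!scalar_mx_block.
Qed.

Lemma givens_col n (c s x y : R) (w : 'cV[R]_n) :
  givens n c s *m cV_cons (x, cV_cons (y, w)) =
  cV_cons ((c * x - s * y)%R, cV_cons ((c * y + s * x)%R, w)).
Proof.
rewrite /givens /cV_cons/= mul_block_col mul_row_col mul_col_mx mul_block_col.
rewrite !mul0mx !mul1mx !addr0 !add0r -!scalar_mxM -raddfD/= mulNr.
by rewrite add_col_mx add0r -raddfD/= [(s * x + _)%R]addrC.
Qed.

Lemma lift_orthogonal n (U : 'M[R]_n) : U *m U^T = 1%:M ->
  block_mx 1%:M 0 0 U *m (block_mx 1%:M 0 0 U)^T = 1%:M :> 'M[R]_(1 + n).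
Proof.
move=> U1; rewrite tr_block_mx mulmx_block !trmx0 trmx1 !mulmx0 !mul0mx !addr0 !add0r.
by rewrite mul1mx U1 -scalar_mx_block.
Qed.

Lemma lift_row n (a : R) (l : 'rV[R]_n) (U : 'M[R]_n) :
  row_mx a%:M l *m block_mx 1%:M 0 0 U = row_mx a%:M (l *m U).
Proof. by rewrite mul_row_block mulmx1 !mulmx0 addr0 add0r. Qed.

Lemma givens_row n (c s a b : R) (w : 'rV[R]_n) :
  row_mx a%:M (row_mx b%:M w) *m givens n c s =
  row_mx (a * c + b * s)%:M (row_mx (b * c + a * - s)%:M w).
Proof.
rewrite /givens mul_row_block mul_row_col mul_mx_row mul_row_block.
rewrite !mulmx0 !addr0 ?add0r mulmx1 -!scalar_mxM -raddfD/= add_row_mx add0r.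
by rewrite -raddfD/= [(a * - s + _)%R]addrC.
Qed.

Lemma row_sqr_ge0 n (v : 'rV[R]_n) : (0 <= (v *m v^T) 0 0)%R.
Proof. by rewrite mxE sumr_ge0// => i _; rewrite mxE -expr2 sqr_ge0. Qed.

Lemma row_sqr_eq0 n (v : 'rV[R]_n) : ((v *m v^T) 0 0 = 0)%R -> v = 0%R.
Proof.
move=> /eqP; rewrite mxE psumr_eq0 => [/allP v0|j _]; last first.
  by rewrite mxE -expr2 sqr_ge0.
apply/rowP => i; have := v0 i; rewrite mem_index_enum !mxE mulf_eq0 orbb.
by move=> /(_ isT)/eqP.
Qed.

Lemma row_mx_sqr n (a : R) (l : 'rV[R]_n) :
  ((row_mx a%:M l *m (row_mx a%:M l)^T) 0 0 = a ^+ 2 + (l *m l^T) 0 0)%R.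
Proof.
rewrite tr_row_mx mul_row_col tr_scalar_mx -scalar_mxM mxE.
by rewrite mxE eqxx mulr1n.
Qed.

Lemma gaussian_invariant_givens n (c s : R) : (c ^+ 2 + s ^+ 2 = 1)%R ->
  gaussian_invariant (givens n c s).
Proof.
move=> cs f mf f0.
pose h (z : T * T) := \int[std_gaussian n]_w f (cV_cons (z.1, cV_cons (z.2, w))).
have mcons (x : T) : measurable_fun setT (fun z : 'cV[R]_n.+1 => f (cV_cons (x, z))).
  exact: (measurableT_comp mf (measurable_cV_consl _)).
have mU := measurableT_comp mf (measurable_mulmx (givens n c s)).
have gE g : measurable_fun setT g -> (forall x, 0 <= g x) ->
    \int[std_gaussian n.+2]_z g z = \int[N]_x \int[N]_y
      \int[std_gaussian n]_w g (cV_cons (x, cV_cons (y, w))).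
  move=> mg g0; rewrite (ge0_integral_std_gaussianS mg g0).
  apply: eq_integral => x _.
  exact: (ge0_integral_std_gaussianS
    (measurableT_comp mg (measurable_cV_consl x)) (fun z => g0 _)).
apply: etrans (gE _ mU (fun z => f0 _)) _; rewrite (gE _ mf f0).
have mh : measurable_fun setT h.
  pose k (zw : (T * T) * 'cV[R]_n) := f (cV_cons (zw.1.1, cV_cons (zw.1.2, zw.2))).
  apply: (measurable_fun_fubini_tonelli_F (m2 := std_gaussian n) k) => //.
    apply: (measurableT_comp mf); apply: (measurableT_comp (@measurable_cV_cons R n.+1)).
    apply: measurable_fun_pair; first exact: measurableT_comp.
    apply: (measurableT_comp (@measurable_cV_cons R n)).
    by apply: measurable_fun_pair => //; exact: measurableT_comp.
  by move=> z; exact: f0.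
have h0 z : 0 <= h z by apply: integral_ge0 => w _; exact: f0.
have cs' : (c ^+ 2 + (- s) ^+ 2 = 1)%R by rewrite sqrrN.
apply: etrans (ge0_integral_rotation cs' mh h0).
apply: eq_integral => x _; apply: eq_integral => y _; rewrite /h/=.
by apply: eq_integral => w _; rewrite givens_col mulNr mulNr opprK.
Qed.

(* By rotations of two coordinates at a time. *)
Lemma row_rotation n (l : 'rV[R]_n.+1) : exists U : 'M[R]_n.+1,
  [/\ U *m U^T = 1%:M, gaussian_invariant U &
      l *m U = row_mx (Num.sqrt ((l *m l^T) 0 0)%R)%:M (0%R : 'rV_n)].
Proof.
have row1 (b : R) : row_mx b%:M (0%R : 'rV_0) = b%:M :> 'rV_1.
  apply/rowP => i; have -> : i = @lshift 1 0 0%R by rewrite ord1; exact: val_inj.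
  by rewrite (row_mxEl b%:M) !mxE.
elim: n l => [|n IHn] l.
  pose a := l 0%R 0%R.
  have la : l = a%:M by rewrite [LHS]mx11_scalar.
  have [a0|a0] := leP 0%R a.
    exists 1%:M; split; first by rewrite trmx1 mulmx1.
      by move=> f mf f0; under eq_integral do rewrite mul1mx.
    rewrite mulmx1 la tr_scalar_mx -scalar_mxM mxE eqxx mulr1n -expr2 sqrtr_sqr.
    by rewrite ger0_norm// row1.
  (* The target entry is a nonnegative square root, so a negative entry calls for a reflection. *)
  exists (-1)%:M; split => //=.
  - by rewrite tr_scalar_mx -scalar_mxM mulrNN mulr1.
  - move=> f mf f0; rewrite (ge0_integral_std_gaussianS' mf f0).
    apply: etrans (ge0_integral_std_gaussianS'
      (measurableT_comp mf (measurable_mulmx _)) (fun z => f0 _)) _.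
    apply: eq_integral => z _; have N1 : ((-1) ^+ 2 = 1 :> R)%R by rewrite sqrrN expr1n.
    apply: etrans (ge0_integral_normal_sign N1
      (measurableT_comp mf (measurable_cV_consr z)) (fun x => f0 _)).
    apply: eq_integral => x _; congr (f _).
    rewrite (_ : (-1)%:M = block_mx (-1)%:M 0 0 0 :> 'M[R]_(1 + 0)); last first.
      rewrite -[LHS]submxK; congr block_mx; apply/matrixP => i j.
      - by rewrite !mxE.
      - by case: j.
      - by case: i.
      - by case: i.
    by rewrite block_cV_cons mul0mx mxE addr0 scaler0 add0r mul0mx [z]flatmx0.
  - rewrite la tr_scalar_mx -!scalar_mxM mxE eqxx mulr1n -expr2 sqrtr_sqr.
    by rewrite ltr0_norm// mulrN1 row1.
pose a := l 0%R 0%R; pose l' : 'rV[R]_n.+1 := rsubmx (l : 'rV_(1 + n.+1)).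
have lE : l = row_mx a%:M l'.
  have <- : lsubmx (l : 'rV_(1 + n.+1)) = a%:M.
    rewrite [LHS]mx11_scalar mxE /a; congr (l _ _)%:M; exact: val_inj.
  by rewrite hsubmxK.
have [U' [U'1 iU' lU']] := IHn l'; move: lU'; set r' := Num.sqrt _ => lU'.
set r := Num.sqrt _.
have r2 : (r ^+ 2 = a ^+ 2 + r' ^+ 2)%R.
  by rewrite !sqr_sqrtr ?row_sqr_ge0// lE (row_mx_sqr a l').
(* [(c, s)] is the direction of [(a, r')], so the rotation moves all of this vector into the first
   entry. If [r = 0] both entries vanish already and the rotation is the identity. *)
pose c := if r == 0%R then 1%R else (a / r)%R.
pose s := if r == 0%R then 0%R else (r' / r)%R.
have cs : (c ^+ 2 + s ^+ 2 = 1)%R.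
  rewrite /c /s; case: eqVneq => r0; first by rewrite expr1n expr0n addr0.
  by rewrite !exprMn -mulrDl -r2 -exprMn divff// expr1n.
have cr : (a * c + r' * s = r)%R.
  rewrite /c /s; case: eqVneq => r0; last first.
    rewrite !mulrA -mulrDl (_ : (a * a + r' * r' = r * r)%R) ?mulfK//; exact: (esym r2).
  rewrite mulr1 mulr0 addr0.
  have := r2; rewrite r0 expr0n/= => /esym/eqP.
  by rewrite paddr_eq0 ?sqr_ge0// !sqrf_eq0 => /andP[/eqP ->].
have sr : (r' * c = a * s)%R.
  rewrite /c /s; case: eqVneq => r0; last by rewrite mulrCA.
  rewrite mulr1 mulr0.
  have := r2; rewrite r0 expr0n/= => /esym/eqP.
  by rewrite paddr_eq0 ?sqr_ge0// !sqrf_eq0 => /andP[_ /eqP ->].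
exists (block_mx 1%:M 0 0 U' *m givens n c s : 'M[R]_(1 + (1 + n))); split.
- rewrite trmx_mul mulmxA -(mulmxA _ (givens n c s)) givens_orthogonal// mulmx1.
  exact: lift_orthogonal.
- apply: gaussian_invariantM; first exact: gaussian_invariant_lift.
  exact: gaussian_invariant_givens.
rewrite lE mulmxA (lift_row a l' U') lU' (givens_row c s a r' 0%R) cr.
by rewrite mulrN sr subrr raddf0 row_mx0.
Qed.

(* Column-reduces L by an orthogonal map: the first row becomes (r, 0) with r > 0,
   which determines the remaining first column from the first row of L L'. *)
Lemma row_reduction m n (l : 'rV[R]_(1 + n)) (K : 'M[R]_(m, 1 + n)) :
  let r := Num.sqrt ((l *m l^T) 0%R 0%R) in l != 0%R ->
  exists (U : 'M[R]_(1 + n)) (M : 'M[R]_(m, n)),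
   [/\ (0 < r)%R, U *m U^T = 1%:M, gaussian_invariant U,
      col_mx l K *m U = block_mx r%:M 0%R (r^-1 *: (K *m l^T)) M &
      M *m M^T = (K *m K^T - (r^-1 *: (K *m l^T)) *m (r^-1 *: (K *m l^T))^T)%R].
Proof.
move=> r l0; have r_gt0 : (0 < r)%R.
  rewrite lt_neqAle eq_sym sqrtr_ge0 andbT; apply: contra_neq l0 => r0.
  apply: row_sqr_eq0; have := congr1 (fun x => x ^+ 2)%R r0.
  by rewrite sqr_sqrtr ?row_sqr_ge0// => ->; rewrite expr0n.
have [U [U1 iU lU]] := @row_rotation n l; rewrite -/r in lU.
pose KU : 'M[R]_(m, 1 + n) := K *m U.
have lUT : U *m col_mx r%:M (0%R : 'cV_n) = l^T.
  have -> : col_mx r%:M 0%R = (row_mx r%:M 0%R)^T :> 'cV[R]_(1 + n).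
    by rewrite tr_row_mx tr_scalar_mx trmx0.
  by rewrite -lU trmx_mul mulmxA U1 mul1mx.
have KUr : KU *m col_mx r%:M 0%R = r *: lsubmx KU.
  by rewrite -{1}(hsubmxK KU) mul_row_col mulmx0 addr0 mul_mx_scalar.
have KUl : r^-1 *: (K *m l^T) = lsubmx KU.
  by rewrite -lUT mulmxA [X in r^-1 *: X]KUr scalerA mulVf ?gt_eqF// scale1r.
exists U, (rsubmx KU); split => //.
  by rewrite (mul_col_mx l K U) lU KUl -[RHS]/(col_mx (row_mx r%:M 0%R)
    (row_mx (lsubmx KU) (rsubmx KU))) hsubmxK.
have -> : K *m K^T = KU *m KU^T by rewrite trmx_mul mulmxA -(mulmxA K) U1 mulmx1.
by rewrite KUl -{3 4}(hsubmxK KU) tr_row_mx mul_row_col addrC addKr.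
Qed.

Lemma col_mx_sqr m n (l : 'rV[R]_n) (K : 'M[R]_(m, n)) :
  col_mx l K *m (col_mx l K)^T =
  block_mx (l *m l^T) (l *m K^T) (K *m l^T) (K *m K^T).
Proof. by rewrite tr_col_mx mul_col_row. Qed.

Lemma block_mx_sqr m n (r : R) (a : 'cV[R]_m) (N : 'M[R]_(m, n)) :
  block_mx r%:M 0 a N *m (block_mx r%:M 0 a N)^T =
  block_mx (r * r)%:M (r%:M *m a^T) (a *m r%:M) (a *m a^T + N *m N^T)%R.
Proof.
rewrite tr_block_mx mulmx_block !trmx0 tr_scalar_mx !mulmx0 !mul0mx !addr0.
by rewrite -scalar_mxM.
Qed.

Lemma col_mx_sqr_inj m n1 n2 (l1 : 'rV[R]_n1) (K1 : 'M[R]_(m, n1))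
    (l2 : 'rV[R]_n2) (K2 : 'M[R]_(m, n2)) :
  col_mx l1 K1 *m (col_mx l1 K1)^T = col_mx l2 K2 *m (col_mx l2 K2)^T ->
  [/\ l1 *m l1^T = l2 *m l2^T, K1 *m l1^T = K2 *m l2^T & K1 *m K1^T = K2 *m K2^T].
Proof. by rewrite !col_mx_sqr => /eq_block_mx[]. Qed.

(** Induction on the rows. A zero first row is dropped; otherwise [row_reduction] turns the first
    rows into [(r, 0)]. Equality of [L L'] forces the same [r] and the same first column, and the
    remaining blocks again have equal [M M'], so the induction hypothesis applies at each value of
    the first coordinate. *)
Lemma ge0_integral_gaussian_cov m n1 n2 (L1 : 'M[R]_(m, n1)) (L2 : 'M[R]_(m, n2))
    (f : 'cV[R]_m -> \bar R) :
  L1 *m L1^T = L2 *m L2^T -> measurable_fun setT f -> (forall x, 0 <= f x) ->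
  \int[std_gaussian n1]_z f (L1 *m z) = \int[std_gaussian n2]_z f (L2 *m z).
Proof.
elim: m n1 n2 L1 L2 f => [|m IHm] n1 n2 L1 L2 f.
  move=> _ mf f0; have E n (L : 'M[R]_(0, n)) (z : 'cV_n) : L *m z = 0%R.
    exact: flatmx0.
  under eq_integral do rewrite E; under [RHS]eq_integral do rewrite E.
  rewrite !integral_cst//; congr (_ * _).
  exact: etrans (probability_setT _) (esym (probability_setT _)).
rewrite -[L1](@vsubmxK _ 1 m) -[L2](@vsubmxK _ 1 m).
move: (usubmx _) (dsubmx _) (usubmx _) (dsubmx _) => l2 K2 l1 K1 {L1 L2}.
move=> /(@col_mx_sqr_inj m n1 n2 l1 K1 l2 K2)[ll Kl KK] mf f0.
have [l10|l1_neq0] := eqVneq l1 0%R.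
  have l20 : l2 = 0%R by apply: row_sqr_eq0; rewrite -ll l10 mul0mx mxE.
  have E0 n (K : 'M[R]_(m, n)) (z : 'cV[R]_n) :
      (col_mx (0%R : 'rV[R]_n) K : 'M[R]_(m.+1, n)) *m z = col_mx (0%R : 'cV[R]_1) (K *m z).
    by rewrite (mul_col_mx (0%R : 'rV[R]_n) K z) mul0mx.
  rewrite l10 l20; under eq_integral do rewrite E0.
  under [RHS]eq_integral do rewrite E0.
  apply: (IHm _ _ K1 K2 (fun w => f (col_mx (0%R : 'cV[R]_1) w)) KK) => [|w].
    exact: (measurableT_comp mf (@measurable_col_mx R 1 m 0%R)).
  exact: f0.
have l2_neq0 : l2 != 0%R.
  by apply: contra_neq l1_neq0 => l20; apply: row_sqr_eq0; rewrite ll l20 mul0mx mxE.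
case: n1 l1 K1 ll Kl KK l1_neq0 => [|n1] l1 K1 ll Kl KK l1_neq0.
  by rewrite [l1]thinmx0 eqxx in l1_neq0.
case: n2 l2 K2 ll Kl KK l2_neq0 => [|n2] l2 K2 ll Kl KK l2_neq0.
  by rewrite [l2]thinmx0 eqxx in l2_neq0.
have [U1 [M1 [r1 U11 iU1 LU1 MM1]]] := row_reduction K1 l1_neq0.
have [U2 [M2 [r2 U21 iU2 LU2 MM2]]] := row_reduction K2 l2_neq0.
have mL n (L : 'M[R]_(m.+1, n)) : measurable_fun setT (fun z => f (L *m z)).
  exact: (measurableT_comp mf (measurable_mulmx L)).
apply: etrans (esym (iU1 _ (mL _ _) (fun z => f0 _))) _.
apply: etrans _ (iU2 _ (mL _ _) (fun z => f0 _)).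
under eq_integral do rewrite mulmxA LU1.
under [RHS]eq_integral do rewrite mulmxA LU2.
apply: etrans (ge0_integral_std_gaussianS (mL _ _) (fun z => f0 _)) _.
apply/esym/(etrans (ge0_integral_std_gaussianS (mL _ _) (fun z => f0 _))).
apply: eq_integral => x _.
under eq_integral do rewrite block_cV_cons0.
under [RHS]eq_integral do rewrite block_cV_cons0.
have MM : M1 *m M1^T = M2 *m M2^T by rewrite MM1 MM2 KK ll Kl.
rewrite ll Kl.
pose a := (x *: ((Num.sqrt ((l2 *m l2^T) 0 0))^-1 *: (K2 *m l2^T)))%R.
apply/esym; apply: (IHm _ _ _ _ (fun w => f (cV_cons (_, a + w)%R))  MM _ (fun w => f0 _)).
exact: (measurableT_comp (measurableT_comp mf (measurable_cV_consl _))
    (measurable_addmx a)).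
Qed.

(** [cov_root] is a choice with default 0, so the content is that a square root exists. It is built
    as a Cholesky factor, one row reduction per row. *)
Lemma cov_rootP m n (M : 'M[R]_(m, n)) :
  cov_root (M *m M^T) *m (cov_root (M *m M^T))^T = M *m M^T.
Proof.
suff [L LM] : exists L : 'M[R]_m, L *m L^T = M *m M^T.
  by rewrite /cov_root; case: xgetP => [L0 _ //|/(_ L)].
elim: m n M => [|m IHm] n M; first by exists 0%R; rewrite [LHS]flatmx0 [RHS]flatmx0.
rewrite -[M](@vsubmxK _ 1 m); move: (usubmx _) (dsubmx _) => l K {M}.
have [l0|l0] := eqVneq l 0%R.
  have [L LK] := IHm _ K; exists (block_mx 0%R%:M 0 0 L : 'M[R]_(1 + m)).
  apply: etrans (block_mx_sqr _ _ _) _; apply/esym/(etrans (col_mx_sqr l K)).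
  by rewrite l0 LK !trmx0 !mulmx0 !mul0mx mul0r raddf0 add0r.
case: n l K l0 => [|n] l K l0; first by rewrite [l]thinmx0 eqxx in l0.
have [U [N [_ U1 _ LU _]]] := row_reduction K l0.
have [L LN] := IHm _ N; move: LU; set r := Num.sqrt _; set a := _ *: _ => LU.
exists (block_mx r%:M 0 a L : 'M[R]_(1 + m)).
have -> : col_mx l K *m (col_mx l K)^T =
    (block_mx r%:M 0%R a N) *m (block_mx r%:M 0%R a N)^T.
  by rewrite -LU trmx_mul mulmxA -(mulmxA _ U) U1 mulmx1.
apply: etrans (block_mx_sqr _ _ _) _; apply/esym/(etrans (block_mx_sqr _ _ _)).
by rewrite LN.
Qed.

End gaussian_law.

Section gaussian_sets.
Context {R : realType}.
Local Notation N := (normal_prob (0 : R) 1).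
Local Notation T := (measurableTypeR R).
Local Open Scope ereal_scope.

Lemma measurable_preimage d d' (S : measurableType d) (S' : measurableType d')
    (f : S -> S') (B : set S') :
  measurable_fun setT f -> measurable B -> measurable [set x | B (f x)].
Proof. by move=> mf mB; rewrite -[X in measurable X]setTI; exact: mf. Qed.

Lemma measurable_affine_mx m n (a : 'cV[R]_m) (L : 'M[R]_(m, n)) :
  measurable_fun setT (fun z : 'cV[R]_n => L *m z + a)%R.
Proof.
have -> : (fun z : 'cV[R]_n => L *m z + a)%R = affine a L.
  by apply/funext => z; rewrite addrC.
exact: measurable_affine.
Qed.

Lemma integral_indic_preimage d (S : measurableType d)
    (mu : {measure set S -> \bar R}) (A : set S) :
  measurable A -> \int[mu]_x (\1_A x)%:E = mu A.
Proof. by move=> mA; rewrite integral_indic// setIT. Qed.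

Lemma std_gaussian_cov m n1 n2 (L1 : 'M[R]_(m, n1)) (L2 : 'M[R]_(m, n2)) B :
  L1 *m L1^T = L2 *m L2^T -> measurable B ->
  std_gaussian n1 [set z | B (L1 *m z)] = std_gaussian n2 [set z | B (L2 *m z)].
Proof.
move=> LL mB.
have E n (L : 'M[R]_(m, n)) : std_gaussian n [set z | B (L *m z)] =
    \int[std_gaussian n]_z (\1_B (L *m z))%:E.
  rewrite -integral_indic_preimage//.
  exact: (measurable_preimage (measurable_mulmx L) mB).
rewrite !E; apply: (ge0_integral_gaussian_cov (f := fun w => (\1_B w)%:E) LL).
  by apply/measurable_EFinP; exact: measurable_indic.
by move=> x; rewrite lee_fin.
Qed.

Lemma gaussianE m (S : 'M[R]_m) (a : 'cV[R]_m) n (L : 'M[R]_(m, n)) B :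
  S = L *m L^T -> measurable B ->
  gaussian a S B = std_gaussian n [set z | B (L *m z + a)%R].
Proof.
move=> -> mB; have mB' : measurable [set w | B (w + a)%R].
  apply: measurable_preimage mB.
  by under eq_fun do rewrite addrC; exact: measurable_addmx.
transitivity (std_gaussian m [set z | B (cov_root (L *m L^T) *m z + a)%R]).
  rewrite /gaussian /distribution /pushforward; congr (std_gaussian m _).
  by apply/seteqP; split => z; rewrite /affine/= addrC.
exact: (std_gaussian_cov (cov_rootP L) mB').
Qed.

(** [(v z, W z)] has the same covariance as [(t x, W z)] with a separate standard normal [x], hence
    the same law. A degenerate [v z] is included, with [t = 0]. *)
Lemma ge0_integral_gaussian_uncorrelated m n (v : 'rV[R]_n) (W : 'M[R]_(m, n))
    (t : R) (f : 'cV[R]_m.+1 -> \bar R) :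
  W *m v^T = 0%R -> (v *m v^T) 0%R 0%R = (t ^+ 2)%R ->
  measurable_fun setT f -> (forall x, 0 <= f x) ->
  \int[std_gaussian n]_z f (cV_cons ((v *m z) 0%R 0%R : T, W *m z)) =
  \int[std_gaussian n]_z \int[N]_x f (cV_cons (t * x : T, W *m z)%R).
Proof.
move=> Wv vv mf f0.
have vW : v *m W^T = 0%R by rewrite -[LHS]trmxK trmx_mul trmxK Wv trmx0.
pose L2 : 'M[R]_(1 + m, 1 + n) := block_mx t%:M 0%R 0%R W.
have LL : col_mx v W *m (col_mx v W)^T = L2 *m L2^T.
  apply: etrans (col_mx_sqr _ _) _; apply/esym/(etrans (block_mx_sqr _ _ _)).
  by rewrite Wv vW [v *m v^T]mx11_scalar vv !trmx0 !mulmx0 !mul0mx add0r expr2.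
have mL : measurable_fun setT (fun z : 'cV[R]_n.+1 => f (L2 *m z)).
  exact: (measurableT_comp mf (@measurable_mulmx R m.+1 n.+1 L2)).
transitivity (\int[std_gaussian n]_z f (col_mx v W *m z)).
  apply: eq_integral => z _; congr (f _); rewrite (mul_col_mx v W z).
  by rewrite [v *m z]mx11_scalar /cV_cons/= mxE eqxx mulr1n.
apply: etrans (ge0_integral_gaussian_cov LL mf f0) _.
apply: etrans (ge0_integral_std_gaussianS' mL (fun z => f0 _)) _.
apply: eq_integral => z _; apply: eq_integral => x _; congr (f _).
by rewrite /L2 block_cV_cons0 scaler0 add0r.
Qed.

End gaussian_sets.

(** * Limits of matrices and of Gaussian measures *)

Section matrix_limits.
Context {R : realType}.

(** Entrywise, so that limits of products, determinants and inverses reduce to real sequences. *)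
Definition mxcvg m n (M : nat -> 'M[R]_(m, n)) (L : 'M[R]_(m, n)) :=
  forall i j, M k i j @[k --> \oo] --> (L i j : R).

Lemma mxcvgP m n (M : nat -> 'M[R]_(m, n)) (L : 'M[R]_(m, n)) :
  M k @[k --> \oo] --> L -> mxcvg M L.
Proof. by move=> ML i j; exact: (cvg_comp _ (fun N : 'M[R]_(m, n) => N i j) ML (@coord_continuous R m n i j L)). Qed.

Lemma cvg_sumr I (r : seq I) (f : I -> nat -> R) (l : I -> R) :
  (forall i, f i k @[k --> \oo] --> (l i : R)) ->
  \sum_(i <- r) f i k @[k --> \oo] --> (\sum_(i <- r) l i : R).
Proof.
move=> fl; elim: r => [|i r IHr].
  by rewrite big_nil; under eq_fun do rewrite big_nil; exact: cvg_cst.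
by rewrite big_cons; under eq_fun do rewrite big_cons; exact: cvgD.
Qed.

Lemma cvg_prodr I (r : seq I) (f : I -> nat -> R) (l : I -> R) :
  (forall i, f i k @[k --> \oo] --> (l i : R)) ->
  \prod_(i <- r) f i k @[k --> \oo] --> (\prod_(i <- r) l i : R).
Proof.
move=> fl; elim: r => [|i r IHr].
  by rewrite big_nil; under eq_fun do rewrite big_nil; exact: cvg_cst.
by rewrite big_cons; under eq_fun do rewrite big_cons; exact: cvgM.
Qed.

Lemma mxcvg_cst m n (L : 'M[R]_(m, n)) : mxcvg (fun=> L) L.
Proof. by move=> i j; exact: cvg_cst. Qed.

Lemma mxcvg_mul m n p (M : nat -> 'M[R]_(m, n)) L (M' : nat -> 'M[R]_(n, p)) L' :
  mxcvg M L -> mxcvg M' L' -> mxcvg (fun k => M k *m M' k) (L *m L').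
Proof.
move=> ML ML' i j; rewrite mxE; under eq_fun do rewrite mxE.
by apply: cvg_sumr => l; exact: cvgM.
Qed.

Lemma mxcvg_add m n (M M' : nat -> 'M[R]_(m, n)) L L' :
  mxcvg M L -> mxcvg M' L' -> mxcvg (fun k => M k + M' k) (L + L').
Proof. by move=> ML ML' i j; rewrite mxE; under eq_fun do rewrite mxE; exact: cvgD. Qed.

Lemma mxcvg_scale m n (a : nat -> R) (b : R) (M : nat -> 'M[R]_(m, n)) L :
  a k @[k --> \oo] --> b -> mxcvg M L -> mxcvg (fun k => a k *: M k) (b *: L).
Proof. by move=> ab ML i j; rewrite mxE; under eq_fun do rewrite mxE; exact: cvgM. Qed.

Lemma mxcvg_tr m n (M : nat -> 'M[R]_(m, n)) L :
  mxcvg M L -> mxcvg (fun k => (M k)^T) L^T.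
Proof. by move=> ML i j; rewrite mxE; under eq_fun do rewrite mxE; exact: ML. Qed.

Lemma cvg_det n (M : nat -> 'M[R]_n) L : mxcvg M L ->
  \det (M k) @[k --> \oo] --> (\det L : R).
Proof.
move=> ML; apply: cvg_sumr => s; apply: cvgM; first exact: cvg_cst.
by apply: cvg_prodr => i; exact: ML.
Qed.

Lemma mxcvg_inv n (M : nat -> 'M[R]_n) L : L \in unitmx -> mxcvg M L ->
  mxcvg (fun k => invmx (M k)) (invmx L).
Proof.
move=> uL ML; have dL : \det L != 0 by rewrite -unitfE.
have dM := cvg_det ML.
(* [invmx] returns its argument at a singular matrix, so the cofactor formula is available only
   eventually. *)
have [K _ HK] : \forall k \near \oo, M k \in unitmx.
  have /cvgr_norm_gt/(_ 0) := dM; rewrite normr_gt0 => /(_ dL) [K _ HK].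
  by exists K => // k /HK /=; rewrite normr_gt0 unitmxE unitfE.
move=> i j; rewrite /invmx uL mxE.
apply: cvg_trans (_ : (\det (M k))^-1 * (\adj (M k)) i j @[k --> \oo] --> _).
  apply: near_eq_cvg; exists K => // k /HK /= uM.
  by rewrite uM !mxE.
apply: cvgM; first exact: cvgV.
rewrite mxE; under eq_fun do rewrite mxE.
apply: cvgM; first exact: cvg_cst.
apply: cvg_det => a b; rewrite !mxE; under eq_fun do rewrite !mxE.
exact: ML.
Qed.

End matrix_limits.

Lemma cV_consD (R : realType) n (x y : measurableTypeR R) (z w : 'cV[R]_n) :
  cV_cons (x, z) + cV_cons (y, w) =
  cV_cons ((x : R) + (y : R) : measurableTypeR R, z + w) :> 'cV[R]_n.+1.
Proof. by rewrite /cV_cons [LHS](@add_col_mx R 1 n 1) -raddfD. Qed.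

(** * Total variation under triangular maps close to the identity *)

Section total_variation.
Context {R : realType}.
Local Notation N := (normal_prob (0 : R) 1).
Local Notation T := (measurableTypeR R).
Local Notation mu := (@lebesgue_measure R).

Lemma cvg_normal_pdf (m a : nat -> R) (x : R) : m n @[n --> \oo] --> (0 : R) ->
  a n @[n --> \oo] --> (1 : R) ->
  normal_pdf (m n) (a n) x @[n --> \oo] --> normal_pdf 0 1 x.
Proof.
move=> m0 a1.
have a_neq0 : \forall n \near \oo, a n != 0.
  have [k _ ak] := cvgr_gt _ a1 0 ltr01.
  by exists k => // n kn; rewrite gt_eqF//; exact: ak.
apply: cvg_trans (_ : normal_peak (a n) * normal_fun (m n) (a n) x @[n --> \oo] --> _).
  by apply: near_eq_cvg; near=> n; rewrite normal_pdfE//; near: n.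
rewrite normal_pdfE ?oner_neq0//.
have a2 : (a n) ^+ 2 @[n --> \oo] --> (1 : R) ^+ 2.
  exact: (cvg_comp _ (fun y : R => y ^+ 2) a1 (@exprn_continuous R 2 1)).
apply: cvgM.
  apply: cvgV; first by rewrite gt_eqF// sqrtr_gt0 expr1n mul1r mulrn_wgt0 ?pi_gt0.
  apply: continuous_cvg; first exact: sqrt_continuous.
  by apply: cvgMn; apply: cvgM => //; exact: cvg_cst.
apply: continuous_cvg; first exact: continuous_expR.
apply: cvgM.
  apply: cvgN.
  apply: (cvg_comp _ (fun y : R => y ^+ 2)); last exact: exprn_continuous.
  by apply: cvgB => //; exact: cvg_cst.
apply: cvgV; first by rewrite expr1n mulr2n gt_eqF// addr_gt0.
exact: cvgMn.
Unshelve. all: end_near. Qed.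

(** The device of Scheffe's lemma: unlike the absolute difference, the positive part of the lost
    density is dominated by the fixed density [normal_pdf 0 1], so dominated convergence applies. *)
Definition pdf_defect (m a x : R) : R :=
  Num.max 0 (normal_pdf 0 1 x - normal_pdf m a x).

Lemma cvg_pdf_defect_pt (m a : nat -> R) (x : R) :
  m n @[n --> \oo] --> (0 : R) -> a n @[n --> \oo] --> (1 : R) ->
  pdf_defect (m n) (a n) x @[n --> \oo] --> (0 : R).
Proof.
move=> m0 a1.
have pdf0 : normal_pdf 0 1 x - normal_pdf (m n) (a n) x @[n --> \oo] --> (0 : R).
  rewrite -[X in _ --> X](subrr (normal_pdf 0 1 x)); apply: cvgB; first exact: cvg_cst.
  exact: cvg_normal_pdf.
apply: squeeze_cvgr (cvg_cst 0) (_ : `|normal_pdf 0 1 x - normal_pdf (m n) (a n) x|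
  @[n --> \oo] --> (0 : R)).
  apply: nearW => k; rewrite /pdf_defect le_max lexx/= ge_max normr_ge0.
  exact: ler_norm.
by rewrite -[X in _ --> X](normr0 R); exact: cvg_norm.
Qed.

Lemma measurable_pdf_defect d (S : measurableType d) (m x : S -> R) (a : R) :
  measurable_fun setT m -> measurable_fun setT x ->
  measurable_fun setT (fun s => pdf_defect (m s) a (x s)).
Proof.
move=> mm mx; apply: measurable_maxr => //; apply: measurable_funB.
  exact: (measurableT_comp (measurable_normal_pdf 0 1)).
(* At scale 0 [normal_pdf] is by convention the indicator of the unit interval. *)
have [->|a0] := eqVneq a 0.
  rewrite /normal_pdf eqxx.
  exact: (measurableT_comp (measurable_indic (measurable_itv `[0, 1]%R))).
rewrite [X in measurable_fun _ X](_ : _ = normal_pdf 0 a \o (fun s => x s - m s)).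
  by apply: (measurableT_comp (measurable_normal_pdf 0 a)); exact: measurable_funB.
by apply/funext => s/=; rewrite !normal_pdfE// /normal_fun subr0.
Qed.

Lemma cvg_pdf_defect (n : nat) (a : nat -> R) (m : nat -> 'cV[R]_n -> R) :
  (forall k, measurable_fun setT (m k)) ->
  (forall z, m k z @[k --> \oo] --> (0 : R)) -> a k @[k --> \oo] --> (1 : R) ->
  (\int[std_gaussian n]_z \int[mu]_x (pdf_defect (m k z) (a k) x)%:E)%E
    @[k --> \oo] --> 0%E.
Proof.
move=> mm m0 a1.
pose f k (w : T * 'cV[R]_n) := (pdf_defect (m k w.2) (a k) w.1)%:E.
have mf k : measurable_fun setT (f k).
  apply/measurable_EFinP; apply: measurable_pdf_defect => //.
  exact: measurableT_comp.
have f0 k w : (0 <= f k w)%E by rewrite lee_fin le_max lexx.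
under eq_fun => k.
  rewrite -(fubini_tonelli2 (m1 := mu) (m2 := std_gaussian n) (f k))//.
  over.
pose g (w : T * 'cV[R]_n) := (normal_pdf 0 1 w.1)%:E.
have mg : measurable_fun setT g.
  apply/measurable_EFinP.
  exact: (measurableT_comp (measurable_normal_pdf 0 1)).
have g0 w : (0 <= g w)%E by rewrite lee_fin normal_pdf_ge0.
have [] := @dominated_convergence _ _ _ (mu \x std_gaussian n)%E setT measurableT
   f (cst 0%E) g mf (measurable_cst _).
- apply: aeW => w _ /=.
  rewrite -[X in _ --> X]/(0%:E); apply: cvg_EFin; first exact: nearW.
  exact: cvg_pdf_defect_pt.
- apply/integrableP; split => //.
  under eq_integral do rewrite gee0_abs//.
  rewrite fubini_tonelli2// (_ : integral _ _ _ = \int[std_gaussian n]_y 1)%E.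
    rewrite integral_cst// mul1e; apply: le_lt_trans (ltry 1).
    exact: probability_le1.
  by apply: eq_integral => z _; exact: integral_normal_pdf.
- apply: aeW => w k _; rewrite gee0_abs//.
  rewrite lee_fin ge_max normal_pdf_ge0/= gerBl.
  exact: normal_pdf_ge0.
by move=> _ _; rewrite integral0.
Qed.

Lemma indic_block n (B : set 'cV[R]_n.+1) (a : R) (b : 'rV[R]_n) (d : R) (x : T)
    (z : 'cV[R]_n) :
  \1_[set z | B ((block_mx a%:M b 0 1%:M : 'M[R]_n.+1) *m z + cV_cons (d : T, 0))]
    (cV_cons (x, z)) =
  \1_B (cV_cons (affine1 a ((b *m z) 0 0 + d) x, z)) :> R.
Proof.
rewrite /indic; congr ((_ : bool)%:R).
rewrite (_ : (_ \in _) = (block_mx a%:M b 0 1%:M *m cV_cons (x, z) +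
  cV_cons (d : T, 0) \in B))//.
congr (_ \in B); rewrite block_cV_cons scaler0 add0r mul1mx /cV_cons/=.
by rewrite add_col_mx addr0 -raddfD/= /affine1 addrA.
Qed.

(** Given the other coordinates [z], the first one becomes normal with mean [m k z] and scale [a k].
    On any event this loses, against N(0, 1), at most the integral of [pdf_defect], a bound that
    does not involve the event. *)
Lemma tv_shear (n : nat) (a : nat -> R) (b : nat -> 'rV[R]_n) (d : nat -> R) :
  a k @[k --> \oo] --> (1 : R) -> (forall i, b k 0 i @[k --> \oo] --> (0 : R)) ->
  d k @[k --> \oo] --> (0 : R) ->
  forall e : R, 0 < e -> \forall k \near \oo, forall B : set 'cV[R]_n.+1,
    measurable B ->
    (std_gaussian n.+1 B <= std_gaussian n.+1
      [set z | B ((block_mx (a k)%:M (b k) 0 1%:M : 'M[R]_n.+1) *m z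
        + cV_cons (d k : T, 0))%R] + e%:E)%E.
Proof.
move=> a1 b0 d0 e e0.
pose m k (z : 'cV[R]_n) := (b k *m z) 0 0 + d k.
have mm k : measurable_fun setT (m k).
  apply: measurable_funD => //.
  exact: (measurableT_comp (measurable_entry 0 0) (measurable_mulmx (b k))).
have m0 z : m k z @[k --> \oo] --> (0 : R).
  rewrite -[X in _ --> X](addr0 0); apply: cvgD => //.
  have b0' : mxcvg b 0 by move=> i j; rewrite (ord1 i) mxE; exact: b0.
  have bz : mxcvg (fun k => b k *m z) (0 *m z) := mxcvg_mul b0' (@mxcvg_cst R _ _ z).
  by have := bz 0 0; rewrite mul0mx mxE.
have a_neq0 : \forall k \near \oo, a k != 0.
  have [k _ ak] := cvgr_gt _ a1 0 ltr01.
  by exists k => // j kj; rewrite gt_eqF//; exact: ak.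
have J0 := cvg_pdf_defect mm m0 a1.
have [K _ HK] : \forall k \near \oo, (\int[std_gaussian n]_z
    \int[mu]_x (pdf_defect (m k z) (a k) x)%:E < e%:E)%E.
  apply: (J0 [set x | (x < e%:E)%E]); apply: open_nbhs_nbhs.
  by split; [exact: open_ereal_lt_ereal|rewrite /= lte_fin].
have [K' _ HK'] := a_neq0.
exists (maxn K K') => // k; rewrite [X in X -> _]/= geq_max => /andP[/HK Je /HK' ak] B mB.
rewrite /= in Je ak.
set S := [set z | _].
have mS : measurable S by exact: (measurable_preimage (measurable_affine_mx _ _) mB).
have mI (A : set 'cV[R]_n.+1) : measurable A ->
    measurable_fun setT (fun z => (\1_A z)%:E : \bar R).
  by move=> mA; apply/measurable_EFinP; exact: measurable_indic.
have I0 (A : set 'cV[R]_n.+1) z : (0 <= (\1_A z)%:E :> \bar R)%E by rewrite lee_fin.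
rewrite -(integral_indic_preimage (std_gaussian n.+1) mB).
rewrite -(integral_indic_preimage (std_gaussian n.+1) mS).
rewrite (ge0_integral_std_gaussianS' (mI _ mB) (I0 _)).
rewrite (ge0_integral_std_gaussianS' (mI _ mS) (I0 _)).
have mg (z : 'cV[R]_n) : measurable_fun setT (fun x : T => (\1_B (cV_cons (x, z)))%:E : \bar R).
  exact: (measurableT_comp (mI _ mB) (measurable_cV_consr z)).
have SE z : (\int[N]_x (\1_S (cV_cons (x, z)))%:E =
    \int[mu]_x ((\1_B (cV_cons (x, z)))%:E * (normal_pdf (m k z) (a k) x)%:E))%E.
  under eq_integral do rewrite indic_block.
  rewrite (ge0_integral_normal_affine1 _ ak (mg z) (fun x => I0 _ _)).
  exact: (ge0_integral_normal_prob _ _ (mg z) (fun x => I0 _ _)).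
pose h z x := (pdf_defect (m k z) (a k) x)%:E.
have h0 z x : (0 <= h z x)%E by rewrite lee_fin le_max lexx.
have mh z : measurable_fun setT (h z : T -> \bar R).
  by apply/measurable_EFinP; exact: measurable_pdf_defect.
have mh2 : measurable_fun setT (fun w : T * 'cV[R]_n => h w.2 w.1).
  by apply/measurable_EFinP; apply: measurable_pdf_defect => //; exact: measurableT_comp.
have mG (A : set 'cV[R]_n.+1) : measurable A ->
    measurable_fun setT (fun z => \int[N]_x (\1_A (cV_cons (x, z)))%:E : \bar R)%E.
  move=> mA; apply: (measurable_fun_fubini_tonelli_G (m1 := N)
    (fun w : T * 'cV[R]_n => (\1_A (cV_cons w))%:E : \bar R)) => //.
  exact: (measurableT_comp (mI _ mA) (@measurable_cV_cons R n)).
have mH : measurable_fun setT (fun z => \int[mu]_x h z x)%E.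
  exact: (measurable_fun_fubini_tonelli_G (m1 := mu) _ mh2 (fun w => h0 _ _)).
have intH0 z : (0 <= \int[mu]_x h z x)%E by exact: integral_ge0.
have intS0 z : (0 <= \int[N]_x (\1_S (cV_cons (x, z)))%:E)%E by exact: integral_ge0.
apply: (@le_trans _ _ (\int[std_gaussian n]_z
  (\int[N]_x (\1_S (cV_cons (x, z)))%:E + \int[mu]_x h z x))%E); last first.
  rewrite (ge0_integralD (std_gaussian n) measurableT (fun z _ => intS0 z) (mG _ mS)
    (fun z _ => intH0 z) mH).
  by rewrite leeD2l// ltW.
apply: ge0_le_integral => //=.
- by move=> z _; exact: integral_ge0.
- exact: mG.
- exact: (emeasurable_funD (mG _ mS) mH).
move=> z _; rewrite SE.
rewrite (ge0_integral_normal_prob _ _ (mg z) (fun x => I0 _ _)).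
have mpdf m' a' : measurable_fun setT (fun x : T => (normal_pdf m' a' x)%:E : \bar R).
  by apply/measurable_EFinP; exact: measurable_normal_pdf.
have mgp m' a' : measurable_fun setT (fun x : T =>
    (\1_B (cV_cons (x, z)))%:E * (normal_pdf m' a' x)%:E : \bar R)%E.
  by apply: emeasurable_funM; [exact: mg|exact: mpdf].
have gp0 m' a' x : (0 <= (\1_B (cV_cons (x, z)))%:E * (normal_pdf m' a' x)%:E :> \bar R)%E.
  by rewrite mule_ge0 ?lee_fin// normal_pdf_ge0.
rewrite -(ge0_integralD mu measurableT (fun x _ => gp0 _ _ x) (mgp _ _)
  (fun x _ => h0 z x) (mh z)).
apply: ge0_le_integral => //=.
- exact: (emeasurable_funD (mgp _ _) (mh z)).
move=> x _; rewrite -!EFinM -EFinD lee_fin indicE; case: (_ \in _).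
  by rewrite !mul1r /pdf_defect -lerBlDl le_max lexx orbT.
by rewrite !mul0r add0r le_max lexx.
Qed.

(** An upper triangular matrix is a map of the last coordinates composed with a shear of the first
    one. The induction hypothesis, applied on slices, pays for the former and [tv_shear] for the
    latter, each with half of [e]. *)
Lemma tv_affine (n : nat) (M : nat -> 'M[R]_n) (d : nat -> 'cV[R]_n) :
  (forall k (i j : 'I_n), (j < i)%N -> M k i j = 0) ->
  (forall i j, M k i j @[k --> \oo] --> ((i == j)%:R : R)) ->
  (forall i, d k i 0 @[k --> \oo] --> (0 : R)) ->
  forall e : R, 0 < e -> \forall k \near \oo, forall B : set 'cV[R]_n,
    measurable B ->
    (std_gaussian n B <= std_gaussian n [set z | B (M k *m z + d k)%R] + e%:E)%E.
Proof.
elim: n M d => [|n IHn] M d M0 M1 d0 e e0.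
  apply: nearW => k B mB; rewrite (_ : [set z | _] = B); last first.
    by apply/seteqP; split => z /=; rewrite [z]flatmx0 [_ + _]flatmx0.
  by rewrite leeDl// lee_fin ltW.
pose a k := M k 0 0; pose b k : 'rV[R]_n := \row_j M k 0 (lift ord0 j).
pose M' k : 'M[R]_n := \matrix_(i, j) M k (lift ord0 i) (lift ord0 j).
pose d1 k := d k 0 0; pose d' k : 'cV[R]_n := \col_i d k (lift ord0 i) 0.
have e2 : 0 < e / 2 by rewrite divr_gt0.
have [|||K1 _ HK1] := IHn M' d' _ _ _ _ e2.
- by move=> k i j ji; rewrite mxE M0// !lift0 ltnS.
- move=> i j; under eq_fun do rewrite mxE.
  by rewrite -(inj_eq (@lift_inj _ ord0)); exact: M1.
- by move=> i; under eq_fun do rewrite mxE; exact: d0.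
have [|||K2 _ HK2] := @tv_shear n a b d1 _ _ _ _ e2.
- exact: M1.
- by move=> i; under eq_fun do rewrite mxE; exact: (M1 0 (lift ord0 i)).
- exact: d0.
exists (maxn K1 K2) => // k; rewrite [X in X -> _]/= geq_max => /andP[/HK1 {}HK1 /HK2 {}HK2] B mB.
have l0 : 0 = @lshift 1 n 0 :> 'I_n.+1 by exact: val_inj.
have r0 i : lift ord0 i = @rshift 1 n i :> 'I_n.+1 by exact: val_inj.
have ME : M k = (block_mx (a k)%:M (b k) 0 (M' k) : 'M[R]_(1 + n)).
  apply/matrixP => i j.
  case: (@split_ordP 1 n i) => i' ->; case: (@split_ordP 1 n j) => j' ->.
  - by rewrite (@block_mxEul R 1 n 1 n (a k)%:M (b k) 0 (M' k) i' j') (ord1 i') (ord1 j') -l0 mxE eqxx mulr1n.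
  - by rewrite (@block_mxEur R 1 n 1 n (a k)%:M (b k) 0 (M' k) i' j') (ord1 i') mxE -l0 r0.
  - rewrite (@block_mxEdl R 1 n 1 n (a k)%:M (b k) 0 (M' k) i' j') mxE M0//= (ord1 j').
    by rewrite add1n.
  - by rewrite (@block_mxEdr R 1 n 1 n (a k)%:M (b k) 0 (M' k) i' j') mxE !r0.
have dE : d k = cV_cons (d1 k : T, d' k).
  apply/colP => i; case: (@split_ordP 1 n i) => i' ->.
  - by rewrite /cV_cons (@col_mxEu R 1 n 1 (d1 k)%:M (d' k) i' 0) (ord1 i') mxE eqxx mulr1n -l0.
  - by rewrite /cV_cons (@col_mxEd R 1 n 1 (d1 k)%:M (d' k) i' 0) mxE r0.
pose Mk : 'M[R]_n.+1 := @block_mx R 1 n 1 n 1%:M 0 0 (M' k).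
pose C := [set z : 'cV[R]_n.+1 | B (Mk *m z + cV_cons (0 : T, d' k))].
have mC : measurable C by exact: (measurable_preimage (measurable_affine_mx _ _) mB).
have mI (A : set 'cV[R]_n.+1) : measurable A ->
    measurable_fun setT (fun z => (\1_A z)%:E : \bar R).
  by move=> mA; apply/measurable_EFinP; exact: measurable_indic.
have I0 (A : set 'cV[R]_n.+1) z : (0 <= (\1_A z)%:E :> \bar R)%E by rewrite lee_fin.
have BC : (std_gaussian n.+1 B <= std_gaussian n.+1 C + (e / 2)%:E)%E.
  have slice A : measurable A -> std_gaussian n.+1 A =
      (\int[N]_x std_gaussian n [set z | A (cV_cons (x, z))])%E.
    move=> mA; rewrite -(integral_indic_preimage (std_gaussian n.+1) mA).
    rewrite (ge0_integral_std_gaussianS (mI _ mA) (I0 _)); apply: eq_integral => x _.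
    rewrite -integral_indic_preimage//.
    exact: (measurable_preimage (measurable_cV_consl x) mA).
  have mslice A : measurable A ->
      measurable_fun setT (fun x : T => std_gaussian n [set z | A (cV_cons (x, z))]).
    move=> mA.
    rewrite (_ : (fun x => _) = fun x : T =>
        \int[std_gaussian n]_z (\1_A (cV_cons (x, z)))%:E)%E; last first.
      apply/funext => x; rewrite -integral_indic_preimage//.
      exact: (measurable_preimage (measurable_cV_consl x) mA).
    apply: (measurable_fun_fubini_tonelli_F (m2 := std_gaussian n)
      (fun w : T * 'cV[R]_n => (\1_A (cV_cons w))%:E : \bar R)) => //.
    exact: (measurableT_comp (mI _ mA) (@measurable_cV_cons R n)).
  rewrite (slice _ mB) (slice _ mC).
  apply: (@le_trans _ _ (\int[N]_x
    (std_gaussian n [set z | C (cV_cons (x, z))] + (e / 2)%:E))%E).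
    apply: ge0_le_integral => //=.
    - exact: mslice.
    - by apply: emeasurable_funD => //; exact: mslice.
    move=> x _; have mBx : measurable [set z | B (cV_cons (x, z))].
      exact: (measurable_preimage (measurable_cV_consl x) mB).
    apply: le_trans (HK1 _ mBx) _; rewrite leeD2r//.
    rewrite (_ : [set z | C (cV_cons (x, z))] =
      [set z | B (cV_cons (x, M' k *m z + d' k))])//.
    apply/seteqP; split => z; rewrite /C/= /Mk block_cV_cons0 mul1r scaler0 add0r.
      by rewrite cV_consD addr0.
    by rewrite cV_consD addr0.
  rewrite ge0_integralD//=; last 2 first.
  - exact: mslice.
  - by move=> x _; rewrite lee_fin ltW.
  by rewrite leeD2l// integral_cst// [X in (_ * X)%E]probability_setT mule1.
apply: (le_trans BC); rewrite [e in leRHS](splitr e) EFinD addeA leeD2r//.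
apply: le_trans (HK2 _ mC) _; rewrite leeD2r//.
rewrite (_ : [set z | _] = [set z | B (M k *m z + d k)])//.
have MkM : Mk *m (@block_mx R 1 n 1 n (a k)%:M (b k) 0 1%:M) = M k.
  rewrite ME /Mk (@mulmx_block R 1 n 1 n 1 n 1%:M 0 0 (M' k) (a k)%:M (b k) 0 1%:M).
  by rewrite !mul1mx !mul0mx !mulmx0 mulmx1 !addr0 add0r.
have Mkd : Mk *m cV_cons (d1 k : T, 0) + cV_cons (0 : T, d' k) = d k.
  rewrite dE /Mk block_cV_cons0 mul1r scaler0 mulmx0 addr0 cV_consD.
  by rewrite add0r addr0.
by apply/seteqP; split => z; rewrite /C/= mulmxDr -addrA Mkd mulmxA MkM.
Qed.

End total_variation.

(** * Concentration of the squared norm *)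

Section chi_square.
Context {R : realType}.
Local Notation N := (normal_prob (0 : R) 1).
Local Notation T := (measurableTypeR R).

Definition sqn n (z : 'cV[R]_n) : R := (z^T *m z) 0 0.

Lemma sqnE n (z : 'cV[R]_n) : sqn z = \sum_i z i 0 ^+ 2.
Proof. by rewrite /sqn mxE; apply: eq_bigr => i _; rewrite mxE. Qed.

Lemma sqn_ge0 n (z : 'cV[R]_n) : 0 <= sqn z.
Proof. by rewrite sqnE sumr_ge0// => i _; rewrite sqr_ge0. Qed.

Lemma sqn_coord n (z : 'cV[R]_n) i : z i 0 ^+ 2 <= sqn z.
Proof.
by rewrite sqnE (bigD1 i)//= lerDl sumr_ge0// => j _; rewrite sqr_ge0.
Qed.

Lemma sqn_cons n (x : T) (z : 'cV[R]_n) :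
  sqn (cV_cons (x, z)) = (x : R) ^+ 2 + sqn z.
Proof.
rewrite /sqn /cV_cons tr_col_mx mul_row_col tr_scalar_mx -scalar_mxM mxE.
by rewrite mxE eqxx mulr1n.
Qed.

Lemma measurable_sqn n : measurable_fun setT (@sqn n).
Proof.
rewrite (_ : @sqn n = fun z => \sum_i z i 0 ^+ 2); last exact/funext/sqnE.
apply: measurable_sum => i; apply: measurable_funX; exact: measurable_entry.
Qed.

(** Exponential tilting: with the parameter [(1 - w^-1) / 2] the tilted density is a multiple of the
    one with variance [w], so the exponential moment of [x ^+ 2] is read off as [Num.sqrt w]. *)
Lemma normal_pdf_tilt (w x : R) : 0 < w ->
  expR ((1 - w^-1) / 2 * x ^+ 2) * normal_pdf 0 1 x =
  Num.sqrt w * normal_pdf 0 (Num.sqrt w) x.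
Proof.
move=> w0; have sw0 : Num.sqrt w != 0 by rewrite gt_eqF// sqrtr_gt0.
rewrite !normal_pdfE ?oner_neq0// /normal_fun /normal_peak.
rewrite sqr_sqrtr ?ltW// expr1n mul1r mulrCA -expRD [RHS]mulrA; congr (_ * expR _).
  by rewrite -mulrnAr sqrtrM ?ltW// invfM mulrA divff// mul1r.
by rewrite subr0; field; rewrite gt_eqF.
Qed.

Lemma ge0_integral_exp_sqn n (w : R) : 0 < w ->
  (\int[std_gaussian n]_z (expR ((1 - w^-1) / 2 * sqn z))%:E =
   (Num.sqrt w ^+ n)%:E)%E.
Proof.
move=> w0; set l := (1 - w^-1) / 2.
have mexp m : measurable_fun setT (fun z : 'cV[R]_m => (expR (l * sqn z))%:E).
  apply/measurable_EFinP; apply: measurableT_comp => //.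
  by apply: measurable_funM => //; exact: measurable_sqn.
have exp0 m (z : 'cV[R]_m) : (0 <= (expR (l * sqn z))%:E)%E by rewrite lee_fin expR_ge0.
have e1 : (\int[N]_x (expR (l * x ^+ 2))%:E = (Num.sqrt w)%:E)%E.
  rewrite ge0_integral_normal_prob//; last first.
    apply/measurable_EFinP; apply: measurableT_comp => //.
    by apply: measurable_funM => //; exact: measurable_funX.
  under eq_integral do rewrite -EFinM normal_pdf_tilt// EFinM.
  rewrite ge0_integralZl//; last 2 first.
  - by apply/measurable_EFinP; exact: measurable_normal_pdf.
  - by move=> x _; rewrite lee_fin normal_pdf_ge0.
  by rewrite integral_normal_pdf mule1.
elim: n => [|n IHn].
  under eq_integral do rewrite sqnE big_ord0 mulr0 expR0.
  by rewrite integral_cst// mul1e [LHS]probability_setT.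
rewrite (ge0_integral_std_gaussianS (mexp _) (exp0 _)).
transitivity (\int[N]_x ((expR (l * x ^+ 2))%:E * (Num.sqrt w ^+ n)%:E))%E.
  apply: eq_integral => x _.
  under eq_integral do rewrite sqn_cons mulrDr expRD EFinM.
  rewrite (ge0_integralZl (std_gaussian n) measurableT (mexp n) (fun z _ => exp0 n z)).
    by rewrite IHn.
  by rewrite lee_fin expR_ge0.
rewrite ge0_integralZr//; last first.
  apply/measurable_EFinP; apply: measurableT_comp => //.
  by apply: measurable_funM => //; exact: measurable_funX.
by rewrite e1 -EFinM exprS.
Qed.

(** The factor [l] is kept on both sides because of its sign: the event is the upper tail for
    [w > 1] and the lower tail for [w < 1]. *)
Lemma sqn_chernoff n (w l t : R) : 0 < w -> l = (1 - w^-1) / 2 ->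
  (std_gaussian n [set z | l * t <= l * sqn z]%R <=
   (Num.sqrt w ^+ n * expR (- (l * t)))%:E)%E.
Proof.
move=> w0 lE.
have ml : measurable_fun setT (fun z : 'cV[R]_n => l * sqn z).
  by apply: measurable_funM => //; exact: measurable_sqn.
have mS : measurable [set z : 'cV[R]_n | l * t <= l * sqn z].
  rewrite (_ : [set z | _] = (fun z => l * sqn z) @^-1` `[l * t, +oo[%classic).
    by rewrite -[X in measurable X]setTI; apply: ml => //; exact: measurable_itv.
  by apply/seteqP; split => z /=; rewrite in_itv/= andbT.
rewrite -integral_indic_preimage// EFinM -ge0_integral_exp_sqn// -lE.
rewrite -ge0_integralZr//; last first.
  by apply/measurable_EFinP; apply: measurableT_comp.
apply: ge0_le_integral => //=.
- by apply/measurable_EFinP; exact: measurable_indic.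
- by apply: emeasurable_funM => //; apply/measurable_EFinP; apply: measurableT_comp.
move=> z _; rewrite -EFinM -expRD lee_fin indicE.
case: (boolP (z \in _)) => [|_]; last exact: expR_ge0.
rewrite inE/= => tz; apply: le_trans (expR_ge1Dx _).
by rewrite lerDl subr_ge0.
Qed.

Lemma sqn_tight n (e : R) : 0 < e ->
  exists K : R, (std_gaussian n [set z | K <= sqn z]%R <= e%:E)%E.
Proof.
move=> e0; pose c := Num.sqrt (2 : R) ^+ n.
have c0 : 0 < c by rewrite exprn_gt0// sqrtr_gt0.
have l4 : (1 - 2^-1) / 2 = 4^-1 :> R by lra.
exists (- (4 * ln (e / c))).
have := @sqn_chernoff n 2 4^-1 (- (4 * ln (e / c))) (ltr0n R 2) (esym l4).
rewrite mulrN opprK mulrA mulVf// mul1r lnK ?posrE ?divr_gt0// mulrCA divff ?gt_eqF// mulr1.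
by apply: le_trans; rewrite le_eqVlt; apply/orP; left; apply/eqP; congr (std_gaussian n _);
  apply/seteqP; split => z/= h; lra.
Qed.

Lemma sqn_lln (e d : R) : 0 < e -> 0 < d -> \forall n \near \oo,
  (std_gaussian n [set z | e * n%:R <= `|sqn z - n%:R| ]%R <= d%:E)%E.
Proof.
move=> e0 d0.
(* The Chernoff bound per coordinate at the threshold [n w]; it is below 1 for [w != 1] because
   [w < expR (w - 1)]. *)
pose q (w : R) := Num.sqrt w * expR (- ((w - 1) / 2)).
have q0 w : 0 <= q w by rewrite mulr_ge0// ?sqrtr_ge0// expR_ge0.
have q1 w : 0 < w -> w != 1 -> q w < 1.
  move=> w0 w1; rewrite -(@ltr_pXn2r _ 2)// ?nnegrE// expr1n exprMn sqr_sqrtr ?ltW//.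
  rewrite -expRM_natl mulrN mulrCA divff ?mulr1 ?pnatr_eq0// expRN.
  rewrite ltr_pdivrMr ?expR_gt0// mul1r.
  by have := @expR_gt1Dx R (w - 1); rewrite subr_eq0 addrC subrK; apply.
have qn w n : 0 < w -> (std_gaussian n [set z | (1 - w^-1) / 2 * (n%:R * w) <=
   (1 - w^-1) / 2 * sqn z]%R <= (q w ^+ n)%:E)%E.
  move=> w0; apply: le_trans (sqn_chernoff _ _ w0 erefl) _.
  rewrite lee_fin /q exprMn -expRM_natl le_eqVlt; apply/orP; left; apply/eqP.
  by congr (_ * expR _); field; rewrite gt_eqF.
(* The cap keeps [1 - e'] positive, as the lower tail requires. *)
pose e' := Num.min e 2^-1.
have e'0 : 0 < e' by rewrite lt_min e0/=; lra.
have e'1 : e' < 1 by rewrite gt_min; apply/orP; right; lra.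
have d2 : 0 < d / 2 by rewrite divr_gt0.
have qcvg w : 0 < w -> w != 1 -> \forall n \near \oo, q w ^+ n <= d / 2.
  move=> w0 w1; have : q w ^+ n @[n --> \oo] --> (0 : R).
    by apply: cvg_expr; rewrite ger0_norm// q1.
  by move=> /cvgr_le; apply.
have w10 : 0 < 1 + e' by rewrite addr_gt0.
have w20 : 0 < 1 - e' by rewrite subr_gt0.
have w11 : 1 + e' != 1 by rewrite gt_eqF// ltrDl.
have w21 : 1 - e' != 1 by rewrite lt_eqF// gtrDl oppr_lt0.
near=> n.
have n0 : 0 < n%:R :> R by rewrite ltr0n; near: n; exact: nbhs_infty_gt.
have ml (l : R) : measurable_fun setT (fun z : 'cV[R]_n => l * sqn z).
  by apply: measurable_funM => //; exact: measurable_sqn.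
have mS (l t : R) : measurable [set z : 'cV[R]_n | t <= l * sqn z].
  rewrite (_ : [set z | _] = (fun z => l * sqn z) @^-1` `[t, +oo[%classic).
    by rewrite -[X in measurable X]setTI; apply: ml => //; exact: measurable_itv.
  by apply/seteqP; split => z /=; rewrite in_itv/= andbT.
pose A w := [set z : 'cV[R]_n | (1 - w^-1) / 2 * (n%:R * w) <= (1 - w^-1) / 2 * sqn z].
have AU : [set z : 'cV[R]_n | e * n%:R <= `|sqn z - n%:R| ] `<=` A (1 + e') `|` A (1 - e').
  move=> z /= ez; have e'z : e' * n%:R <= `|sqn z - n%:R|.
    by apply: le_trans ez; rewrite ler_pM2r// ge_min lexx.
  have [zn|zn] := leP 0 (sqn z - n%:R).
    left; rewrite /A/= ler_pM2l; first by move: e'z; rewrite ger0_norm//; lra.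
    by rewrite divr_gt0// subr_gt0 invf_lt1// ltrDl.
  right; rewrite /A/= ler_nM2l; first by move: e'z; rewrite ltr0_norm//; lra.
  by rewrite pmulr_llt0// subr_lt0 invf_gt1// gtrDl oppr_lt0.
have mE : measurable [set z : 'cV[R]_n | e * n%:R <= `|sqn z - n%:R| ].
  rewrite (_ : [set z | _] = (fun z => `|sqn z - n%:R|) @^-1` `[e * n%:R, +oo[%classic).
    rewrite -[X in measurable X]setTI.
    have mf : measurable_fun setT (fun z : 'cV[R]_n => `|sqn z - n%:R|).
      apply: measurableT_comp => //.
      by apply: measurable_funB => //; exact: measurable_sqn.
    by apply: mf => //; exact: measurable_itv.
  by apply/seteqP; split => z /=; rewrite in_itv/= andbT.
apply: (@le_trans _ _ (std_gaussian n (A (1 + e') `|` A (1 - e')))).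
  by apply: le_measure; rewrite ?inE//; apply: measurableU; exact: mS.
apply: (le_trans (measureU2 (std_gaussian n) (mS _ _) (mS _ _))).
rewrite [d]splitr EFinD leeD//.
  apply: le_trans (qn _ _ w10) _; rewrite lee_fin.
  by near: n; exact: qcvg.
apply: le_trans (qn _ _ w20) _; rewrite lee_fin.
by near: n; exact: qcvg.
Unshelve. all: end_near. Qed.

End chi_square.

(** * Blocks and the whitening matrix *)

Section resize.
Context {R : realType}.

Lemma pid_mulmxE P n p (M : 'M[R]_(P, n)) i j :
  ((pid_mx p : 'M[R]_P) *m M) i j = (i < p)%:R * M i j.
Proof.
rewrite mxE (bigD1 i)//= mxE eqxx big1 ?addr0// => l li.
by rewrite mxE eq_sym (_ : (_ == _) = false) ?mul0r//; exact: negbTE.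
Qed.

Lemma mulmx_pidE P n p (M : 'M[R]_(n, P)) i j :
  (M *m (pid_mx p : 'M[R]_P)) i j = M i j * (j < p)%:R.
Proof.
rewrite mxE (bigD1 j)//= [X in _ * X]mxE eqxx big1 ?addr0// => l lj.
by rewrite [X in _ * X]mxE (_ : (_ == _) = false) ?mulr0//; exact: negbTE.
Qed.

Lemma pid_mxK P p : (pid_mx p : 'M[R]_P) *m (pid_mx p : 'M[R]_P) = pid_mx p.
Proof. by rewrite mul_pid_mx minnn pid_mx_minv. Qed.

Lemma entryE m n (M : 'M[R]_(m, n)) (i : 'I_m) (j : 'I_n) : entry M i j = M i j.
Proof. by rewrite /entry !valK. Qed.

Lemma entry_outl m n (M : 'M[R]_(m, n)) (i j : nat) : (m <= i)%N -> entry M i j = 0.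
Proof. by move=> mi; rewrite /entry insubF// ltnNge mi. Qed.

Lemma entry_outr m n (M : 'M[R]_(m, n)) (i j : nat) : (n <= j)%N -> entry M i j = 0.
Proof.
by move=> nj; rewrite /entry; case: insubP => // i' _ _; rewrite insubF// ltnNge nj.
Qed.

(** Writes truncation and padding as products with partial identities, which turns the block
    notation of the theorem into plain matrix algebra. *)
Lemma resizeE m n m' n' (M : 'M[R]_(m, n)) :
  resize m' n' M = (pid_mx m : 'M[R]_(m', m)) *m M *m (pid_mx n : 'M[R]_(n, n')).
Proof.
apply/matrixP => i j; rewrite !mxE.
have [mi|mi] := leqP m i.
  rewrite entry_outl// big1// => l _; rewrite mxE big1 ?mul0r// => l' _.
  by rewrite mxE ltnNge mi andbF mul0r.
have [nj|nj] := leqP n j.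
  rewrite entry_outr// big1// => l _; rewrite [X in _ * X]mxE.
  by rewrite (_ : (_ == _) = false) ?mulr0// ltn_eqF// (leq_trans (ltn_ord l)).
rewrite (bigD1 (Ordinal nj))//= [X in _ * X]mxE eqxx nj mulr1 [X in _ + X]big1.
  rewrite addr0 mxE (bigD1 (Ordinal mi))//= mxE eqxx mi mul1r [X in _ + X]big1.
    by rewrite addr0 -(entryE M (Ordinal mi) (Ordinal nj)).
  move=> l li; rewrite mxE (_ : (_ == _) = false) ?mul0r//.
  by apply: contraNF li => /eqP il; apply/eqP/val_inj.
move=> l lj; rewrite [X in _ * X]mxE (_ : (_ == _) = false) ?mulr0//.
by apply: contraNF lj => /eqP jl; apply/eqP/val_inj.
Qed.

Variable P : nat.

(* E p embeds R^p as the span of the first p coordinates, F p embeds R^(P - p)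
   as the span of the others. *)
Definition first_emb p : 'M[R]_(P, p) := pid_mx p.
Definition last_emb p : 'M[R]_(P, P - p) := \matrix_(i, j) (i == p + j :> nat)%N%:R.

Lemma last_embE p i j : last_emb p i j = (i == p + j :> nat)%N%:R.
Proof. by rewrite mxE. Qed.

Variable p : nat.
Hypothesis pP : (p <= P)%N.
Local Notation E := (first_emb p).
Local Notation F := (last_emb p).

Lemma first_embTK : E^T *m E = 1%:M.
Proof. by rewrite /first_emb tr_pid_mx mul_pid_mx minnn (minn_idPr pP) pid_mx_1. Qed.

Lemma first_embKT : E *m E^T = pid_mx p.
Proof. by rewrite /first_emb tr_pid_mx mul_pid_mx !minnn. Qed.

Lemma last_embKT : F *m F^T = 1%:M - pid_mx p.
Proof.
apply/matrixP => i j; rewrite !mxE.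
have [ip|ip] := ltnP i p.
  rewrite andbT subrr big1// => l _; rewrite !mxE (_ : (_ == _) = false) ?mul0r//.
  by rewrite ltn_eqF// ltn_addr.
rewrite andbF subr0.
have ipP : (i - p < P - p)%N by rewrite ltn_sub2r// (leq_ltn_trans ip).
have ipE : (p + Ordinal ipP)%N = i by exact: subnKC.
rewrite (bigD1 (Ordinal ipP))//= [F^T _ _]mxE !last_embE ipE.
rewrite eqxx mul1r big1 ?addr0.
  by rewrite eq_sym.
move=> l li; rewrite !mxE (_ : (_ == _) = false) ?mul0r//.
apply: contraNF li => /eqP il; apply/eqP/val_inj => /=.
by rewrite il addKn.
Qed.

Lemma first_colsE m (A : 'M[R]_(m, P)) : first_cols p A = A *m E.
Proof.
rewrite /first_cols resizeE pid_mx_1 mul1mx; congr (_ *m _).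
by rewrite /first_emb -[LHS]pid_mx_minh (minn_idPl pP).
Qed.

Lemma block11E (Q : 'M[R]_P) : block11 p Q = E^T *m Q *m E.
Proof.
rewrite /block11 resizeE /first_emb tr_pid_mx.
have <- : pid_mx P = pid_mx p :> 'M[R]_(p, P) by rewrite -[LHS]pid_mx_minv (minn_idPl pP).
by have <- : pid_mx P = pid_mx p :> 'M[R]_(P, p) by rewrite -[LHS]pid_mx_minh (minn_idPl pP).
Qed.

Lemma resize_emb (M : 'M[R]_p) : resize P P M = E *m M *m E^T.
Proof. by rewrite resizeE /first_emb tr_pid_mx. Qed.

Lemma resize_embc (v : 'cV[R]_p) : resize P 1 v = E *m v.
Proof. by rewrite resizeE pid_mx_1 mulmx1. Qed.

Lemma last_compsE (x : 'cV[R]_P) : last_comps p x = F^T *m x.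
Proof.
apply/colP => i; rewrite !mxE.
have ipP : (p + i < P)%N by rewrite -ltn_subRL.
rewrite (bigD1 (Ordinal ipP))//= !mxE eqxx mul1r big1 ?addr0.
  by rewrite -(entryE x (Ordinal ipP) 0).
move=> l li; rewrite !mxE (_ : (_ == _) = false) ?mul0r//.
by apply: contraNF li => /eqP il; apply/eqP/val_inj.
Qed.

Lemma block12E (Q : 'M[R]_P) : block12 p Q = E^T *m Q *m F.
Proof.
apply/matrixP => i j; rewrite !mxE.
have ip : (i < P)%N := leq_trans (ltn_ord i) pP.
have jpP : (p + j < P)%N by rewrite -ltn_subRL.
rewrite (bigD1 (Ordinal jpP))//= [X in _ * X]mxE eqxx mulr1 [X in _ + X]big1 ?addr0.
  rewrite mxE (bigD1 (Ordinal ip))//= !mxE/= eqxx ltn_ord mul1r big1 ?addr0.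
    by rewrite -(entryE Q (Ordinal ip) (Ordinal jpP)).
  move=> l li; rewrite !mxE (_ : (_ == _) = false) ?mul0r//.
  by apply: contraNF li => /eqP il; apply/eqP/val_inj.
move=> l li; rewrite [X in _ * X]mxE (_ : (_ == _) = false) ?mulr0//.
by apply: contraNF li => /eqP il; apply/eqP/val_inj.
Qed.

Lemma resize_col_mx (a : 'cV[R]_p) (b : 'cV[R]_(P - p)) :
  resize P 1 (col_mx a b) = E *m a + F *m b.
Proof.
apply/colP => i; rewrite !mxE.
have [ip|ip] := ltnP i p.
  rewrite (bigD1 (Ordinal ip))//= !mxE eqxx ip mul1r [X in _ + X + _]big1 => [|l li].
    rewrite addr0 [X in _ + X]big1 ?addr0 => [|l _].
      apply: etrans (entryE (col_mx a b) (lshift (P - p) (Ordinal ip)) 0) _.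
      by rewrite col_mxEu.
    by rewrite mxE (_ : (_ == _) = false) ?mul0r// ltn_eqF// ltn_addr.
  rewrite mxE (_ : (_ == _) = false) ?mul0r//.
  by apply: contraNF li => /eqP il; apply/eqP/val_inj.
have ipP : (i - p < P - p)%N by rewrite ltn_sub2r// (leq_ltn_trans ip).
rewrite [X in X + _]big1 ?add0r => [|l _]; last by rewrite mxE ltnNge ip andbF mul0r.
have ipE : (p + Ordinal ipP)%N = i by exact: subnKC.
rewrite (bigD1 (Ordinal ipP))//= last_embE ipE eqxx mul1r big1 ?addr0 => [|l li].
  have := entryE (col_mx a b) (rshift p (Ordinal ipP)) 0.
  by rewrite [nat_of_ord (rshift _ _)]ipE col_mxEd => ->.
rewrite mxE (_ : (_ == _) = false) ?mul0r//.
apply: contraNF li => /eqP il; apply/eqP/val_inj => /=.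
by rewrite il addKn.
Qed.

End resize.

Section whitening.
Context {R : realType} {P : nat}.
Implicit Types Q : 'M[R]_P.

Definition posdef Q := Q^T = Q /\
  forall x : 'cV[R]_P, x != 0 -> 0 < (x^T *m Q *m x) 0 0.

(* Q[p:p]^-1 completed with zeros. *)
Definition block_inv Q p : 'M[R]_P := resize P P (invmx (block11 p Q)).

(* The lower triangular D with D Q D' = 1 and Q[p:p]^-1 = D' pid_p D for every p:
   D maps X'u to the vector of t-statistics, so that these are independent. *)
Definition whiten Q : 'M[R]_P :=
  \matrix_(i, j) (block_inv Q i.+1 i j / xi_inf Q i.+1).

Section fixed.
Variable Q : 'M[R]_P.
Hypothesis pdQ : posdef Q.
Let Qsym : Q^T = Q := pdQ.1.

Lemma posdef_blockP p (x : 'cV[R]_p) : (p <= P)%N -> x != 0 ->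
  0 < (x^T *m block11 p Q *m x) 0 0.
Proof.
move=> pP x0; rewrite block11E//; set E := first_emb P p.
have -> : x^T *m (E^T *m Q *m E) *m x = (E *m x)^T *m Q *m (E *m x).
  by rewrite trmx_mul !mulmxA.
apply: pdQ.2; apply: contra_neq x0 => Ex.
by rewrite -[x]mul1mx -(first_embTK pP) -mulmxA Ex mulmx0.
Qed.

Lemma posdef_block p : (p <= P)%N -> block11 p Q \in unitmx.
Proof.
move=> pP; rewrite -row_free_unit -kermx_eq0; apply/rowV0P => v /sub_kermxP vM.
apply/eqP; rewrite -(inj_eq trmx_inj) trmx0; apply: contraT => v0.
by have := posdef_blockP pP v0; rewrite trmxK vM mul0mx mxE ltxx.
Qed.

Lemma block_invK p : (p <= P)%N ->
  block_inv Q p *m Q *m pid_mx p = pid_mx p :> 'M[R]_P.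
Proof.
move=> pP; rewrite -first_embKT /block_inv resize_emb//.
have VK := mulVmx (posdef_block pP); set V := invmx _ in VK *.
rewrite block11E// in VK.
rewrite -[RHS](_ : first_emb P p *m (V *m ((first_emb P p)^T *m Q *m first_emb P p))
  *m (first_emb P p)^T = _); first by rewrite !mulmxA.
by rewrite VK mulmx1.
Qed.

Lemma block_inv_pid p : (p <= P)%N -> block_inv Q p *m pid_mx p = block_inv Q p.
Proof.
move=> pP; rewrite -first_embKT /block_inv resize_emb//.
by rewrite -!mulmxA (mulmxA _ _ (_^T)) first_embTK// mul1mx.
Qed.

Lemma block_inv_outr p (i j : 'I_P) : (p <= P)%N -> (p <= j)%N -> block_inv Q p i j = 0.
Proof.
move=> pP pj; rewrite -block_inv_pid// mxE big1// => l _.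
rewrite [X in _ * X]mxE (_ : (_ && _) = false) ?mulr0//.
by apply/negbTE; rewrite negb_and -leqNgt; case: eqP => //= ->.
Qed.

(** The entry is the quadratic form of the block [M] at the nonzero vector [invmx M *m e]. *)
Lemma block_inv_diag_gt0 (i : 'I_P) : 0 < block_inv Q i.+1 i i.
Proof.
set M := block11 i.+1 Q; have uM : M \in unitmx by exact: posdef_block.
have -> : block_inv Q i.+1 i i = invmx M ord_max ord_max.
  by rewrite mxE -(entryE (invmx M) ord_max ord_max).
pose e : 'cV[R]_i.+1 := delta_mx ord_max 0.
have y0 : invmx M *m e != 0.
  apply/negP => /eqP y0; have : M *m (invmx M *m e) = 0 by rewrite y0 mulmx0.
  rewrite mulKVmx// => /matrixP/(_ ord_max 0)/eqP.
  by rewrite !mxE !eqxx oner_eq0.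
have := posdef_blockP (ltn_ord i) y0; rewrite -/M trmx_mul -!mulmxA mulKVmx//.
rewrite trmx_delta -rowE mxE -colE !mxE.
have Msym : M^T = M by rewrite /M block11E// !trmx_mul trmxK Qsym mulmxA.
by rewrite -[in invmx _]Msym -trmx_inv mxE.
Qed.

Lemma xi_inf_sqr (i : 'I_P) : xi_inf Q i.+1 ^+ 2 = block_inv Q i.+1 i i.
Proof.
have := block_inv_diag_gt0 i; rewrite mxE => d0.
by rewrite sqr_sqrtr//; exact: ltW.
Qed.

Lemma xi_inf_gt0 (i : 'I_P) : 0 < xi_inf Q i.+1.
Proof. by rewrite sqrtr_gt0; have := block_inv_diag_gt0 i; rewrite mxE. Qed.

Lemma whiten_trig (i j : 'I_P) : (i < j)%N -> whiten Q i j = 0.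
Proof. by move=> ij; rewrite mxE block_inv_outr ?mul0r. Qed.

Lemma whiten_diag (i : 'I_P) : whiten Q i i = xi_inf Q i.+1.
Proof.
rewrite mxE -xi_inf_sqr expr2 mulfK// gt_eqF//; exact: xi_inf_gt0.
Qed.

(** Row [i] of [whiten Q] is a multiple of the last row of the inverse block of size [i.+1], whose
    product with [Q] is a unit vector on the first [i.+1] columns. So [whiten Q *m Q] is upper
    triangular although [whiten Q] is lower triangular. *)
Lemma whitenQ_trig (i j : 'I_P) : (j <= i)%N ->
  (whiten Q *m Q) i j = (i == j)%:R / xi_inf Q i.+1.
Proof.
move=> ji.
have -> : (whiten Q *m Q) i j = (block_inv Q i.+1 *m Q) i j / xi_inf Q i.+1.
  by rewrite !mxE mulr_suml; apply: eq_bigr => l _; rewrite mxE mulrAC.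
congr (_ / _); have := congr1 (fun M : 'M[R]_P => M i j) (block_invK (ltn_ord i)).
rewrite /= mxE (bigD1 j)//= !mxE eqxx ltnS ji mulr1 [X in _ + X]big1 ?addr0.
  by move=> ->; rewrite ltnSn andbT.
move=> l lj; rewrite [X in _ * X]mxE (_ : (_ == _) = false) ?mulr0//.
by apply: contraNF lj => /eqP il; apply/eqP/val_inj.
Qed.

(** The product of the upper triangular [whiten Q *m Q] and [(whiten Q)^T] is upper triangular and
    also symmetric, hence diagonal. *)
Lemma whitenK : whiten Q *m Q *m (whiten Q)^T = 1%:M.
Proof.
have upper (i j : 'I_P) : (j <= i)%N -> (whiten Q *m Q *m (whiten Q)^T) i j = (i == j)%:R.
  move=> ji; rewrite mxE (bigD1 i)//= [X in _ + X]big1 ?addr0.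
    rewrite whitenQ_trig// eqxx [X in _ * X]mxE.
    have [ij|ij] := eqVneq i j.
      by rewrite ij whiten_diag mul1r mulVf ?gt_eqF ?xi_inf_gt0.
    by rewrite whiten_trig ?mulr0// ltn_neqAle eq_sym ij.
  move=> l li; have [li'|il] := leqP l i.
    by rewrite whitenQ_trig// eq_sym (negbTE li) !mul0r.
  by rewrite [X in _ * X]mxE whiten_trig ?mulr0// (leq_ltn_trans ji).
have sym : (whiten Q *m Q *m (whiten Q)^T)^T = whiten Q *m Q *m (whiten Q)^T.
  by rewrite !trmx_mul trmxK Qsym mulmxA.
apply/matrixP => i j; rewrite [RHS]mxE.
have [ji|ij] := leqP j i; first exact: upper.
by rewrite -sym mxE upper 1?eq_sym// ltnW.
Qed.

Lemma whitenTK : (whiten Q)^T *m whiten Q *m Q = 1%:M.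
Proof. by rewrite -mulmxA; apply: mulmx1C; exact: whitenK. Qed.

(** The last component of the estimator of order [i.+1] involves the statistic of index [i] alone;
    this is what makes that statistic the t-statistic of this component. *)
Lemma whitenT_pid (i : 'I_P) (v : 'cV[R]_P) :
  ((whiten Q)^T *m (pid_mx i.+1 *m v)) i 0 = xi_inf Q i.+1 * v i 0.
Proof.
rewrite mxE (bigD1 i)//= mxE whiten_diag// pid_mulmxE ltnSn mul1r big1 ?addr0// => l li.
rewrite mxE pid_mulmxE; have [lti|il] := ltnP l i.+1; last by rewrite mul0r mulr0.
by rewrite whiten_trig ?mul0r// ltn_neqAle -ltnS lti andbT; exact: li.
Qed.

(** Both sides invert [Q] on the span of the first [p] coordinates, one from the left and the other
    from the right, and therefore agree. *)
Lemma block_invE p : (p <= P)%N ->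
  block_inv Q p = (whiten Q)^T *m pid_mx p *m whiten Q.
Proof.
move=> pP; set D := whiten Q.
pose J : 'M[R]_P := pid_mx p.
have pidlJ n (M : 'M[R]_(P, n)) i j : (J *m M) i j = (i < p)%:R * M i j by exact: pid_mulmxE.
have pidrJ n (M : 'M[R]_(n, P)) i j : (M *m J) i j = M i j * (j < p)%:R by exact: mulmx_pidE.
have BJ : block_inv Q p *m J = block_inv Q p by exact: block_inv_pid.
have BQJ : block_inv Q p *m Q *m J = J by exact: block_invK.
rewrite -[pid_mx p]/J.
(* [D^T] and [D *m Q] are upper triangular, so both preserve the span of the first [p]
   coordinates. *)
have pidDT : J *m (D^T *m J) = D^T *m J.
  apply/matrixP => i j; rewrite pidlJ pidrJ [D^T i j]mxE.
  have [_|pi] := ltnP i p; first by rewrite mul1r.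
  have [jp|_] := ltnP j p; last by rewrite !mulr0.
  by rewrite whiten_trig ?mul0r ?mulr0// (leq_trans jp).
have pidDQ : J *m (D *m Q *m J) = D *m Q *m J.
  apply/matrixP => i j; rewrite pidlJ pidrJ.
  have [_|pi] := ltnP i p; first by rewrite mul1r.
  have [jp|_] := ltnP j p; last by rewrite !mulr0.
  have ji := leq_trans jp pi.
  by rewrite whitenQ_trig 1?ltnW// -val_eqE/= gtn_eqF// !mul0r.
have Jtr : J^T = J by rewrite tr_pid_mx.
have CQ : D^T *m J *m D *m Q *m J = J.
  have -> : D^T *m J *m D *m Q *m J
      = D^T *m (J *m (D *m Q *m J)) by rewrite !mulmxA.
  by rewrite pidDQ !mulmxA whitenTK mul1mx.
have QC : J *m Q *m (D^T *m J *m D) = J.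
  transitivity ((D^T *m J *m D *m Q *m J)^T); last by rewrite CQ.
  by rewrite !trmx_mul !trmxK Qsym Jtr !mulmxA.
have pidC : J *m (D^T *m J *m D) = D^T *m J *m D.
  by rewrite !mulmxA -(mulmxA J) pidDT.
set C := D^T *m J *m D in QC pidC *.
transitivity (block_inv Q p *m Q *m C).
  by rewrite -[LHS]BJ -[X in _ *m X]QC !mulmxA BJ.
by rewrite -pidC mulmxA BQJ pidC.
Qed.

End fixed.
End whitening.

(** * Statistics of the sample *)

Section gram.
Context {R : realType} {P : nat}.

Lemma sqn_eq0 n (z : 'cV[R]_n) : sqn z = 0 -> z = 0.
Proof.
move=> z0; apply/eqP; rewrite -(inj_eq trmx_inj) trmx0; apply/eqP.
by apply: row_sqr_eq0; rewrite trmxK.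
Qed.

Lemma sqnZ n (a : R) (z : 'cV[R]_n) : sqn (a *: z) = a ^+ 2 * sqn z.
Proof.
by rewrite !sqnE mulr_sumr; apply: eq_bigr => i _; rewrite mxE exprMn.
Qed.

Lemma posdef_gram n (X : 'M[R]_(n, P)) : (0 < n)%N -> \rank X = P ->
  posdef (n%:R^-1 *: (X^T *m X)).
Proof.
move=> n0 rX; split=> [|x x0]; first by rewrite linearZ/= trmx_mul trmxK.
rewrite -scalemxAr -scalemxAl mxE pmulr_rgt0 ?invr_gt0 ?ltr0n//.
have -> : x^T *m (X^T *m X) *m x = (X *m x)^T *m (X *m x).
  by rewrite trmx_mul !mulmxA.
rewrite -/(sqn _) lt_neqAle sqn_ge0 andbT eq_sym; apply: contra_neq x0 => /sqn_eq0 Xx.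
have fX : row_free X^T by rewrite /row_free mxrank_tr rX.
apply: trmx_inj; apply: (row_free_inj fX).
by rewrite -trmx_mul Xx !trmx0 mul0mx.
Qed.

(** The limit form is nonnegative. If it vanishes at [x], then [Q *m x = 0], since otherwise a small
    step from [x] against [Q *m x] would make it negative; nonsingularity then gives [x = 0]. *)
Lemma posdef_lim (Qn : nat -> 'M[R]_P) (Q : 'M[R]_P) : mxcvg Qn Q ->
  (\forall n \near \oo, posdef (Qn n)) -> Q \in unitmx -> posdef Q.
Proof.
move=> QnQ [N _ pdN] uQ; have QnQT := mxcvg_tr QnQ.
have Qsym : Q^T = Q.
  apply/matrixP => i j; apply: (@cvg_unique _ _ _ _ _ _ (QnQT i j)) => //.
  apply: cvg_trans (QnQ i j); apply: near_eq_cvg; exists N => // n Nn.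
  by rewrite (pdN _ Nn).1.
have psd (x : 'cV[R]_P) : 0 <= (x^T *m Q *m x) 0 0.
  have xc : mxcvg (fun n => x^T *m Qn n *m x) (x^T *m Q *m x).
    apply: mxcvg_mul; last exact: mxcvg_cst.
    by apply: mxcvg_mul => //; exact: mxcvg_cst.
  rewrite -(cvg_lim _ (xc 0 0))//; apply: limr_ge.
    by apply/cvg_ex; eexists; exact: xc.
  exists N => // n Nn; have [->|x0] := eqVneq x 0; first by rewrite mulmx0 mxE.
  exact/ltW/(pdN _ Nn).2.
split=> // x x0; rewrite lt_neqAle psd andbT eq_sym; apply: contra_neq x0 => xQx.
pose y := Q *m x; have yE : y^T = x^T *m Q by rewrite trmx_mul Qsym.
suff y0 : y = 0 by rewrite -[x](mulKmx uQ) -/y y0 mulmx0.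
apply: sqn_eq0; apply/eqP; rewrite eq_le sqn_ge0 andbT leNgt; apply/negP => a_gt0.
set a := sqn y in a_gt0; pose b := (y^T *m Q *m y) 0 0.
have b0 : 0 <= b := psd y.
have quad t : 0 <= - (2 * t * a) + t ^+ 2 * b.
  have linl (u v w : 'cV[R]_P) : ((u - t *: v)^T *m Q *m w) 0 0 =
      (u^T *m Q *m w) 0 0 - t * (v^T *m Q *m w) 0 0.
    by rewrite linearB linearZ/= !mulmxBl -!scalemxAl !mxE.
  have linr (u v w : 'cV[R]_P) : (u^T *m Q *m (v - t *: w)) 0 0 =
      (u^T *m Q *m v) 0 0 - t * (u^T *m Q *m w) 0 0.
    by rewrite mulmxBr -!scalemxAr !mxE.
  have := psd (x - t *: y); rewrite linl !linr xQx sub0r -/b.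
  rewrite -yE -mulmxA -/y -/(sqn y) -/a.
  by congr (0 <= _); ring.
have b1 : 0 < b + 1 by rewrite ltr_wpDl.
(* Nearly the minimizer [a / b]; here [b] is only known to be nonnegative, and with [b + 1] the
   value is still negative. *)
have := quad (a / (b + 1)).
have -> : - (2 * (a / (b + 1)) * a) + (a / (b + 1)) ^+ 2 * b =
  - (a / (b + 1)) ^+ 2 * (b + 2) by field; rewrite gt_eqF.
rewrite leNgt mulNr oppr_lt0 mulr_gt0//; first by rewrite exprn_gt0// divr_gt0.
by rewrite ltr_wpDl.
Qed.

End gram.

Section whiten_limits.
Context {R : realType} {P : nat}.
Variables (Qn : nat -> 'M[R]_P) (Q : 'M[R]_P).
Hypotheses (QnQ : mxcvg Qn Q) (pdQ : posdef Q).

Lemma mxcvg_block_inv p : (p <= P)%N ->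
  mxcvg (fun n => block_inv (Qn n) p) (block_inv Q p).
Proof.
move=> pP; have cE := @mxcvg_cst R _ _ (first_emb P p).
have cB : mxcvg (fun n => block11 p (Qn n)) (block11 p Q).
  rewrite block11E//; under eq_fun do rewrite block11E//.
  exact: mxcvg_mul (mxcvg_mul (mxcvg_tr cE) QnQ) cE.
have cI := mxcvg_inv (posdef_block pdQ pP) cB.
rewrite /block_inv resize_emb; under eq_fun do rewrite resize_emb.
exact: mxcvg_mul (mxcvg_mul cE cI) (mxcvg_tr cE).
Qed.

Lemma cvg_xi_inf (i : 'I_P) : xi_inf (Qn n) i.+1 @[n --> \oo] --> xi_inf Q i.+1.
Proof.
have xiE (S : 'M[R]_P) : xi_inf S i.+1 = Num.sqrt (block_inv S i.+1 i i) by rewrite mxE.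
rewrite xiE; under eq_fun do rewrite xiE.
apply: continuous_cvg; first exact: sqrt_continuous.
exact: mxcvg_block_inv.
Qed.

Lemma mxcvg_whiten : mxcvg (fun n => whiten (Qn n)) (whiten Q).
Proof.
move=> i j; rewrite mxE; under eq_fun do rewrite mxE.
apply: cvgM; first exact: mxcvg_block_inv.
apply: cvgV; last exact: cvg_xi_inf.
by rewrite gt_eqF//; exact: xi_inf_gt0.
Qed.

End whiten_limits.

Section delta.
Context {R : realType} {P : nat}.
Variables (Q : 'M[R]_P) (gam : 'cV[R]_P).
Hypothesis pdQ : posdef Q.

(** [block_inv Q p *m Q] is the projection onto the first [p] coordinates that is orthogonal for the
    form [Q], so [delta] is minus the part of [gam] that order [p] cannot fit. *)
Lemma deltaE p : (p <= P)%N -> delta Q gam p = block_inv Q p *m Q *m gam - gam.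
Proof.
move=> pP; rewrite /delta mul_col_mx resize_col_mx// last_compsE// block12E//.
rewrite mulNmx mul1mx !mulmxN.
set E := first_emb P p; set F := last_emb P p.
have FF : F *m F^T = 1%:M - pid_mx p by exact: last_embKT.
rewrite (mulmxA F) FF mulmxBl mul1mx.
have -> : E *m (invmx (block11 p Q) *m (E^T *m Q *m F) *m (F^T *m gam)) =
    block_inv Q p *m Q *m ((F *m F^T) *m gam).
  by rewrite /block_inv resize_emb !mulmxA.
rewrite FF mulmxBl mul1mx mulmxBr (mulmxA _ (pid_mx p)) block_invK//.
by rewrite opprB addrA subrK.
Qed.

Lemma component_ord (x : 'cV[R]_P) (i : 'I_P) : component x i.+1 = x i 0.
Proof. by rewrite /component -(entryE x i 0). Qed.

Lemma delta_component (i : 'I_P) :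
  component (delta Q gam i.+1) i.+1 + component gam i.+1 =
  xi_inf Q i.+1 * (whiten Q *m Q *m gam) i 0.
Proof.
rewrite !component_ord deltaE// mxE [X in _ + X + _]mxE subrK -!mulmxA !mxE mulr_sumr.
apply: eq_bigr => l _; rewrite [whiten Q i l]mxE mulrA; congr (_ * _).
by rewrite mulrCA divff ?mulr1// gt_eqF// xi_inf_gt0.
Qed.

End delta.

Section sample_algebra.
Context {R : realType} {P n : nat}.
Variable X : 'M[R]_(n, P).
Hypotheses (nP : (P < n)%N) (rX : \rank X = P).
Let Qn := n%:R^-1 *: (X^T *m X).
Let n0 : (0 < n)%N := leq_ltn_trans (leq0n P) nP.
Let nR0 : n%:R != 0 :> R.
Proof. by rewrite pnatr_eq0 -lt0n. Qed.
Let rn := Num.sqrt n%:R : R.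
Let rn0 : 0 < rn.
Proof. by rewrite sqrtr_gt0 ltr0n. Qed.
Let rn2 : rn * rn = n%:R.
Proof. by rewrite -expr2 sqr_sqrtr// ler0n. Qed.
Let pdQn : posdef Qn := posdef_gram n0 rX.
Let D := whiten Qn.

Lemma gramE p : (p <= P)%N ->
  (first_cols p X)^T *m first_cols p X = n%:R *: block11 p Qn.
Proof.
move=> pP; rewrite first_colsE// block11E// trmx_mul /Qn -scalemxAr -scalemxAl.
by rewrite scalerA divff// scale1r !mulmxA.
Qed.

Lemma xi_nE p : (p <= P)%N -> xi_n X p = xi_inf Qn p.
Proof. by move=> pP; rewrite /xi_n gramE// scalerA mulVf// scale1r. Qed.

Lemma restricted_lsE p y : (p <= P)%N ->
  restricted_ls X p y = n%:R^-1 *: (block_inv Qn p *m (X^T *m y)).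
Proof.
move=> pP; rewrite /restricted_ls gramE// invmxZ; last first.
  by rewrite unitmxZ ?unitfE//; exact: posdef_block.
rewrite resize_embc first_colsE// /block_inv resize_emb trmx_mul -!scalemxAl -scalemxAr.
by rewrite !mulmxA.
Qed.

(* The vector (T*_1, ..., T*_P). *)
Definition tstar (s : R) (y : 'cV[R]_n) : 'cV[R]_P :=
  (rn * s)^-1 *: (D *m (X^T *m y)).

Lemma restricted_ls_tstar p s y : (p <= P)%N -> s != 0 ->
  restricted_ls X p y = (s / rn) *: (D^T *m (pid_mx p *m tstar s y)).
Proof.
move=> pP s0; rewrite restricted_lsE// block_invE// -/D /tstar -!scalemxAr scalerA.
rewrite !mulmxA; congr (_ *: _); rewrite -rn2; field.
by rewrite s0 gt_eqF.
Qed.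

Lemma t_statE (i : 'I_P) s s' y : s != 0 ->
  t_stat X s' i.+1 y = s / s' * tstar s y i 0.
Proof.
move=> s0; rewrite /t_stat/= xi_nE// (restricted_ls_tstar _ _ s0)// component_ord mxE.
rewrite (whitenT_pid pdQn) mulrA -/rn invfM.
have xi0 : xi_inf Qn i.+1 != 0 by rewrite gt_eqF// xi_inf_gt0.
(* An estimated scale can vanish; its inverse is then 0 by convention, and so are both sides. *)
have [->|s'0] := eqVneq s' 0; first by rewrite invr0 !(mulr0, mul0r).
by field; rewrite xi0 s'0 gt_eqF.
Qed.

Lemma tstarD s (th : 'cV[R]_P) u : s != 0 ->
  tstar s (X *m th + u) = tstar s u + (rn / s) *: (D *m Qn *m th).
Proof.
move=> s0; rewrite /tstar !mulmxDr scalerDr addrC; congr (_ + _).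
rewrite /Qn -scalemxAr -!scalemxAl scalerA !mulmxA; congr (_ *: _).
by rewrite -rn2; field; rewrite s0 gt_eqF.
Qed.

(** Pythagoras: the fitted part of the noise is orthogonal to the residual and has squared norm
    [s ^+ 2 * sqn (tstar s u)]. *)
Lemma sigma_hat_sqr s (th : 'cV[R]_P) u : s != 0 ->
  sigma_hat X (X *m th + u) =
  Num.sqrt ((n - P)%N%:R^-1 * (sqn u - s ^+ 2 * sqn (tstar s u))).
Proof.
move=> s0; rewrite /sigma_hat; congr (Num.sqrt (_ * _)).
pose w := n%:R^-1 *: (block_inv Qn P *m (X^T *m u)).
have BQ : block_inv Qn P *m Qn = 1%:M.
  by have := block_invK pdQn (leqnn P); rewrite pid_mx_1 mulmx1.
have lsE : restricted_ls X P (X *m th + u) = th + w.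
  rewrite restricted_lsE// !mulmxDr scalerDr; congr (_ + _).
  have -> : X^T *m (X *m th) = n%:R *: (Qn *m th).
    by rewrite /Qn -scalemxAl scalerA divff// scale1r mulmxA.
  by rewrite -scalemxAr scalerA mulVf// scale1r mulmxA BQ mul1mx.
have rE : X *m th + u - X *m (th + w) = u - X *m w.
  by rewrite mulmxDr opprD addrACA subrr add0r.
have XXw : X^T *m (X *m w) = X^T *m u.
  have -> : X^T *m (X *m w) = n%:R *: (Qn *m w).
    by rewrite /Qn -scalemxAl scalerA divff// scale1r mulmxA.
  rewrite /w -scalemxAr scalerA divff// scale1r mulmxA.
  by rewrite !mulmxA (mulmx1C BQ) mul1mx.
have uXw : u^T *m (X *m w) = (s ^+ 2 * sqn (tstar s u))%:M.
  pose v := D *m (X^T *m u).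
  have -> : u^T *m (X *m w) = n%:R^-1 *: (v^T *m v).
    rewrite /w -!scalemxAr; congr (_ *: _).
    have -> : block_inv Qn P = D^T *m D by rewrite block_invE// pid_mx_1 mulmx1.
    by rewrite /v !trmx_mul trmxK !mulmxA.
  rewrite /tstar -/v sqnZ [LHS]mx11_scalar mxE; congr (_%:M); rewrite mulrA.
  by congr (_ * _); rewrite -rn2; field; rewrite s0 gt_eqF.
have sqB (a b : 'cV[R]_n) : (a - b)^T *m (a - b) = a^T *m a - a^T *m b - (b^T *m a - b^T *m b).
  by rewrite [(a - b)^T]linearB/= mulmxBl !mulmxBr.
rewrite lsE rE sqB uXw trmx_mul -!mulmxA XXw subrr subr0.
by rewrite mxE [X in _ + X]mxE [X in - X]mxE eqxx mulr1n.
Qed.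

(** The statistics are [K] times a standard Gaussian vector of R^n, and [K *m K^T = 1] is [whitenK]
    for the Gram matrix. *)
Lemma tstar_law s (B : set 'cV[R]_P) : 0 < s -> measurable B ->
  gaussian 0 (s ^+ 2)%:M [set u | B (tstar s u)] = std_gaussian P B.
Proof.
move=> s0 mB; have sE : (s ^+ 2)%:M = s%:M *m (s%:M)^T :> 'M[R]_n.
  by rewrite tr_scalar_mx -scalar_mxM expr2.
have mt : measurable_fun setT (tstar s).
  rewrite (_ : tstar s = fun u => ((rn * s)^-1 *: (D *m X^T)) *m u).
    exact: measurable_mulmx.
  by apply/funext => u; rewrite /tstar -scalemxAl mulmxA.
rewrite (gaussianE 0 sE); last exact: measurable_preimage mt mB.
pose K : 'M[R]_(P, n) := rn^-1 *: (D *m X^T).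
have KE v : tstar s (s%:M *m v + 0) = K *m v.
  rewrite /tstar /K addr0 mul_scalar_mx -!scalemxAr scalerA -scalemxAl mulmxA.
  by congr (_ *: _); field; rewrite !gt_eqF.
have KK : K *m K^T = 1%:M *m (1%:M)^T.
  rewrite trmx1 mulmx1 /K linearZ/= -scalemxAl -scalemxAr scalerA trmx_mul trmxK.
  rewrite -(whitenK pdQn) -/D /Qn -scalemxAr -scalemxAl !mulmxA; congr (_ *: _).
  by rewrite -rn2 invfM.
rewrite (_ : [set z | _] = [set z | B (K *m z)]); last first.
  by apply/seteqP; split => v /=; rewrite KE.
rewrite (std_gaussian_cov KK mB); congr (std_gaussian P _).
by apply/seteqP; split => v /=; rewrite mul1mx.
Qed.

End sample_algebra.

(** * The limit experiment *)

(** [S o] excludes the empty maximum, whose value 0 could be mistaken for an index. *)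
Lemma bigmax_natP (o P q : nat) (S : pred nat) : (o <= P)%N -> S o ->
  ((\max_(o <= p < P.+1 | S p) p)%N = q) <->
  [/\ (o <= q <= P)%N, S q & forall r, (q < r <= P)%N -> ~~ S r].
Proof.
move=> oP So; set m := (\max_(_ <= _ < _ | _) _)%N.
have ub r : (o <= r <= P)%N -> S r -> (r <= m)%N.
  move=> /andP[or rP] Sr; rewrite /m.
  by apply: (@leq_bigmax_seq _ _ _ id) => //; rewrite mem_index_iota or ltnS.
have om : (o <= m)%N by apply: ub => //; rewrite leqnn.
have [mP Sm] : (m <= P)%N /\ S m.
  rewrite /m big_seq_cond.
  have : (\max_(i <- index_iota o P.+1 | (i \in index_iota o P.+1) && S i) i)%N = 0%N \/
     (\max_(i <- index_iota o P.+1 | (i \in index_iota o P.+1) && S i) i <= P)%N /\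
     S (\max_(i <- index_iota o P.+1 | (i \in index_iota o P.+1) && S i) i)%N.
    apply: (big_ind (fun x => x = 0%N \/ (x <= P)%N /\ S x)); first by left.
    - move=> x y [->|[xP Sx]] [->|[yP Sy]]; rewrite ?max0n ?maxn0; [by left|by right|by right|].
      by right; rewrite /maxn; case: ifP.
    - by move=> i /andP[]; rewrite mem_index_iota ltnS => /andP[_ iP] Si; right.
  rewrite -big_seq_cond -/m => -[m0|//].
  have o0 : o = 0%N by apply/eqP; rewrite -leqn0 -m0.
  by rewrite m0; split => //; rewrite -o0.
split=> [<-|[/andP[oq qP] Sq Sr]].
  split=> [||r /andP[mr rP]]; [by rewrite om|by []|].
  apply: contraL (mr) => Sr; rewrite -leqNgt; apply: ub => //.
  by rewrite rP andbT (leq_trans om)// ltnW.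
apply/eqP; rewrite eqn_leq ub ?oq// andbT leqNgt; apply/negP => qm.
by have := Sr m; rewrite qm mP Sm => /(_ isT).
Qed.

Section gaussian_events.
Context {R : realType}.
Local Notation N := (normal_prob (0 : R) 1).
Local Notation T := (measurableTypeR R).

Lemma gaussian_uncorrelated m n (v : 'rV[R]_n) (W : 'M[R]_(m, n)) (t : R)
    (E : set (T * 'cV[R]_m)) :
  W *m v^T = 0 -> (v *m v^T) 0 0 = t ^+ 2 -> measurable E ->
  (std_gaussian n [set z : 'cV[R]_n | E ((v *m z) 0 0 : T, W *m z)]%R =
   \int[std_gaussian n]_z N [set x : T | E (t * x : T, W *m z)]%R)%E.
Proof.
move=> Wv vv mE.
pose f (w : 'cV[R]_m.+1) := (\1_E (w 0 0 : T, \col_i w (lift ord0 i) 0))%:E : \bar R.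
have mp : measurable_fun setT
    (fun w : 'cV[R]_m.+1 => (w 0 0 : T, \col_i w (lift ord0 i) 0 : 'cV[R]_m)).
  apply: measurable_fun_pair; first exact: measurable_entry.
  apply: measurable_matrixP => i j; under eq_fun do rewrite mxE.
  exact: measurable_entry.
have mf : measurable_fun setT f.
  by apply/measurable_EFinP; exact: (measurableT_comp (measurable_indic mE) mp).
have f0 w : (0 <= f w)%E by rewrite lee_fin.
have fE (x : T) (w : 'cV[R]_m) : f (cV_cons (x, w)) = (\1_E (x, w))%:E.
  rewrite /f; congr (\1_E (_, _))%:E.
    rewrite (_ : 0 = @lshift 1 m 0); last exact: val_inj.
    by apply: etrans (@col_mxEu R 1 m 1 _ _ _ _) _; rewrite mxE eqxx mulr1n.
  apply/colP => i; rewrite mxE (_ : lift ord0 i = @rshift 1 m i); last exact: val_inj.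
  exact: (@col_mxEd R 1 m 1).
have := ge0_integral_gaussian_uncorrelated Wv vv mf f0.
under eq_integral do rewrite fE.
under [X in _ = X -> _]eq_integral => z _.
  under eq_integral do rewrite fE.
  over.
move=> H.
have mvW : measurable_fun setT (fun z : 'cV[R]_n => ((v *m z) 0 0 : T, W *m z)).
  apply: measurable_fun_pair; last exact: measurable_mulmx.
  exact: (measurableT_comp (measurable_entry 0 0) (measurable_mulmx v)).
rewrite -integral_indic_preimage; last exact: measurable_preimage mvW mE.
apply: etrans H _; apply: eq_integral => z _.
rewrite -integral_indic_preimage//.
apply: (@measurable_preimage _ _ _ _ (fun x : T => (t * x : T, W *m z)) E) => //.
by apply: measurable_fun_pair => //; exact: measurable_funM.
Qed.

Lemma gaussian_independent m n (v : 'rV[R]_n) (W : 'M[R]_(m, n)) (t : R)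
    (B : set 'cV[R]_m) (C : set T) :
  W *m v^T = 0 -> (v *m v^T) 0 0 = t ^+ 2 -> measurable B -> measurable C ->
  (std_gaussian n [set z : 'cV[R]_n | B (W *m z) /\ C ((v *m z) 0 0)]%R =
   std_gaussian n [set z : 'cV[R]_n | B (W *m z)]%R * N [set x : T | C (t * x)]%R)%E.
Proof.
move=> Wv vv mB mC.
have mE : measurable (C `*` B) by exact: measurableX.
have := gaussian_uncorrelated Wv vv mE.
rewrite (_ : [set z | _] = [set z | B (W *m z) /\ C ((v *m z) 0 0)]); last first.
  by apply/seteqP; split => z /= [? ?].
move=> ->.
have mBW : measurable [set z | B (W *m z)].
  exact: (measurable_preimage (measurable_mulmx W) mB).
have E z : N [set x | (C `*` B) (t * x : T, W *m z)] =
    ((\1_[set z | B (W *m z)] z)%:E * N [set x : T | C (t * x)]%R)%E.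
  rewrite indicE; case: (boolP (z \in _)) => [|]; rewrite ?inE ?notin_setE/= => Bz.
    rewrite mul1e; congr (N _); apply/seteqP; split => x /=; first by case.
    by move=> Cx; split.
  rewrite mul0e [X in N X](_ : _ = set0) ?measure0//.
  by apply/seteqP; split => x //= -[].
under eq_integral do rewrite E.
rewrite ge0_integralZr//; last first.
  by apply/measurable_EFinP; exact: measurable_indic.
by rewrite integral_indic_preimage.
Qed.

(** With [s x], [x] standard normal, in place of a N(0, s^2) variable, the case [s = 0] fits the
    same formula. The sign of [a] changes by symmetry of the normal law. *)
Lemma DeltaE (s a b : R) :
  Delta s a b = fine (N [set x | `|s * (x : R) + a| < b]).
Proof.
rewrite /Delta; have mB (u v : R) : measurable [set x : T | `|u * x + v| < b].
  have mf : measurable_fun setT (fun x : T => `|u * x + v| : T).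
    apply: (measurableT_comp (@normr_measurable R setT)).
    by apply: measurable_funD => //; exact: measurable_funM.
  have -> : [set x : T | `|u * x + v| < b] =
      [set x : T | [set y : T | y \in `]-oo, b[] `|u * x + v|].
    by apply/seteqP; split => x /=; rewrite in_itv.
  exact: (measurable_preimage mf).
case: eqVneq => [->|s0]; congr fine.
  rewrite diracE.
  under [in RHS]eq_set do rewrite mul0r add0r.
  case: (boolP (`|a| < b)) => ab.
    rewrite (_ : [set x | true] = setT) ?probability_setT ?mem_set//=; last first.
      by apply/seteqP.
    by rewrite sub0r normrN.
  rewrite (_ : [set x | false] = set0) ?measure0 ?memNset//=; last first.
    by apply/seteqP; split=> x.
  by rewrite sub0r normrN; exact/negP.
have mf : measurable_fun setT (fun x : T => (\1_[set x : T | `|x - a| < b] x)%:E : \bar R).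
  apply/measurable_EFinP; apply: measurable_indic.
  by have := mB 1 (- a); under eq_set do rewrite mul1r.
have f0 x : (0 <= (\1_[set x : T | `|x - a| < b] x)%:E :> \bar R)%E by rewrite lee_fin.
have mA : measurable [set x : T | `|x - a| < b].
  by have := mB 1 (- a); under eq_set do rewrite mul1r.
rewrite -(integral_indic_preimage _ mA).
apply: etrans (esym (ge0_integral_normal_affine1 _ s0 mf f0)) _.
rewrite -(integral_indic_preimage _ (mB s a)).
have mg : measurable_fun setT (fun x : T => (\1_[set x : T | `|x - a| < b] (affine1 s 0 x))%:E : \bar R).
  by apply: (measurableT_comp mf); exact: measurable_affine1.
have sgn : (-1 : R) ^+ 2 = 1 by rewrite sqrrN expr1n.
apply: etrans (esym (ge0_integral_normal_sign sgn mg _)) _ => //.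
apply: eq_integral => x _; congr (_ %:E); rewrite !indicE; congr (_%:R); congr nat_of_bool.
by apply/idP/idP; rewrite !inE/= /affine1 addr0 mulN1r mulrN -opprD normrN.
Qed.

End gaussian_events.

(** * Regression of a statistic on the estimator *)

Section limit_algebra.
Context {R : realType} {P k : nat}.
Variables (Q : 'M[R]_P) (A : 'M[R]_(k, P)) (ginv : 'M[R]_k -> 'M[R]_k).
Hypothesis pdQ : posdef Q.
Hypothesis hginv : forall M, is_ginv M (ginv M).

(** The coefficients of A theta~(p) in the statistics, up to scale. *)
Definition limit_root p : 'M[R]_(k, P) := A *m ((whiten Q)^T *m pid_mx p).

Lemma limit_root_pid p : limit_root p *m pid_mx p = limit_root p.
Proof. by rewrite /limit_root -!mulmxA pid_mxK. Qed.

Lemma cov_infE p : (p <= P)%N -> cov_inf Q A p = limit_root p *m (limit_root p)^T.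
Proof.
move=> pP; rewrite /cov_inf first_colsE// trmx_mul.
have -> : A *m first_emb P p *m invmx (block11 p Q) *m ((first_emb P p)^T *m A^T) =
    A *m block_inv Q p *m A^T by rewrite /block_inv resize_emb// !mulmxA.
rewrite block_invE// /limit_root !trmx_mul trmxK tr_pid_mx !mulmxA.
by rewrite -(mulmxA _ (pid_mx p) (pid_mx p)) pid_mxK.
Qed.

(** [C_inf] is a covariance with component p of the estimator of order p, which is [xi_inf] times a
    single statistic; this selects one column of the root. *)
Lemma C_infE (i : 'I_P) : C_inf Q A i.+1 =
  xi_inf Q i.+1 *: (limit_root i.+1 *m delta_mx i 0).
Proof.
have lb : last_basis i.+1 = (first_emb P i.+1)^T *m delta_mx i 0 :> 'cV[R]_i.+1.
  apply/colP => l; rewrite !mxE (bigD1 i)//= !mxE eqxx mulr1 big1 ?addr0; last first.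
    by move=> j ji; rewrite !mxE (negbTE ji) mulr0.
  by rewrite ltnSn andbT eqSS eq_sym.
have De : pid_mx i.+1 *m whiten Q *m delta_mx i 0 = xi_inf Q i.+1 *: delta_mx i 0 :> 'cV[R]_P.
  rewrite -colE; apply/colP => l; rewrite mxE pid_mulmxE 2![in RHS]mxE eqxx andbT ltnS.
  case: (ltngtP l i) => [li|li|/val_inj->]; rewrite ?mul1r ?mul0r.
  - by rewrite whiten_trig// (_ : (l == i) = false) ?mulr0//; apply/negbTE; rewrite -val_eqE/= ltn_eqF.
  - by rewrite (_ : (l == i) = false) ?mulr0//; apply/negbTE; rewrite -val_eqE/= gtn_eqF.
  - by rewrite whiten_diag// eqxx mulr1.
rewrite /C_inf first_colsE// lb.
have -> : A *m first_emb P i.+1 *m invmx (block11 i.+1 Q) *m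
    ((first_emb P i.+1)^T *m delta_mx i (0 : 'I_1)) = A *m (block_inv Q i.+1 *m delta_mx i (0 : 'I_1)).
  by rewrite /block_inv resize_emb// !mulmxA.
rewrite block_invE// /limit_root -!mulmxA (mulmxA (pid_mx _)) De -!scalemxAr; congr (_ *: _).
congr (_ *m (_ *m _)); apply/colP => l; rewrite pid_mulmxE !mxE.
by case: eqP => [->|]; rewrite ?ltnSn ?mul1r ?mulr0.
Qed.

(** The difference [N] of the two sides satisfies [M *m N = 0] and has the form [M^T] times a
    matrix, so [N^T *m N = 0]. Hence any generalized inverse yields the normal equations of the
    regression. *)
Lemma ginv_normal m n (M : 'M[R]_(m, n)) G :
  is_ginv (M *m M^T) G -> M^T *m G *m (M *m M^T) = M^T.
Proof.
move=> SGS; apply/eqP; rewrite -subr_eq0; set N := _ - _.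
have MN : M *m N = 0 by rewrite /N mulmxBr !mulmxA -[M *m M^T *m G *m M *m _]mulmxA SGS subrr.
have NN : N^T *m N = 0.
  have -> : N^T *m N = (G *m (M *m M^T) - 1%:M)^T *m (M *m N).
    rewrite mulmxA; congr (_ *m N).
    by rewrite -[X in _ = _ *m X]trmxK -trmx_mul mulmxBr mulmx1 /N !mulmxA.
  by rewrite MN mulmx0.
apply/eqP/matrixP => a b; rewrite [RHS]mxE; apply/eqP.
have : (N^T *m N) b b = 0 by rewrite NN mxE.
rewrite mxE => /eqP; rewrite psumr_eq0 => [/allP/(_ a (mem_index_enum _))|j _].
  by rewrite mxE mulf_eq0 orbb.
by rewrite mxE -expr2 sqr_ge0.
Qed.

Section fixed.
Variables (i : 'I_P) (sigma : R).
Hypothesis sigma0 : 0 < sigma.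
Let W := sigma *: limit_root i.+1.
Let b := b_inf Q A ginv i.+1.
(** The residual when the rescaled statistic of index [i] is regressed on [W z]. *)
Let v : 'rV[R]_P := (sigma * xi_inf Q i.+1) *: delta_mx 0 i - b *m W.

Let bS : b *m cov_inf Q A i.+1 = (C_inf Q A i.+1)^T.
Proof.
rewrite /b /b_inf C_infE cov_infE// [(_ *: _)^T]linearZ/= -!scalemxAl; congr (_ *: _).
rewrite trmx_mul; set M := limit_root _; set G := ginv _.
have e : M^T *m G *m (M *m M^T) = M^T by exact: ginv_normal.
by rewrite -[in RHS]e !mulmxA.
Qed.

Let Wvl : (sigma * xi_inf Q i.+1) *: (W *m (delta_mx 0 i)^T) = sigma ^+ 2 *: C_inf Q A i.+1.
Proof.
by rewrite C_infE /W trmx_delta -scalemxAl !scalerA; congr (_ *: _); rewrite expr2 mulrAC.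
Qed.

Let WW : W *m W^T = sigma ^+ 2 *: cov_inf Q A i.+1.
Proof. by rewrite /W [X in _ *m X]linearZ/= -scalemxAl -scalemxAr scalerA -cov_infE. Qed.

Lemma limit_residual_uncorrelated : W *m v^T = 0.
Proof.
rewrite /v linearB/= linearZ/= mulmxBr -scalemxAr Wvl trmx_mul mulmxA WW -scalemxAl.
by rewrite -scalerBr -[cov_inf _ _ _]trmxK -trmx_mul (_ : (cov_inf _ _ _)^T = cov_inf Q A i.+1)
  ?bS ?trmxK ?subrr ?scaler0// cov_infE// trmx_mul trmxK.
Qed.

Lemma limit_residual_sqr : (v *m v^T) 0 0 = (sigma * zeta_inf Q A ginv i.+1) ^+ 2.
Proof.
have vv : (v *m v^T) 0 0 = sigma ^+ 2 * (xi_inf Q i.+1 ^+ 2 - (b *m C_inf Q A i.+1) 0 0).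
  have -> : v *m v^T = (sigma * xi_inf Q i.+1) *: (delta_mx (0 : 'I_1) i *m v^T) - b *m (W *m v^T).
    by rewrite {1}/v mulmxBl -scalemxAl mulmxA.
  rewrite limit_residual_uncorrelated mulmx0 subr0.
  have -> : (sigma * xi_inf Q i.+1) *: (delta_mx (0 : 'I_1) i *m v^T) =
      (v *m ((sigma * xi_inf Q i.+1) *: (delta_mx (0 : 'I_1) i)^T))^T.
    by rewrite trmx_mul linearZ/= trmxK -scalemxAl.
  have dd : delta_mx (0 : 'I_1) i *m (delta_mx (0 : 'I_1) i)^T = 1%:M :> 'M[R]_1.
    by rewrite trmx_delta mul_delta_mx; apply/matrixP => a a'; rewrite !ord1 !mxE.
  rewrite -scalemxAr /v mulmxBl scalerBr -mulmxA [in X in _ - X]scalemxAr Wvl -scalemxAl dd -scalemxAr.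
  by rewrite !mxE eqxx mulr1n; ring.
(* Up to the factor [sigma ^+ 2] this is a variance, so the square root in [zeta_inf] is a genuine
   one. *)
have d0 : 0 <= xi_inf Q i.+1 ^+ 2 - (b *m C_inf Q A i.+1) 0 0.
  by rewrite -(pmulr_rge0 _ (exprn_gt0 2 sigma0)) -vv row_sqr_ge0.
by rewrite vv exprMn; congr (_ * _); exact: esym (sqr_sqrtr d0).
Qed.
End fixed.
End limit_algebra.

Section measurable_sets.
Context {R : realType} d (S : measurableType d).
Local Notation T := (measurableTypeR R).

Lemma measurable_set_lt (f : S -> T) (b : R) :
  measurable_fun setT f -> measurable [set x | (f x : R) < b].
Proof.
move=> mf; rewrite (_ : [set x | _] = [set x : S | [set y : T | y \in `]-oo, b[] (f x)]).
  exact: (measurable_preimage mf).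
by apply/seteqP; split => x /=; rewrite in_itv.
Qed.

Lemma measurable_set_ge (f : S -> T) (b : R) :
  measurable_fun setT f -> measurable [set x | b <= (f x : R)].
Proof.
move=> mf; rewrite (_ : [set x | _] = [set x : S | [set y : T | y \in `[b, +oo[] (f x)]).
  exact: (measurable_preimage mf).
by apply/seteqP; split => x /=; rewrite in_itv/= andbT.
Qed.

Lemma measurable_set_le (f : S -> T) (b : R) :
  measurable_fun setT f -> measurable [set x | (f x : R) <= b].
Proof.
move=> mf; rewrite (_ : [set x | _] = [set x : S | [set y : T | y \in `]-oo, b]] (f x)]).
  exact: (measurable_preimage mf).
by apply/seteqP; split => x /=; rewrite in_itv.
Qed.

Lemma measurable_set_forall (I : finType) (C : I -> set S) :
  (forall i, measurable (C i)) -> measurable [set x | forall i, C i x].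
Proof.
move=> mC; rewrite (_ : [set x | _] = \bigcap_(i in [set: I]) C i).
  by apply: fin_bigcap_measurable => //; exact: finite_finset.
by apply/seteqP; split => x /= Cx i => [_|]; exact: Cx.
Qed.

Lemma measurable_set_imply (b : bool) (C : set S) :
  measurable C -> measurable [set x | b -> C x].
Proof.
case: b => mC.
  by rewrite (_ : [set x | _] = C)//; apply/seteqP; split => x //=; apply.
by rewrite (_ : [set x | _] = setT)//; apply/seteqP; split.
Qed.

Lemma measurable_set_or (b : bool) (C : set S) :
  measurable C -> measurable [set x | b \/ C x].
Proof.
case: b => mC.
  by rewrite (_ : [set x | _] = setT)//; apply/seteqP; split => x //=; left.
by rewrite (_ : [set x | _] = C)//; apply/seteqP; split => x /= => [[]|]//; right.
Qed.

End measurable_sets.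

Section selection_pattern.
Context {R : realType} {P : nat}.
Variables (b : nat) (c : nat -> R).
Hypothesis bP : (b <= P)%N.

(* The order selected from the statistics w when the test at order b rejects with
   certainty, as it does in the limit for b = max (p_0, O). *)
Definition pattern (w : 'cV[R]_P) : nat :=
  (\max_(b <= p < P.+1 | (p == b) || (c p <= `|component w p|)%R) p)%N.

Lemma patternP w p : pattern w = p <->
  [/\ (b <= p <= P)%N, (p == b) || (c p <= `|component w p|) &
      forall i : 'I_P, (p <= i)%N -> `|w i 0| < c i.+1].
Proof.
rewrite /pattern bigmax_natP ?eqxx//; split=> -[/andP[bp pP] Sp].
  move=> h; split=> // [|i pi]; first by rewrite bp.
  by have := h i.+1; rewrite ltnS pi ltn_ord component_ord negb_or -ltNge => /(_ isT)/andP[].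
move=> h; split=> // [|[|r] /andP[pr rP]]; [by rewrite bp|by []|].
rewrite negb_or -ltNge (component_ord _ (Ordinal rP)) h// andbT.
by rewrite gtn_eqF// (leq_ltn_trans bp).
Qed.

Lemma measurable_component n p : measurable_fun setT (fun w : 'cV[R]_n => component w p : measurableTypeR R).
Proof.
rewrite /component /entry; case: insubP => [i _ _|_]; last exact: measurable_cst.
by case: insubP => [j _ _|_]; [exact: measurable_entry|exact: measurable_cst].
Qed.

Lemma measurable_norm_component n p :
  measurable_fun setT (fun w : 'cV[R]_n => `|component w p| : measurableTypeR R).
Proof. exact: (measurableT_comp (@normr_measurable R setT) (measurable_component _)). Qed.

Lemma measurable_norm_entry n i :
  measurable_fun setT (fun w : 'cV[R]_n => `|w i 0| : measurableTypeR R).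
Proof. exact: (measurableT_comp (@normr_measurable R setT) (measurable_entry _ _)). Qed.

Lemma measurable_pattern p : measurable [set w | pattern w = p].
Proof.
rewrite (_ : [set w | _] = [set w | (b <= p <= P)%N /\ ((p == b) \/ c p <= `|component w p|) /\
    forall i : 'I_P, (p <= i)%N -> `|w i 0| < c i.+1]); last first.
  apply/seteqP; split => w /=; rewrite patternP.
    by move=> -[? /orP ?]; split.
  by move=> [? [/orP]]; split.
case: (boolP (b <= p <= P)%N) => bp; last first.
  by rewrite (_ : [set w | _] = set0)//; apply/seteqP; split => w //= -[].
rewrite (_ : [set w | _] = [set w : 'cV[R]_P | (p == b) \/ c p <= `|component w p|] `&`
   [set w : 'cV[R]_P | forall i : 'I_P, (p <= i)%N -> `|w i 0| < c i.+1]); last first.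
  by apply/seteqP; split => w /= [].
apply: measurableI.
  by apply: measurable_set_or; apply: measurable_set_ge; exact: measurable_norm_component.
apply: measurable_set_forall => i; apply: measurable_set_imply.
by apply: measurable_set_lt; exact: measurable_norm_entry.
Qed.

End selection_pattern.

Section tail.
Context {R : realType} {P : nat}.
Local Notation T := (measurableTypeR R).
Local Notation N := (normal_prob (0 : R) 1).

(** Coordinates are peeled off from the last one down: the condition on coordinate [p] joins the
    event on the first [p.+1] coordinates, and independence splits its factor off once the later
    ones are gone. *)
Lemma gaussian_tail p (E : set 'cV[R]_P) (C : 'I_P -> set T) :
  (p <= P)%N -> measurable E -> (forall i, measurable (C i)) ->
  (std_gaussian P [set z : 'cV[R]_P | E (pid_mx p *m z) /\
      forall i : 'I_P, (p <= i)%N -> C i (z i 0)]%R =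
   std_gaussian P [set z : 'cV[R]_P | E (pid_mx p *m z)]%R *
   \prod_(i < P | (p <= i)%N) N (C i))%E.
Proof.
move=> pP mE mC; move: {2}(P - p)%N (leqnn (P - p)) => m.
elim: m p pP E mE => [|m IHm] p pP E mE.
  rewrite leqn0 subn_eq0 => Pp; rewrite big_pred0 ?mule1.
    congr (std_gaussian P _); apply/seteqP; split => z /=; first by case.
    by move=> Ez; split => // i; rewrite leqNgt (leq_trans _ Pp).
  by move=> i; rewrite leqNgt (leq_trans _ Pp).
move=> Ppm; have [Pp|ltpP] := leqP P p.
  by apply: IHm => //; move: Pp; rewrite -subn_eq0 => /eqP ->.
pose i0 := Ordinal ltpP.
have EpE (z : 'cV[R]_P) : (pid_mx p : 'M[R]_P) *m (pid_mx p.+1 *m z) = pid_mx p *m z.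
  by rewrite mulmxA mul_pid_mx (minn_idPl (leqnSn p)) pid_mx_minv.
pose E' := [set z : 'cV[R]_P | E (pid_mx p *m z) /\ C i0 (z i0 0)].
have mpid (q : nat) : measurable [set z : 'cV[R]_P | E (pid_mx q *m z)].
  exact: (measurable_preimage (measurable_mulmx _) mE).
have mE' : measurable E'.
  apply: (measurableI [set z : 'cV[R]_P | E (pid_mx p *m z)]) => //.
  exact: (measurable_preimage (measurable_entry i0 0) (mC i0)).
have split_p : [set z : 'cV[R]_P | E (pid_mx p *m z) /\
      forall i : 'I_P, (p <= i)%N -> C i (z i 0)] =
    [set z : 'cV[R]_P | E' (pid_mx p.+1 *m z) /\
      forall i : 'I_P, (p.+1 <= i)%N -> C i (z i 0)].
  apply/seteqP; split => z /=; rewrite /E'/= EpE pid_mulmxE ltnSn mul1r.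
    move=> [Ez Cz]; split=> [|i pi]; last exact: Cz (ltnW pi).
    by split => //; exact: Cz.
  move=> [[Ez C0] Cz]; split => // i; rewrite leq_eqVlt => /predU1P[pi|]; last exact: Cz.
  by rewrite (_ : i = i0)//; exact: val_inj.
rewrite split_p IHm//; last by lia.
rewrite (_ : [set z | _] = [set z : 'cV[R]_P | E (pid_mx p *m z) /\ C i0 (((delta_mx 0 i0 : 'rV[R]_P) *m z) 0 0)]); last first.
  apply/seteqP; split => z /=; rewrite /E'/= EpE pid_mulmxE ltnSn mul1r;
  by rewrite -rowE mxE.
rewrite (gaussian_independent (t := 1))//; last 2 first.
- apply/matrixP => i j; rewrite trmx_delta -colE !mxE.
  case: (ltnP i p) => ip; last by rewrite andbF.
  by rewrite (_ : (_ == _) = false)//; exact: ltn_eqF.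
- by rewrite trmx_delta mul_delta_mx mxE expr1n.
rewrite -muleA; congr (_ * _)%E.
rewrite [RHS](bigD1 i0)//=; congr (_ * _)%E.
  by under eq_set do rewrite mul1r.
apply: eq_bigl => i; rewrite -val_eqE/=; lia.
Qed.

End tail.

Section finite_selection.
Context {R : realType} d (S : measurableType d).

Lemma sum_select (V : lmodType R) b n s (G : nat -> V) : (b <= s < n)%N ->
  \sum_(b <= p < n) (s == p)%:R *: G p = G s.
Proof.
move=> bsn; rewrite (bigD1_seq s)/= ?mem_index_iota ?iota_uniq// eqxx scale1r.
by rewrite big1 ?addr0// => p ps; rewrite eq_sym (negbTE ps) scale0r.
Qed.

Lemma measurable_sum_select k b n (sel : S -> nat) (G : nat -> S -> 'cV[R]_k) :
  (forall p, measurable [set x | sel x = p]) ->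
  (forall p, measurable_fun setT (G p)) ->
  measurable_fun setT (fun x => \sum_(b <= p < n) (sel x == p)%:R *: G p x).
Proof.
move=> msel mG; apply: measurable_matrixP => i j; under eq_fun do rewrite summxE.
apply: measurable_sum => p; under eq_fun do rewrite mxE.
apply: measurable_funM; last exact: (measurableT_comp (measurable_entry i j) (mG p)).
rewrite (_ : (fun x => _) = \1_[set x | sel x = p]); first exact: measurable_indic.
apply/funext => x; rewrite indicE; congr (_%:R); congr nat_of_bool.
by apply/eqP/idP; rewrite inE.
Qed.

Lemma probability_select (mu : probability S R) b n (sel : S -> nat) (E : set S) :
  (forall p, measurable [set x | sel x = p]) -> measurable E ->
  (forall x, (b <= sel x < n)%N) ->
  mu E = (\sum_(b <= p < n) mu [set x | sel x = p /\ E x])%E.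
Proof.
move=> msel mE bseln.
have mlt m : measurable [set x | (sel x < m)%N].
  elim: m => [|m IHm].
    by rewrite (_ : [set x | _] = set0)//; apply/seteqP; split.
  rewrite (_ : [set x | _] = [set x | (sel x < m)%N] `|` [set x | sel x = m]).
    exact: measurableU.
  apply/seteqP; split => x /=; rewrite ltnS; last by case=> [/ltnW|->].
  by rewrite leq_eqVlt => /predU1P[]; [right|left].
have mI p : measurable [set x | sel x = p /\ E x] by exact: (measurableI _ _ (msel p) mE).
have H m : (b <= m)%N -> mu [set x | (sel x < m)%N /\ E x] =
    (\sum_(b <= p < m) mu [set x | sel x = p /\ E x])%E.
  elim: m => [|m IHm].
    rewrite leqn0 => /eqP->; rewrite big_geq// (_ : [set x | _] = set0) ?measure0//.
    by apply/seteqP; split => x //= -[].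
  rewrite leq_eqVlt => /predU1P[bm|].
    rewrite -bm big_geq// (_ : [set x | _] = set0) ?measure0//.
    by apply/seteqP; split => x //= -[]; rewrite ltnNge; have /andP[-> _] := bseln x.
  rewrite ltnS => bm; rewrite big_nat_recr//= -IHm//.
  rewrite -measureU//; last 2 first.
  - exact: (measurableI _ _ (mlt m) mE).
  - by apply/seteqP; split => x //= -[[+ _] [xm _]]; rewrite xm ltnn.
  congr (mu _); apply/seteqP; split => x /=; rewrite ltnS; last first.
    by case=> -[]; [move=> /ltnW|move=> ->].
  by move=> []; rewrite leq_eqVlt => /predU1P[]; [right|left].
case: (boolP (b <= n)%N) => bn.
  rewrite -H//; congr (mu _); apply/seteqP; split => x /= => [Ex|[]//].
  by split => //; have /andP[] := bseln x.
rewrite big_geq; last by rewrite leqNgt; apply: contra bn => /ltnW.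
rewrite (_ : E = set0) ?measure0//; apply/seteqP; split => x // _.
by have /andP[bs /ltnW/(leq_trans bs)] := bseln x; rewrite (negbTE bn).
Qed.

End finite_selection.

Section gaussian_marginal.
Context {R : realType}.
Local Notation T := (measurableTypeR R).
Local Notation N := (normal_prob (0 : R) 1).

Lemma std_gaussian_entry n (i : 'I_n) (C : set T) : measurable C ->
  (std_gaussian n [set z : 'cV[R]_n | C (z i 0)]%R = N C)%E.
Proof.
move=> mC; have v1 : ((delta_mx 0 i : 'rV[R]_n) *m (delta_mx 0 i : 'rV[R]_n)^T) 0 0 = 1 ^+ 2.
  by rewrite trmx_delta mul_delta_mx mxE expr1n.
(* With a matrix without rows the independence formula reduces to a marginal law. *)
have W0 : (0 : 'M[R]_(0, n)) *m (delta_mx 0 i : 'rV[R]_n)^T = 0 :> 'cV[R]_0 by rewrite mul0mx.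
have := gaussian_independent (B := setT) W0 v1 measurableT mC.
rewrite (_ : [set z : 'cV[R]_n | setT _] = setT); last by apply/seteqP.
rewrite [X in X = _ -> _](_ : _ = std_gaussian n [set z : 'cV[R]_n | C (z i 0)]); last first.
  congr (std_gaussian n _); apply/seteqP; split => z /=; rewrite -rowE mxE; first by case.
  by split.
rewrite probability_setT mul1e => ->.
by under eq_set do rewrite mul1r.
Qed.

End gaussian_marginal.

Section distribution.
Context {R : realType} d d' (S : measurableType d) (S' : measurableType d').

Lemma image_law (mu : probability S R) (f : S -> S') : measurable_fun setT f ->
  exists nu : probability S' R, forall B, nu B = mu [set x | B (f x)].
Proof.
move=> mf; pose g : {mfun S >-> S'} := HB.pack f (isMeasurableFun.Build _ _ _ _ f mf).
by exists (distribution mu g).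
Qed.

End distribution.

(** * Law of the limit experiment *)

Section limit_law.
Context {R : realType} {P k : nat}.
Variables (Q : 'M[R]_P) (A : 'M[R]_(k, P)) (ginv : 'M[R]_k -> 'M[R]_k).
Variables (gam : 'cV[R]_P) (sigma : R) (c : nat -> R).
Hypothesis pdQ : posdef Q.
Hypothesis hginv : forall M, is_ginv M (ginv M).
Hypothesis sigma0 : 0 < sigma.
Local Notation T := (measurableTypeR R).
Local Notation N := (normal_prob (0 : R) 1).
Local Notation gauss := (@std_gaussian R P).

Definition local_shift : 'cV[R]_P := sigma^-1 *: (whiten Q *m Q *m gam).

(* Limit of sqrt n A (theta~(p) - theta), as a function of the limit z of the
   centered t-statistics. *)
Definition limit_map p (z : 'cV[R]_P) : 'cV[R]_k :=
  (sigma *: limit_root Q A p) *m (z + local_shift) - A *m gam.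

Lemma limit_mapE p z : (p <= P)%N ->
  limit_map p z = (sigma *: limit_root Q A p) *m z + A *m delta Q gam p.
Proof.
move=> pP; rewrite /limit_map mulmxDr -addrA; congr (_ + _).
rewrite deltaE// mulmxBr; congr (_ - _); rewrite /local_shift -scalemxAr -scalemxAl scalerA.
by rewrite mulVf ?gt_eqF// scale1r block_invE// /limit_root !mulmxA.
Qed.

Lemma measurable_limit_map p : measurable_fun setT (limit_map p).
Proof.
have -> : limit_map p = fun z => (sigma *: limit_root Q A p) *m z +
    ((sigma *: limit_root Q A p) *m local_shift - A *m gam).
  by apply/funext => z; rewrite /limit_map mulmxDr addrA.
exact: measurable_affine_mx.
Qed.

Definition accept_set (i : 'I_P) : set T :=
  [set x : T | `|(x : R) + local_shift i 0| < c i.+1].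

Lemma measurable_accept_set i : measurable (accept_set i).
Proof.
apply: (@measurable_set_lt R _ _ (fun x : T => `|(x : R) + local_shift i 0| : T)).
apply: (measurableT_comp (@normr_measurable R setT)).
exact: measurable_funD.
Qed.

Lemma accept_setE (i : 'I_P) : accept Q gam sigma c i.+1 = fine (N (accept_set i)).
Proof.
rewrite /accept DeltaE delta_component//; congr (fine (N _)); apply/seteqP.
have sx : 0 < sigma * xi_inf Q i.+1 by rewrite mulr_gt0// xi_inf_gt0.
have E (x : R) : sigma * xi_inf Q i.+1 * x + xi_inf Q i.+1 * (whiten Q *m Q *m gam) i 0 =
    sigma * xi_inf Q i.+1 * (x + local_shift i 0).
  rewrite /local_shift [X in _ = _ * (_ + X)]mxE mulrDr; congr (_ + _).
  by rewrite mulrACA divff ?gt_eqF// mul1r.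
by split => x; rewrite /accept_set/= E normrM gtr0_norm// -mulrA [c _ * _]mulrC ltr_pM2l.
Qed.

Lemma accept_prod p : (p <= P)%N ->
  (\prod_(i : 'I_P | (p <= i)%N) N (accept_set i) =
   (\prod_(p.+1 <= q < P.+1) accept Q gam sigma c q)%:E)%E.
Proof.
move=> pP; rewrite big_add1/= (big_nat_widenl p 0)// big_mkord.
rewrite -prodEFin; apply: eq_bigr => i _; rewrite accept_setE fineK//.
by rewrite fin_num_measure//; exact: measurable_accept_set.
Qed.

Lemma limit_map_pid p z : limit_map p (pid_mx p *m z) = limit_map p z.
Proof.
by rewrite /limit_map !mulmxDr -!scalemxAl mulmxA limit_root_pid.
Qed.

Lemma measurable_next_event (i : 'I_P) (B : set 'cV[R]_k) : measurable B ->
  measurable [set z : 'cV[R]_P | B (limit_map i.+1 z) /\ c i.+1 <= `|z i 0 + local_shift i 0| ].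
Proof.
move=> mB; apply: (measurableI [set z | B (limit_map i.+1 z)]).
  exact: (measurable_preimage (measurable_limit_map _) mB).
apply: (@measurable_set_ge R _ _ (fun z : 'cV[R]_P => `|z i 0 + local_shift i 0| : T)).
apply: (measurableT_comp (@normr_measurable R setT)).
by apply: measurable_funD => //; exact: measurable_entry.
Qed.

Section pattern_law.
Variable b : nat.
Hypothesis bP : (b <= P)%N.

(** Order [b] is selected exactly when all later tests accept, while [limit_map b] involves the
    first [b] coordinates only. *)
Lemma pattern_law_first (B : set 'cV[R]_k) : measurable B ->
  (gauss [set z | pattern b c (z + local_shift) = b /\ B (limit_map b z)] =
   gauss [set z | B (limit_map b z)] *
   (\prod_(b.+1 <= q < P.+1) accept Q gam sigma c q)%:E)%E.
Proof.
move=> mB; pose E := [set z | B (limit_map b z)].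
have mE : measurable E by exact: (measurable_preimage (measurable_limit_map b) mB).
have := gaussian_tail bP mE measurable_accept_set.
rewrite accept_prod// [X in _ = (gauss X * _)%E -> _](_ : _ = E); last first.
  by apply/seteqP; split => z; rewrite /E/= limit_map_pid.
move=> <-; congr (gauss _); apply/seteqP; split => z /=; rewrite patternP// leqnn eqxx/=.
  move=> [[_ _ h] Bz]; rewrite /E/= limit_map_pid; split => // i bi.
  by have := h i bi; rewrite mxE.
by rewrite /E/= limit_map_pid => -[Bz h]; split => //; split => // i bi; rewrite mxE; exact: h.
Qed.

Lemma pattern_law_next (i : 'I_P) (B : set 'cV[R]_k) : (b <= i)%N -> measurable B ->
  (gauss [set z | pattern b c (z + local_shift) = i.+1 /\ B (limit_map i.+1 z)] =
   gauss [set z : 'cV[R]_P | B (limit_map i.+1 z) /\ c i.+1 <= `|z i 0 + local_shift i 0| ]%R *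
   (\prod_(i.+2 <= q < P.+1) accept Q gam sigma c q)%:E)%E.
Proof.
move=> bi mB.
pose E := [set z : 'cV[R]_P | B (limit_map i.+1 z) /\ c i.+1 <= `|z i 0 + local_shift i 0| ].
have mE : measurable E by exact: measurable_next_event.
have := gaussian_tail (ltn_ord i) mE measurable_accept_set.
rewrite accept_prod// [X in _ = (gauss X * _)%E -> _](_ : _ = E); last first.
  by apply/seteqP; split => z; rewrite /E/= limit_map_pid pid_mulmxE ltnSn mul1r.
move=> <-; congr (gauss _); apply/seteqP; split => z /=; rewrite patternP//.
  rewrite /E/= limit_map_pid pid_mulmxE ltnSn mul1r component_ord mxE.
  move=> [[_ Sz h] Bz]; split => [|j ij]; last by have := h j ij; rewrite mxE.
  by split => //; move: Sz; rewrite gtn_eqF.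
rewrite /E/= limit_map_pid pid_mulmxE ltnSn mul1r component_ord => -[[Bz Sz] h].
split => //; split; [by rewrite leqW/=|by rewrite mxE Sz orbT|].
by move=> j ij; rewrite mxE; exact: h.
Qed.

End pattern_law.

Lemma Phi_inf_law p (f : 'cV[R]_k -> \bar R) : (p <= P)%N -> measurable_fun setT f ->
  (forall x, 0 <= f x)%E ->
  (\int[Phi_inf Q A sigma p]_z f z = \int[gauss]_z f ((sigma *: limit_root Q A p) *m z))%E.
Proof.
(* [Phi_inf] is a point mass at order 0, where the root is the zero matrix. *)
move=> pP mf f0; case: p pP => [|p] pP.
  rewrite [LHS]integral_dirac// diracT mul1e.
  have E z : f ((sigma *: limit_root Q A 0) *m z) = f 0.
    by rewrite /limit_root pid_mx_0 !mulmx0 scaler0 mul0mx.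
  under eq_integral do rewrite E.
  by rewrite integral_cst// [X in (_ * X)%E](@probability_setT _ _ R gauss) mule1.
have covE : sigma ^+ 2 *: cov_inf Q A p.+1 =
    (sigma *: limit_root Q A p.+1) *m (sigma *: limit_root Q A p.+1)^T.
  by rewrite cov_infE// [in RHS]linearZ/= -scalemxAl -scalemxAr scalerA.
have mfl n (L : 'M[R]_(k, n)) : measurable_fun setT (fun z : 'cV[R]_n => f (L *m z)).
  exact: (measurableT_comp mf (measurable_mulmx L)).
transitivity (\int[std_gaussian k]_z f (affine 0 (cov_root (sigma ^+ 2 *: cov_inf Q A p.+1)) z))%E.
  exact: ge0_integral_distribution.
transitivity (\int[std_gaussian k]_z f (cov_root (sigma ^+ 2 *: cov_inf Q A p.+1) *m z))%E.
  by apply: eq_integral => z _; rewrite /affine add0r.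
by apply: ge0_integral_gaussian_cov => //; rewrite covE cov_rootP.
Qed.

Lemma Phi_inf_lawE p (B : set 'cV[R]_k) : (p <= P)%N -> measurable B ->
  Phi_inf Q A sigma p B = gauss [set z | B ((sigma *: limit_root Q A p) *m z)].
Proof.
move=> pP mB; rewrite -integral_indic_preimage// Phi_inf_law//; last first.
  by apply/measurable_EFinP; exact: measurable_indic.
rewrite -integral_indic_preimage//.
exact: (measurable_preimage (measurable_mulmx _) mB).
Qed.

End limit_law.

Section limit_law.
Context {R : realType} {P k : nat}.
Variables (Q : 'M[R]_P) (A : 'M[R]_(k, P)) (ginv : 'M[R]_k -> 'M[R]_k).
Variables (gam : 'cV[R]_P) (sigma : R) (c : nat -> R).
Hypothesis pdQ : posdef Q.
Hypothesis hginv : forall M, is_ginv M (ginv M).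
Hypothesis sigma0 : 0 < sigma.
Local Notation T := (measurableTypeR R).
Local Notation N := (normal_prob (0 : R) 1).
Local Notation gauss := (@std_gaussian R P).
Local Notation local_shift := (local_shift Q gam sigma).
Local Notation limit_map := (limit_map Q A gam sigma).

(** The residual [v z] is independent of [W z]. Integrating it first yields [1 - Delta] at scale
    [t], which may be 0, and what remains is an integral over the law of [W z], that is
    [Phi_inf]. *)
Lemma pattern_integral (i : 'I_P) (B : set 'cV[R]_k) : measurable B ->
  fine (gauss [set z : 'cV[R]_P | B (limit_map i.+1 z) /\ c i.+1 <= `|z i 0 + local_shift i 0| ]) =
  \int[Phi_inf Q A sigma i.+1]_(w in [set w | B (w + A *m delta Q gam i.+1)])
    (1 - Delta (sigma * zeta_inf Q A ginv i.+1)
           (component (delta Q gam i.+1) i.+1 + component gam i.+1 +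
             (b_inf Q A ginv i.+1 *m w) 0 0)
           (c i.+1 * sigma * xi_inf Q i.+1)).
Proof.
move=> mB; set a := component _ _ + component _ _.
set bb := b_inf _ _ _ _; set t := sigma * zeta_inf _ _ _ _.
set q := c _ * _ * _; set Ad := A *m delta _ _ _; set B' := [set w | B (w + _)].
set W := sigma *: limit_root Q A i.+1.
pose v : 'rV[R]_P := (sigma * xi_inf Q i.+1) *: delta_mx 0 i - bb *m W.
have Wv : W *m v^T = 0 := limit_residual_uncorrelated A pdQ hginv i sigma.
have vv : (v *m v^T) 0 0 = t ^+ 2 := limit_residual_sqr A pdQ hginv i sigma0.
have mB' : measurable B'.
  have mad : measurable_fun setT (fun w : 'cV[R]_k => w + Ad).
    by under eq_fun do rewrite addrC; exact: measurable_addmx.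
  exact: (measurable_preimage mad mB).
have mn d (S : measurableType d) (f : S -> T) : measurable_fun setT f ->
    measurable_fun setT (fun x => `|f x| : T).
  by move=> mf; exact: (measurableT_comp (@normr_measurable R setT)).
have mb : measurable_fun setT (fun w : 'cV[R]_k => (bb *m w) 0 0 : T).
  exact: (measurableT_comp (measurable_entry 0 0) (measurable_mulmx bb)).
pose E := [set x : T * 'cV[R]_k | B' x.2 /\ q <= `|(x.1 : R) + (a + (bb *m x.2) 0 0)| ].
have mE : measurable E.
  apply: (measurableI [set x : T * 'cV[R]_k | B' x.2]).
    exact: (measurable_preimage measurable_snd mB').
  apply: (@measurable_set_ge R _ _ (fun x : T * 'cV[R]_k => `|(x.1 : R) + (a + (bb *m x.2) 0 0)| : T)).
  apply: mn; apply: measurable_funD; first exact: measurable_fst.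
  by apply: measurable_funD => //; exact: (measurableT_comp mb measurable_snd).
have sx : 0 < sigma * xi_inf Q i.+1 by rewrite mulr_gt0// xi_inf_gt0.
pose g (w : 'cV[R]_k) := N [set x : T | E (t * (x : R), w)].
have gE w : g w = (\1_B' w * (1 - Delta t (a + (bb *m w) 0 0) q))%:E.
  rewrite /g indicE; have [/set_mem Bw|/negP Bw] := boolP (w \in B'); last first.
    rewrite mul0r (_ : [set x | _] = set0) ?measure0//.
    by apply/seteqP; split => x //= -[] /= /mem_set.
  pose C := [set x : T | `|t * (x : R) + (a + (bb *m w) 0 0)| < q].
  have mC : measurable C.
    apply: (@measurable_set_lt R _ _ (fun x : T => `|t * (x : R) + (a + (bb *m w) 0 0)| : T)).
    by apply: mn; apply: measurable_funD => //; exact: measurable_funM.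
  rewrite mul1r DeltaE -/C EFinB fineK ?fin_num_measure// -probability_setC//.
  congr (N _); apply/seteqP; split => x; rewrite /E/C/=; first by case=> _; rewrite leNgt => /negP.
  by move=> /negP; rewrite -leNgt.
have mg : measurable_fun setT g.
  have mE' : measurable [set y : 'cV[R]_k * T | E (t * (y.2 : R) : T, y.1)].
    apply: (@measurable_preimage _ _ _ _ (fun y : 'cV[R]_k * T => (t * (y.2 : R) : T, y.1)) E) => //.
    apply: measurable_fun_pair; last exact: measurable_fst.
    by apply: measurable_funM => //; exact: measurable_snd.
  have := measurable_fun_xsection N mE'.
  congr (measurable_fun setT _); apply/funext => w /=; congr (N _).
  by apply/seteqP; split => x; rewrite /xsection/= inE.
have g0 w : (0 <= g w)%E by exact: measure_ge0.
rewrite /Rintegral; congr fine.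
transitivity (gauss [set z : 'cV[R]_P | E ((v *m z) 0 0 : T, W *m z)]).
  congr (gauss _); apply/seteqP.
  (* Residual, regression and mean add up to the shifted statistic, scaled by [sigma * xi_inf],
     which is also the scale of the critical value [q]. *)
  have zE (z : 'cV[R]_P) : (v *m z) 0 0 + (a + (bb *m (W *m z)) 0 0) =
      sigma * xi_inf Q i.+1 * (z i 0 + local_shift i 0).
    rewrite /v mulmxBl -scalemxAl -rowE mulmxA /a delta_component//.
    have -> : local_shift i 0 = sigma^-1 * (whiten Q *m Q *m gam) i 0 by rewrite mxE.
    move: ((whiten Q *m Q *m gam) i 0) (bb *m W *m z) => h y; rewrite !mxE.
    by rewrite mulrDr [in RHS]mulrACA divff ?gt_eqF// mul1r; ring.
  split => z; rewrite /E/= zE limit_mapE// normrM gtr0_norm// /q -mulrA [c _ * _]mulrC ler_pM2l//.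
rewrite (gaussian_uncorrelated Wv vv mE).
transitivity (\int[Phi_inf Q A sigma i.+1]_w g w)%E; first by rewrite Phi_inf_law.
rewrite [RHS]integral_mkcond; apply: eq_integral => w _.
by rewrite gE patchE indicE; case: ifP => _; rewrite ?mul1r ?mul0r.
Qed.

Section limit_measure.
Variable b : nat.
Hypothesis bP : (b <= P)%N.
Local Notation sel := (fun z => pattern b c (z + local_shift)).

Lemma measurable_shift : measurable_fun setT (fun z : 'cV[R]_P => z + local_shift).
Proof. by under eq_fun do rewrite addrC; exact: measurable_addmx. Qed.

Lemma measurable_shifted_pattern p : measurable [set z | sel z = p].
Proof.
apply: (@measurable_preimage _ _ _ _ (fun z : 'cV[R]_P => z + local_shift) [set w | pattern b c w = p]).
  exact: measurable_shift.
exact: measurable_pattern.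
Qed.

Lemma pattern_ge z : (b <= sel z < P.+1)%N.
Proof.
by have /(patternP _ bP)[] := erefl (pattern b c (z + local_shift)); rewrite ltnS.
Qed.

Lemma limit_lower_orthant p (t : 'cV[R]_k) :
  [set w | lower_orthant t (w + A *m delta Q gam p)] =
  lower_orthant (t - A *m delta Q gam p).
Proof.
by apply/seteqP; split => w /= h i; have := h i; rewrite !mxE ?lerBrDr// -lerBrDr.
Qed.

Lemma measurable_lower_orthant (t : 'cV[R]_k) : measurable (lower_orthant t).
Proof.
apply: (measurable_set_forall (C := fun (i : 'I_k) (z : 'cV[R]_k) => z i 0 <= t i 0)) => i.
by apply: measurable_set_le; exact: measurable_entry.
Qed.

(** That [limit_cdf] is a cdf is obtained by exhibiting its measure: the law of the limit map chosen
    by the pattern. Its values split over the selected order, and on lower orthants the terms are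
    those of the formula. *)
Lemma limit_measure : exists nu : probability 'cV[R]_k R,
  mcdf nu = limit_cdf Q A ginv gam sigma c b /\
  forall B, measurable B -> nu B =
    (\sum_(b <= p < P.+1) gauss [set z | sel z = p /\ B (limit_map p z)])%E.
Proof.
pose F z := \sum_(b <= p < P.+1) (sel z == p)%:R *: limit_map p z.
have FE z : F z = limit_map (sel z) z by rewrite /F sum_select// pattern_ge.
have mF : measurable_fun setT F.
  apply: measurable_sum_select; first exact: measurable_shifted_pattern.
  by move=> p; exact: measurable_limit_map.
have [nu nuE] := image_law gauss mF.
have nuS B : measurable B -> nu B =
    (\sum_(b <= p < P.+1) gauss [set z | sel z = p /\ B (limit_map p z)])%E.
  move=> mB; rewrite nuE (probability_select gauss measurable_shifted_pattern _ pattern_ge).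
    apply: eq_bigr => p _; congr (gauss _).
    by apply/seteqP; split => z /= [<-]; rewrite FE.
  exact: (measurable_preimage mF mB).
exists nu; split => //; apply/funext => t.
have mt := measurable_lower_orthant t.
have mS p : measurable [set z | sel z = p /\ lower_orthant t (limit_map p z)].
  apply: (measurableI _ _ (measurable_shifted_pattern p)).
  exact: (measurable_preimage (measurable_limit_map _ _ _ _ p) mt).
rewrite /mcdf nuS//.
rewrite (eq_bigr (fun p => (fine (gauss [set z | sel z = p /\
    lower_orthant t (limit_map p z)]))%:E)); last first.
  by move=> p _; rewrite fineK// fin_num_measure//; exact: mS.
rewrite sumEFin/= big_ltn// /limit_cdf; congr (_ + _).
  rewrite (pattern_law_first _ _ _ pdQ sigma0 bP mt) fineM//; last first.
    rewrite fin_num_measure//.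
    exact: (measurable_preimage (measurable_limit_map _ _ _ _ b) mt).
  congr (_ * _); rewrite /mcdf Phi_inf_lawE//; last exact: measurable_lower_orthant.
  congr (fine (gauss _)); rewrite -limit_lower_orthant.
  by apply/seteqP; split => z /=; rewrite limit_mapE.
apply: eq_big_nat => -[//|p] /andP[bp pP].
pose i : 'I_P := Ordinal (pP : (p < P)%N).
rewrite (pattern_law_next _ _ _ pdQ sigma0 bP (i := i) bp mt) fineM//; last first.
  by rewrite fin_num_measure//; exact: (measurable_next_event _ _ _ _ _ i mt).
by congr (_ * _); rewrite (pattern_integral i mt) limit_lower_orthant.
Qed.

Lemma limit_selectionE p : (b <= p <= P)%N ->
  fine (gauss [set z | sel z = p]) = limit_selection_prob Q gam sigma c b p.
Proof.
move=> /andP[bp pP]; rewrite /limit_selection_prob ltnNge bp/=.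
(* Selection probabilities are the laws of the patterns with no constraint on the estimator. *)
pose B := [set: 'cV[R]_k].
rewrite [X in gauss X](_ : _ = [set z | sel z = p /\ B (limit_map p z)]); last first.
  by apply/seteqP; split => z //= -[].
have mB : measurable B by exact: measurableT.
move: bp; rewrite leq_eqVlt eq_sym; case: eqVneq => [->_ |_ /=].
  rewrite (pattern_law_first _ _ _ pdQ sigma0 bP mB) [X in gauss X](_ : _ = setT).
    by rewrite [X in (X * _)%E](@probability_setT _ _ R gauss) mul1e.
  by apply/seteqP.
case: p pP => // p pP bp; pose i : 'I_P := Ordinal pP.
rewrite (pattern_law_next _ _ _ pdQ sigma0 bP (i := i) bp mB).
rewrite [X in gauss X](_ : _ = [set z : 'cV[R]_P | (~` accept_set Q gam sigma c i) (z i 0)]); last first.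
  apply/seteqP; split => z; rewrite /accept_set/=.
    by move=> [_]; rewrite leNgt => /negP.
  by move=> /negP; rewrite -leNgt.
have mA := measurable_accept_set Q gam sigma c i.
rewrite std_gaussian_entry; last exact: measurableC.
rewrite fineM//; last by rewrite fin_num_measure//; exact: measurableC.
congr (_ * _); rewrite (accept_setE _ _ pdQ sigma0 i).
by rewrite [X in fine X]probability_setC// fineB// fin_num_measure.
Qed.

End limit_measure.
End limit_law.

(** * Selection in the sample *)

Section selection_events.
Context {R : realType} {P n : nat}.
Variables (X : 'M[R]_(n, P)) (o : nat) (c : nat -> R).
Hypotheses (oP : (o <= P)%N) (co : c o = 0).
Local Notation T := (measurableTypeR R).

Lemma selectP s y p : select X o c s y = p <->
  [/\ (o <= p <= P)%N, c p <= `|t_stat X s p y| &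
      forall i : 'I_P, (p <= i)%N -> `|t_stat X s i.+1 y| < c i.+1].
Proof.
rewrite /select bigmax_natP//; last by rewrite co.
split=> -[/andP[op pP] Sp] h; split; rewrite ?op//.
  by move=> i pi; rewrite ltNge; apply: h; rewrite ltnS pi ltn_ord.
case=> [|r] /andP[pr rP]; first by [].
by rewrite -ltNge; exact: (h (Ordinal rP)).
Qed.

Lemma select_ge s y : (o <= select X o c s y < P.+1)%N.
Proof. by have /selectP[] := erefl (select X o c s y); rewrite ltnS. Qed.

Lemma measurable_restricted_ls p : measurable_fun setT (restricted_ls X p).
Proof.
apply: measurable_matrixP => i j; rewrite /restricted_ls (ord1 j).
under eq_fun do rewrite mxE.
rewrite (_ : (fun x => _) = (fun v : 'cV[R]_p => component v i.+1) \o (fun y : 'cV[R]_n =>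
    invmx ((first_cols p X)^T *m first_cols p X) *m (first_cols p X)^T *m y)) //.
exact: (measurableT_comp (measurable_component _) (measurable_mulmx _)).
Qed.

Lemma measurable_sigma_hat : measurable_fun setT (sigma_hat X : 'cV[R]_n -> T).
Proof.
rewrite /sigma_hat.
have msq : measurable_fun setT (Num.sqrt : T -> T).
  by apply: continuous_measurable_fun; exact: sqrt_continuous.
apply: (measurableT_comp msq); apply: measurable_funM => //.
have mr : measurable_fun setT (fun y : 'cV[R]_n => y - X *m restricted_ls X P y).
  apply: measurable_matrixP => i j; under eq_fun do rewrite mxE [X in _ + X]mxE.
  apply: measurable_funB; first exact: measurable_entry.
  apply: (measurableT_comp (measurable_entry i j)).
  exact: (measurableT_comp (measurable_mulmx X) (measurable_restricted_ls P)).
exact: (measurableT_comp (@measurable_sqn R n) mr).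
Qed.

Lemma measurable_norm_t_stat (f : 'cV[R]_n -> T) p : measurable_fun setT f ->
  measurable_fun setT (fun y => `|t_stat X (f y) p y| : T).
Proof.
move=> mf; rewrite /t_stat; case: eqP => [_|_]; first exact: measurable_cst.
have mn d (S : measurableType d) (g : S -> T) : measurable_fun setT g ->
    measurable_fun setT (fun x => `|g x| : T).
  by move=> mg; exact: (measurableT_comp (@normr_measurable R setT)).
(* The inverse is written as a power of a nonnegative number, a measurable function even where the
   number is 0. *)
rewrite (_ : (fun y => _) = fun y => `|Num.sqrt n%:R * component (restricted_ls X p y) p| *
    (`|f y * xi_n X p| `^ -1)); last first.
  by apply/funext => y; rewrite normrM normfV powR_inv1.
apply: measurable_funM.
  apply: mn; apply: measurable_funM => //.
  exact: (measurableT_comp (measurable_component _) (measurable_restricted_ls p)).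
by apply: (measurableT_comp (measurable_powR (-1))); apply: mn; exact: measurable_funM.
Qed.

Lemma measurable_select (f : 'cV[R]_n -> T) p : measurable_fun setT f ->
  measurable [set y | select X o c (f y) y = p].
Proof.
move=> mf; rewrite (_ : [set y | _] = [set y | (o <= p <= P)%N /\
    (c p <= `|t_stat X (f y) p y| /\
     forall i : 'I_P, (p <= i)%N -> `|t_stat X (f y) i.+1 y| < c i.+1)]); last first.
  by apply/seteqP; split => y /=; rewrite selectP => -[? []]; repeat split.
case: (boolP (o <= p <= P)%N) => op; last first.
  by rewrite (_ : [set y | _] = set0)//; apply/seteqP; split => y //= -[].
rewrite (_ : [set y | _] = [set y | c p <= `|t_stat X (f y) p y| ] `&`
   [set y | forall i : 'I_P, (p <= i)%N -> `|t_stat X (f y) i.+1 y| < c i.+1]); last first.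
  by apply/seteqP; split => y /= [].
apply: measurableI; first by apply: measurable_set_ge; exact: measurable_norm_t_stat.
apply: (measurable_set_forall (C := fun (i : 'I_P) y => (p <= i)%N ->
  `|t_stat X (f y) i.+1 y| < c i.+1)) => i.
apply: measurable_set_imply.
by apply: measurable_set_lt; exact: measurable_norm_t_stat.
Qed.

End selection_events.

Section order.
Context {R : realType} {P : nat}.
Variable th : 'cV[R]_P.
Local Notation p0 := (theta_order th).

Lemma theta_orderP : [/\ (p0 <= P)%N, (forall i : 'I_P, (p0 <= i)%N -> th i 0 = 0) &
  forall i : 'I_P, i.+1 = p0 -> th i 0 != 0].
Proof.
rewrite /theta_order; case: arg_minnP => [|p /forallP h hmin].
  by apply/forallP => i; rewrite leqNgt ltn_ord.
split=> [|i pi|i ip]; first by rewrite -ltnS ltn_ord.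
  by apply/eqP; have := h i; rewrite pi.
apply/eqP => thi; have iP : (i < P.+1)%N by rewrite ltnS ltnW.
have /hmin : [forall j : 'I_P, (Ordinal iP <= j)%N ==> (th j ord0 == 0)].
  apply/forallP => j; apply/implyP => /= ij; have [jp|pj] := ltnP j p; last first.
    by have := h j; rewrite pj.
  by rewrite (_ : j = i) ?thi//; apply/val_inj/eqP; rewrite eqn_leq ij -ltnS ip jp.
by rewrite /= -ip ltnn.
Qed.

Variable Q : 'M[R]_P.
Hypothesis pdQ : posdef Q.

(** [whiten Q *m Q] is upper triangular, and [th] vanishes from index [p0] on. *)
Lemma whitenQ_order (i : 'I_P) : (p0 <= i)%N -> (whiten Q *m Q *m th) i 0 = 0.
Proof.
have [_ th0 _] := theta_orderP => pi; rewrite mxE big1// => j _.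
have [pj|jp] := leqP p0 j; first by rewrite th0// mulr0.
rewrite whitenQ_trig//; last exact: ltnW (leq_trans jp pi).
by rewrite -val_eqE/= gtn_eqF ?mul0r// (leq_trans jp).
Qed.

Lemma whitenQ_order_last (i : 'I_P) : i.+1 = p0 ->
  (whiten Q *m Q *m th) i 0 = th i 0 / xi_inf Q i.+1.
Proof.
have [_ th0 _] := theta_orderP => ip; rewrite mxE (bigD1 i)//= big1 ?addr0.
  by rewrite whitenQ_trig// eqxx mul1r mulrC.
move=> j ji; have [ij|ji'] := leqP p0 j; first by rewrite th0// mulr0.
rewrite whitenQ_trig//; last by rewrite -ltnS ip.
by rewrite eq_sym (negbTE ji) !mul0r.
Qed.

End order.

(** * Transport of the sample statistics to the limit experiment *)

Section transfer.
Context {R : realType} {P : nat}.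
Variables (Q Q' : 'M[R]_P) (sigma s : R).
Hypotheses (pdQ : posdef Q) (pdQ' : posdef Q') (sigma0 : 0 < sigma) (s0 : 0 < s).

(* Turns the statistics of the sample with Gram matrix Q' into statistics for Q that
   give the same estimator of order p; it leaves the components after p unchanged and
   rescales component p, hence almost preserves the event that p is selected. *)
Definition transfer p : 'M[R]_P :=
  (s / sigma) *: (pid_mx p *m (whiten Q *m Q *m (whiten Q')^T *m pid_mx p)) +
  (1%:M - pid_mx p).

(** The factors combine to [block_inv Q p *m Q], which is the identity on the first [p] coordinates;
    the range of [(whiten Q')^T *m pid_mx p] lies there by triangularity. *)
Lemma transfer_root k (A : 'M[R]_(k, P)) p : (p <= P)%N ->
  (sigma *: limit_root Q A p) *m transfer p = s *: limit_root Q' A p.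
Proof.
move=> pP; rewrite /transfer mulmxDr -!scalemxAl -scalemxAr !scalerA.
rewrite mulmxBr mulmx1 limit_root_pid subrr scaler0 addr0.
rewrite [_ * (s / sigma)]mulrC divfK ?gt_eqF//; congr (_ *: _).
rewrite [LHS]mulmxA limit_root_pid /limit_root -!mulmxA; congr (A *m _).
have pidDT : pid_mx p *m ((whiten Q')^T *m pid_mx p) = (whiten Q')^T *m (pid_mx p : 'M[R]_P).
  apply/matrixP => i j; rewrite pid_mulmxE !mulmx_pidE [(_^T) i j]mxE.
  have [_|pi] := ltnP i p; first by rewrite mul1r.
  have [jp|_] := ltnP j p; last by rewrite !mulr0.
  by rewrite whiten_trig ?mul0r ?mulr0// (leq_trans jp).
have := block_invK pdQ pP; rewrite block_invE// => BQ.
by rewrite -[in LHS]pidDT !mulmxA BQ -mulmxA pidDT.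
Qed.

Lemma transferE p w i : (transfer p *m w) i 0 =
  (s / sigma) * ((i < p)%:R * (whiten Q *m Q *m ((whiten Q')^T *m (pid_mx p *m w))) i 0) +
  (i >= p)%N%:R * w i (0 : 'I_1).
Proof.
rewrite /transfer mulmxDl -scalemxAl mulmxBl mul1mx mxE.
congr (_ + _); first by rewrite mxE -!mulmxA pid_mulmxE.
rewrite mxE [X in _ + X]mxE pid_mulmxE ltnNge.
by case: (p <= i)%N; rewrite ?mul1r ?mul0r ?subrr ?subr0.
Qed.

Lemma transfer_ge p w (i : 'I_P) : (p <= i)%N -> (transfer p *m w) i 0 = w i (0 : 'I_1).
Proof. by move=> pi; rewrite transferE ltnNge pi !mul0r mulr0 add0r mul1r. Qed.

Lemma transfer_last (i : 'I_P) w : (transfer i.+1 *m w) i 0 =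
  s * xi_inf Q' i.+1 / (sigma * xi_inf Q i.+1) * w i (0 : 'I_1).
Proof.
rewrite transferE ltnSn ltnn mul0r addr0 mul1r.
set v := _ *m (pid_mx _ *m w).
(* [v] vanishes after index [i], and row [i] of [whiten Q *m Q] vanishes before it, so the diagonal
   entry alone contributes. *)
have -> : (whiten Q *m Q *m v) i 0 = v i 0 / xi_inf Q i.+1.
  rewrite mxE (bigD1 i)//= big1 ?addr0 ?whitenQ_trig// ?eqxx ?mul1r 1?mulrC// => j ji.
  have [ij|ji'] := ltnP i j; last by rewrite whitenQ_trig// eq_sym (negbTE ji) !mul0r.
  rewrite (_ : v j 0 = 0) ?mulr0// /v mxE big1// => l _; rewrite pid_mulmxE mxE.
  have [li|_] := ltnP l i.+1; last by rewrite mul0r mulr0.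
  by rewrite whiten_trig ?mul0r// (leq_ltn_trans _ ij).
by rewrite whitenT_pid//; field; rewrite !gt_eqF// xi_inf_gt0.
Qed.

Lemma transfer_trig p (i j : 'I_P) : (j < i)%N -> transfer p i j = 0.
Proof.
move=> ji; rewrite mxE [X in X + _]mxE pid_mulmxE mulmx_pidE mxE big1; last first.
  move=> l _; have [li|il] := ltnP l i.
    by rewrite whitenQ_trig 1?ltnW// -val_eqE/= gtn_eqF// !mul0r.
  by rewrite [_^T l j]mxE whiten_trig ?mulr0// (leq_trans ji).
have ij : (i == j :> nat) = false by rewrite gtn_eqF.
by rewrite mul0r !mulr0 add0r !mxE -val_eqE/= ij subrr.
Qed.

(** The translation is chosen so that, once the shifts are included, the transport is linear: [z]
    plus the shift for [Q'] goes to its image under [transfer p]. *)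
Lemma limit_map_transfer k (A : 'M[R]_(k, P)) gam p z : (p <= P)%N ->
  limit_map Q A gam sigma p (transfer p *m z +
    (transfer p *m local_shift Q' gam s - local_shift Q gam sigma)) =
  limit_map Q' A gam s p z.
Proof.
move=> pP; rewrite /limit_map addrA subrK -mulmxDr mulmxA; congr (_ *m _ - _).
exact: transfer_root.
Qed.

End transfer.

Section sample.
Context {R : realType} {P n : nat}.
Variable X : 'M[R]_(n, P).
Hypotheses (nP : (P < n)%N) (rX : \rank X = P).
Variables (th gam : 'cV[R]_P) (s : R).
Hypothesis s0 : 0 < s.
Let Qn := n%:R^-1 *: (X^T *m X).
Let rn : R := Num.sqrt n%:R.
Let th_ := th + rn^-1 *: gam.
Let n0 : (0 < n)%N := leq_ltn_trans (leq0n P) nP.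
Let pdQn : posdef Qn := posdef_gram n0 rX.
Let rn0 : rn != 0.
Proof. by rewrite gt_eqF// sqrtr_gt0 ltr0n. Qed.

Definition drift : 'cV[R]_P := (rn / s) *: (whiten Qn *m Qn *m th).

Lemma tstar_local u : tstar X s (X *m th_ + u) = tstar X s u + local_shift Qn gam s + drift.
Proof.
rewrite (tstarD _ nP) ?gt_eqF// -addrA; congr (_ + _).
rewrite -/Qn -/rn /th_ mulmxDr -[X in _ *: (_ + X)]scalemxAr scalerDr scalerA addrC; congr (_ + _).
by rewrite mulrAC divff// mul1r.
Qed.

(** An exact identity: from the order of [th] on, restricted least squares reproduces [th], so the
    diverging drift cancels against the centering. *)
Lemma estimator_local k (A : 'M[R]_(k, P)) p u : (theta_order th <= p <= P)%N ->
  rn *: (A *m (restricted_ls X p (X *m th_ + u) - th_)) =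
  limit_map Qn A gam s p (tstar X s u).
Proof.
move=> /andP[p0p pP]; have [_ th0 _] := theta_orderP th.
have driftE : (s / rn) *: ((whiten Qn)^T *m (pid_mx p *m drift)) = th.
  rewrite /drift; set v := whiten Qn *m Qn *m th.
  rewrite -!scalemxAr scalerA [_ * (rn / s)]mulrA divfK// divff ?gt_eqF// scale1r.
  have thp : th = pid_mx p *m th.
    apply/colP => i; rewrite pid_mulmxE; have [_|pi] := ltnP i p; first by rewrite mul1r.
    by rewrite th0 ?mulr0// (leq_trans p0p).
  by rewrite /v [in LHS]thp !mulmxA -block_invE// block_invK// -thp.
have -> : restricted_ls X p (X *m th_ + u) - th_ =
    (s / rn) *: ((whiten Qn)^T *m (pid_mx p *m (tstar X s u + local_shift Qn gam s))) -
    rn^-1 *: gam.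
  rewrite (restricted_ls_tstar nP rX _ pP (lt0r_neq0 s0)) tstar_local -/Qn -/rn.
  by rewrite [in LHS]mulmxDr [in LHS]mulmxDr scalerDr driftE /th_ opprD addrA addrK.
rewrite mulmxBr scalerBr -!scalemxAr !scalerA divff// scale1r; congr (_ - _).
rewrite mulrA [rn * s]mulrC mulfK// -scalemxAl; congr (_ *: _).
by rewrite /limit_root !mulmxA.
Qed.
End sample.

(** The margin [2 d c] suffices since [(1 - d) (1 + 2 d) >= 1] for [0 <= d <= 1 / 2], and
    [(1 + d) (1 - 2 d) <= 1]. *)
Lemma scaled_lt (R : realType) (d r x c : R) : 0 <= d -> d <= 2^-1 -> 0 < c ->
  `|r - 1| <= d -> 2 * d * c < `| `|x| - c| -> (`|r * x| < c) = (`|x| < c).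
Proof.
move=> d0 d2 c0 /ler_normlP[r1 r2] xc.
have rpos : 0 < r by lra.
rewrite normrM (gtr0_norm rpos).
have x0 : 0 <= `|x| by [].
move: (`|x|) x0 xc => y y0 yc; apply/idP/idP.
  apply: contraTT; rewrite -!leNgt => cy.
  have ycE : 2 * d * c < y - c by rewrite ger0_norm in yc; lra.
  nra.
move=> ylt; have ycE : 2 * d * c < c - y by rewrite ltr0_norm in yc; lra.
nra.
Qed.

Section sample.
Context {R : realType} {P n : nat}.
Variable X : 'M[R]_(n, P).
Hypotheses (nP : (P < n)%N) (rX : \rank X = P).
Variables (Q : 'M[R]_P) (th gam : 'cV[R]_P) (sigma s : R) (o : nat) (c : nat -> R).
Hypotheses (pdQ : posdef Q) (sigma0 : 0 < sigma) (s0 : 0 < s).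
Hypotheses (oP : (o <= P)%N) (co : c o = 0) (c0 : forall p, (o < p <= P)%N -> 0 < c p).
Let Qn := n%:R^-1 *: (X^T *m X).
Let n0 : (0 < n)%N := leq_ltn_trans (leq0n P) nP.
Let pdQn : posdef Qn := posdef_gram n0 rX.
Let pst := maxn (theta_order th) o.

(** The deterministic core: it is applied with [s'] the true or the estimated scale, and its
    hypotheses hold outside the bad events. *)
Lemma select_of_pattern (d s' : R) p u :
  let y := X *m (th + (Num.sqrt n%:R)^-1 *: gam) + u in
  let w := tstar X s u + local_shift Qn gam s in
  0 <= d -> d <= 2^-1 -> `|s / s' - 1| <= d ->
  (forall i : 'I_P, `|s * xi_inf Qn i.+1 / (sigma * xi_inf Q i.+1) - 1| <= d) ->
  (forall i : 'I_P, (o <= i)%N -> 2 * d * c i.+1 < `| `|w i 0| - c i.+1| ) ->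
  (forall i : 'I_P, i.+1 = theta_order th -> (o <= i)%N ->
    2 * c i.+1 <= `|w i 0 + drift X th s i 0| ) ->
  pattern pst c (transfer Q Qn sigma s p *m w) = p -> select X o c s' y = p.
Proof.
move=> y w d0 d2 hs' hxi hw hdrift.
have pstP : (pst <= P)%N by rewrite geq_max oP; have [-> ] := theta_orderP th.
have tE (i : 'I_P) : t_stat X s' i.+1 y = s / s' * (w i 0 + drift X th s i 0).
  rewrite (t_statE nP rX i _ _ (lt0r_neq0 s0)) /y (tstar_local _ nP _ _ s0) -/Qn -/w.
  by rewrite [(w + _) i 0]mxE.
have drift0 (i : 'I_P) : (theta_order th <= i)%N -> drift X th s i 0 = 0.
  by move=> pi; rewrite /drift mxE whitenQ_order ?mulr0.
move=> /(patternP _ pstP)[/andP[]]; rewrite geq_max => /andP[p0p op] pP Sp tail.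
have cpos (i : 'I_P) : (o <= i)%N -> 0 < c i.+1 by move=> oi; rewrite c0// ltnS oi ltn_ord.
apply/(selectP _ oP co); split; rewrite ?op//; last first.
  move=> i pi; have := tail i pi; rewrite transfer_ge// tE drift0 ?(leq_trans p0p)// addr0.
  have oi := leq_trans op pi.
  by rewrite (scaled_lt d0 d2 (cpos i oi) hs' (hw i oi)).
move: op; rewrite leq_eqVlt => /predU1P[<-|op]; first by rewrite co.
case: p p0p pP Sp tail op => // p p0p pP Sp tail op.
pose i : 'I_P := Ordinal (pP : (p < P)%N).
have oi : (o <= i)%N by [].
rewrite (tE i).
(* At the order of [th] rejection comes from the drift; the bound [2 * c i.+1] offsets the factor
   [s / s'], which is at least one half. *)
have [pE|pE] := eqVneq (theta_order th) i.+1.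
  have h := hdrift i (esym pE) oi.
  rewrite normrM; move: hs' => /ler_normlP[r1 r2].
  have r0 : 2^-1 <= s / s' by lra.
  rewrite (ger0_norm (le_trans _ r0)) ?invr_ge0//.
  apply: le_trans (ler_pM _ _ r0 h) => //; last by rewrite mulr_ge0// ltW// cpos.
  by rewrite mulrA mulVf ?mul1r// pnatr_eq0.
(* Here [p.+1] exceeds [pst], so the pattern itself rejects at [p.+1]. Transfer and scale each
   multiply this statistic by a factor near 1, and the margin [hw] absorbs both. *)
have p0i : (theta_order th <= i)%N by rewrite -ltnS ltn_neqAle pE.
move: Sp; have -> : (p.+1 == pst) = false by rewrite gtn_eqF// gtn_max !ltnS p0i.
rewrite /= (component_ord _ i) (transfer_last s pdQ pdQn sigma0 i) leNgt.
rewrite drift0// addr0 (scaled_lt d0 d2 (cpos i oi) (hxi i) (hw i oi)).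
by rewrite -(scaled_lt d0 d2 (cpos i oi) hs' (hw i oi)) -leNgt.
Qed.

End sample.

(** * Negligible events *)

Section anticoncentration.
Context {R : realType}.
Local Notation T := (measurableTypeR R).
Local Notation N := (normal_prob (0 : R) 1).

Lemma normal_prob_itv (l r : R) : l <= r -> (N `[l, r] <= (r - l)%:E)%E.
Proof.
move=> lr; rewrite /normal_prob.
apply: (@le_trans _ _ (\int[lebesgue_measure]_(x in `[l, r]) (cst 1%:E x))%E).
  apply: ge0_le_integral => //=.
  - by move=> x _; rewrite lee_fin normal_pdf_ge0.
  - by apply/measurable_EFinP; apply: measurable_funTS; exact: measurable_normal_pdf.
  - move=> x _; rewrite lee_fin; apply: le_trans (normal_pdf_ub _ _ _) _ => //.
    have p1 : (1 : R) <= pi *+ 2 by have := pi_ge2 R; rewrite mulr2n; lra.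
    rewrite /normal_peak expr1n mul1r invf_le1 ?sqrtr_gt0 ?(lt_le_trans _ p1)//.
    by rewrite -[leLHS]sqrtr1 ler_wsqrtr.
rewrite integral_cst//= mul1e lebesgue_measure_itv/= lte_fin.
by case: ifPn => // _; rewrite lee_fin subr_ge0.
Qed.

(** The event lies in two intervals of length [2 h], and the standard normal density is at most
    1. *)
Lemma normal_prob_annulus (a c h : R) : 0 <= h ->
  (N [set x : T | `| `|(x : R) + a| - c| <= h]%R <= (4 * h)%:E)%E.
Proof.
move=> h0; pose I1 : set T := `[c - h - a, c + h - a]%classic; pose I2 : set T := `[- c - h - a, - c + h - a]%classic.
have mS : measurable [set x : T | `| `|(x : R) + a| - c| <= h].
  apply: (@measurable_set_le R _ _ (fun x : T => `| `|(x : R) + a| - c| : T)).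
  apply: (measurableT_comp (@normr_measurable R setT)); apply: measurable_funB => //.
  by apply: (measurableT_comp (@normr_measurable R setT)); exact: measurable_funD.
apply: (@le_trans _ _ (N (I1 `|` I2))).
  apply: le_measure; rewrite ?inE//.
    by apply: measurableU; exact: measurable_itv.
  move=> x; rewrite /I1 /I2/= !in_itv/= ler_norml => /andP[].
  by case: (ler0P (x + a)) => _ h1 h2; [right|left]; apply/andP; split; lra.
apply: le_trans (measureU2 _ _ _) _; [exact: measurable_itv|exact: measurable_itv|].
have -> : 4 * h = (c + h - a - (c - h - a)) + (- c + h - a - (- c - h - a)) by ring.
by rewrite EFinD; apply: leeD; apply: normal_prob_itv; lra.
Qed.

End anticoncentration.

Lemma measure_exists d (S : measurableType d) (R : realType)
    (mu : {measure set S -> \bar R}) (I : finType) (C : I -> set S) (e : I -> R) :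
  (forall i, measurable (C i)) -> (forall i, mu (C i) <= (e i)%:E)%E ->
  measurable [set x | exists i, C i x] /\
  (mu [set x | exists i, C i x] <= (\sum_i e i)%:E)%E.
Proof.
move=> mC muC.
have H (r : seq I) : measurable [set x | exists2 i, i \in r & C i x] /\
    (mu [set x | exists2 i, i \in r & C i x] <= (\sum_(i <- r) e i)%:E)%E.
  elim: r => [|i r [mr IHr]].
    rewrite big_nil (_ : [set x | _] = set0); first by rewrite measure0.
    by apply/seteqP; split => x //= -[].
  rewrite (_ : [set x | _] = C i `|` [set x | exists2 i, i \in r & C i x]); last first.
    apply/seteqP; split => x /=.
      by move=> [j]; rewrite inE => /predU1P[->|]; [left|right; exists j].
    by move=> [Cx|[j jr Cx]]; [exists i; rewrite // mem_head|exists j; rewrite // inE jr orbT].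
  split; first exact: measurableU.
  apply: (le_trans (measureU2 _ (mC i) mr)); rewrite big_cons EFinD.
  apply: leeD; first exact: muC.
  exact: IHr.
have := H (index_enum I); rewrite (_ : [set x | _] = [set x | exists i, C i x])//.
by apply/seteqP; split => x /= [i]; [exists i|exists i; rewrite ?mem_index_enum].
Qed.

Section noise.
Context {R : realType} {P n : nat}.
Variable X : 'M[R]_(n, P).
Hypotheses (nP : (P < n)%N) (rX : \rank X = P).
Variables (th : 'cV[R]_P) (s : R).
Hypothesis s0 : 0 < s.

Lemma noise_sqn (B : set R) : measurable (B : set (measurableTypeR R)) ->
  gaussian 0 (s ^+ 2)%:M [set u : 'cV[R]_n | B (sqn (s^-1 *: u))] =
  std_gaussian n [set z : 'cV[R]_n | B (sqn z)].
Proof.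
move=> mB; have sE : (s ^+ 2)%:M = s%:M *m (s%:M)^T :> 'M[R]_n.
  by rewrite tr_scalar_mx -scalar_mxM expr2.
rewrite (gaussianE _ sE).
  congr (std_gaussian n _); apply/seteqP.
  have E (z : 'cV[R]_n) : s^-1 *: (s%:M *m z + 0) = z.
    by rewrite addr0 mul_scalar_mx scalerA mulVf ?scale1r// gt_eqF.
  by split => z /=; rewrite E.
apply: (@measurable_preimage _ _ _ _ (fun u : 'cV[R]_n => sqn (s^-1 *: u) : measurableTypeR R) B) => //.
under eq_fun do rewrite sqnZ.
by apply: measurable_funM => //; exact: measurable_sqn.
Qed.

Lemma sigma_hat_ratio (d e K : R) (u : 'cV[R]_n) : 0 <= d -> d <= 2^-1 ->
  sqn (tstar X s u) < K -> `|sqn (s^-1 *: u) - n%:R| < e * n%:R ->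
  e * n%:R + K + P%:R <= d / 2 * (n - P)%N%:R ->
  `|s / sigma_hat X (X *m th + u) - 1| <= d.
Proof.
move=> d0 d2 zK un eK; rewrite (sigma_hat_sqr nP rX _ _ (lt0r_neq0 s0)).
have nP0 : 0 < (n - P)%N%:R :> R by rewrite ltr0n subn_gt0.
set m := (n - P)%N%:R in nP0 eK *; have mE : m = n%:R - P%:R by rewrite /m natrB// ltnW.
(* The square of the ratio of [sigma_hat] to [s]. *)
pose w := m^-1 * (sqn (s^-1 *: u) - sqn (tstar X s u)).
have -> : m^-1 * (sqn u - s ^+ 2 * sqn (tstar X s u)) = s ^+ 2 * w.
  rewrite /w mulrCA; congr (_ * _); rewrite mulrBr [sqn (s^-1 *: u)]sqnZ.
  by rewrite mulrA -exprMn divff ?gt_eqF// expr1n mul1r.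
have wm : w * m = sqn (s^-1 *: u) - sqn (tstar X s u).
  by rewrite /w mulrAC mulVf ?mul1r// gt_eqF.
have z0 := sqn_ge0 (tstar X s u).
(* Three errors add up: the squared norm is off by less than [e n], the statistics remove less than
   [K], and [n] differs from the degrees of freedom by [P]. *)
have w1 : `|w - 1| <= d / 2.
  rewrite -(ler_pM2r nP0) -[X in _ * X <= _](gtr0_norm nP0) -normrM mulrBl wm mul1r.
  have P0 : 0 <= P%:R :> R by [].
  move: eK; rewrite mE => eK.
  by move: un => /ltr_normlP[u1 u2]; apply/ler_normlP; split; lra.
move: w1 => /ler_normlP[w1 w2].
rewrite sqrtrM ?sqr_ge0// sqrtr_sqr (gtr0_norm s0) invfM mulrA divff ?gt_eqF// mul1r.
have w0 : 0 <= w by lra.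
have q2 : Num.sqrt w ^+ 2 = w by rewrite sqr_sqrtr.
have q0 : 0 < Num.sqrt w by rewrite sqrtr_gt0; lra.
move: (Num.sqrt w) q0 q2 => q q0 q2.
have -> : q^-1 - 1 = (1 - q) / q by rewrite mulrBl divff ?mul1r// gt_eqF.
rewrite normrM normfV (gtr0_norm q0) ler_pdivrMr//.
apply/ler_normlP; split; nra.
Qed.

End noise.

(** * Asymptotics *)

Section limits.
Context {R : realType} {P : nat}.
Variables (X : forall n, 'M[R]_(n, P)) (Q : 'M[R]_P) (s : nat -> R) (sigma : R).
Let Qn n := n%:R^-1 *: ((X n)^T *m X n).
Hypotheses (QnQ : mxcvg Qn Q) (pdQ : posdef Q).
Hypotheses (s0 : forall n, 0 < s n) (sigma0 : 0 < sigma).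
Hypothesis ssigma : s n @[n --> \oo] --> sigma.
Variables (th gam : 'cV[R]_P).

Lemma cvg_transfer p : (p <= P)%N ->
  mxcvg (fun n => transfer Q (Qn n) sigma (s n) p) 1%:M.
Proof.
move=> pP.
have cs : s n / sigma @[n --> \oo] --> (1 : R).
  rewrite -(divff (lt0r_neq0 sigma0)); apply: cvgM => //; exact: cvg_cst.
have cp := @mxcvg_cst R _ _ (pid_mx p : 'M[R]_P).
have cD := @mxcvg_cst R _ _ (whiten Q *m Q).
have cT := mxcvg_tr (mxcvg_whiten QnQ pdQ).
have H := mxcvg_add (mxcvg_scale cs (mxcvg_mul cp (mxcvg_mul (mxcvg_mul cD cT) cp)))
  (@mxcvg_cst R _ _ (1%:M - pid_mx p : 'M[R]_P)).
rewrite [X in mxcvg _ X](_ : _ = 1 *: (pid_mx p *m (whiten Q *m Q *m (whiten Q)^T *m pid_mx p)) + (1%:M - pid_mx p)) //.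
by rewrite whitenK// mul1mx pid_mxK scale1r addrC subrK.
Qed.

Lemma cvg_shift : mxcvg (fun n => local_shift (Qn n) gam (s n)) (local_shift Q gam sigma).
Proof.
have cs : (s n)^-1 @[n --> \oo] --> sigma^-1 by apply: cvgV => //; rewrite gt_eqF.
exact: (mxcvg_scale cs (mxcvg_mul (mxcvg_mul (mxcvg_whiten QnQ pdQ) QnQ) (@mxcvg_cst R _ _ gam))).
Qed.

Lemma cvg_transfer_shift p : (p <= P)%N ->
  mxcvg (fun n => transfer Q (Qn n) sigma (s n) p *m local_shift (Qn n) gam (s n) -
    local_shift Q gam sigma) 0.
Proof.
move=> pP; have H := mxcvg_add (mxcvg_mul (cvg_transfer pP) cvg_shift)
  (@mxcvg_cst R _ _ (- local_shift Q gam sigma)).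
by rewrite mul1mx subrr in H.
Qed.

Lemma cvg_xi_ratio (i : 'I_P) :
  s n * xi_inf (Qn n) i.+1 / (sigma * xi_inf Q i.+1) @[n --> \oo] --> (1 : R).
Proof.
have x0 : sigma * xi_inf Q i.+1 != 0 by rewrite gt_eqF// mulr_gt0// xi_inf_gt0.
rewrite -(divff x0); apply: cvgM; last exact: cvg_cst.
by apply: cvgM => //; exact: cvg_xi_inf.
Qed.

Hypothesis rX : forall n, (P < n)%N -> \rank (X n) = P.

Lemma drift_infty (i : 'I_P) (C : R) : i.+1 = theta_order th ->
  \forall n \near \oo, C <= `|drift (X n) th (s n) i 0|.
Proof.
move=> ip; have [_ _ /(_ i ip) thi] := theta_orderP th.
set L := 2 * (sigma * xi_inf Q i.+1).
have x0 : 0 < sigma * xi_inf Q i.+1 by rewrite mulr_gt0// xi_inf_gt0.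
have L0 : 0 < L by rewrite mulr_gt0.
have /cvgrPdist_le/(_ 1 ltr01) r1 := @cvg_xi_ratio i.
have C2 := nbhs_infty_ger ((`|C| * L / `|th i 0|) ^+ 2).
near=> n.
have nP : (P < n)%N by near: n; exact: nbhs_infty_gt.
have pdn : posdef (Qn n) by apply: posdef_gram; [exact: leq_ltn_trans nP|exact: rX].
rewrite /drift mxE whitenQ_order_last//.
have xn0 : 0 < s n * xi_inf (Qn n) i.+1 by rewrite mulr_gt0// xi_inf_gt0.
have -> : Num.sqrt n%:R / s n * (th i 0 / xi_inf (n%:R^-1 *: ((X n)^T *m X n)) i.+1) =
    Num.sqrt n%:R * th i 0 / (s n * xi_inf (Qn n) i.+1).
  by rewrite invfM; ring.
rewrite normrM normfV (gtr0_norm xn0) normrM ger0_norm ?sqrtr_ge0//.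
apply: le_trans (ler_norm _) _; rewrite ler_pdivlMr//.
have xL : s n * xi_inf (Qn n) i.+1 <= L.
  have : `|1 - s n * xi_inf (Qn n) i.+1 / (sigma * xi_inf Q i.+1)| <= 1 by near: n; exact: r1.
  rewrite distrC => /ler_normlP[_ h].
  by rewrite /L -ler_pdivrMr//; lra.
apply: le_trans (ler_wpM2l (normr_ge0 _) xL) _.
have t0 : 0 < `|th i 0| by rewrite normr_gt0.
rewrite -ler_pdivrMr//.
have q0 : 0 <= `|C| * L / `|th i 0| by rewrite divr_ge0// mulr_ge0// ltW.
rewrite -(ger0_norm q0) -sqrtr_sqr ler_wsqrtr//.
by near: n; exact: C2.
Unshelve. all: by end_near. Qed.

End limits.

Lemma norm_le_sqr (R : realType) (x y K : R) : 1 <= K -> y <= K -> x ^+ 2 <= y -> `|x| <= K.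
Proof.
move=> K1 yK xy; rewrite -(@ler_pXn2r _ 2) ?nnegrE//; last exact: le_trans K1.
by rewrite -normrX ger0_norm ?sqr_ge0// (le_trans xy)// (le_trans yK)// ler_eXnr.
Qed.

Lemma measurable_tstar (R : realType) P n (X : 'M[R]_(n, P)) s :
  measurable_fun setT (fun u : 'cV[R]_n => tstar X s u).
Proof.
rewrite /tstar; under eq_fun do rewrite mulmxA scalemxAl.
exact: measurable_mulmx.
Qed.

(** * Lower bound for the sample law *)

Section asymptotics.
Context {R : realType} {P k : nat}.
Variables (X : forall n, 'M[R]_(n, P)) (Q : 'M[R]_P) (s : nat -> R) (sigma : R).
Let Qn n := n%:R^-1 *: ((X n)^T *m X n).
Hypotheses (QnQ : mxcvg Qn Q) (pdQ : posdef Q).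
Hypotheses (s0 : forall n, 0 < s n) (sigma0 : 0 < sigma).
Hypothesis ssigma : s n @[n --> \oo] --> sigma.
Hypothesis rX : forall n, (P < n)%N -> \rank (X n) = P.
Variables (th gam : 'cV[R]_P) (A : 'M[R]_(k, P)) (o : nat) (c : nat -> R).
Hypotheses (oP : (o <= P)%N) (co : c o = 0) (c0 : forall p, (o < p <= P)%N -> 0 < c p).
Let pst := maxn (theta_order th) o.
Local Notation T := (measurableTypeR R).
Local Notation N := (normal_prob (0 : R) 1).
Local Notation gauss := (@std_gaussian R P).

Definition noise n : probability 'cV[R]_n R := gaussian 0 (s n ^+ 2)%:M.
Definition response n (u : 'cV[R]_n) := X n *m (th + (Num.sqrt n%:R)^-1 *: gam) + u.

Variable f : forall n, 'cV[R]_n -> R.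
Hypothesis mf : forall n, measurable_fun setT (@f n : 'cV[R]_n -> T).
(** [f] stands for the true scale or for [sigma_hat], so that both selectors are treated at once.
    The tolerance [e] on the norm depends on [d] alone, whereas the bound [K] on the statistics is
    arbitrary and only delays [n]. *)
Hypothesis f_ratio : forall d : R, 0 < d -> exists2 e : R, 0 < e & forall K : R,
  \forall n \near \oo, forall u : 'cV[R]_n, sqn (tstar (X n) (s n) u) < K ->
  `|sqn ((s n)^-1 *: u) - n%:R| < e * n%:R -> `|s n / f (response u) - 1| <= d.

Definition selected n (u : 'cV[R]_n) := select (X n) o c (f (response u)) (response u).
Definition scaled_error n p (u : 'cV[R]_n) : 'cV[R]_k :=
  Num.sqrt n%:R *: (A *m (restricted_ls (X n) p (response u) -
    (th + (Num.sqrt n%:R)^-1 *: gam))).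

Lemma measurable_response n : measurable_fun setT (@response n).
Proof. by rewrite /response; exact: measurable_addmx. Qed.

Lemma measurable_selected n p : measurable [set u : 'cV[R]_n | selected u = p].
Proof.
apply: (@measurable_preimage _ _ _ _ (@response n)
  [set y | select (X n) o c (f y) y = p]); first exact: measurable_response.
exact: measurable_select.
Qed.

Lemma measurable_scaled_error n p : measurable_fun setT (@scaled_error n p).
Proof.
have -> : @scaled_error n p = fun u => (Num.sqrt n%:R *: A) *m restricted_ls (X n) p (response u)
    + - (Num.sqrt n%:R *: (A *m (th + (Num.sqrt n%:R)^-1 *: gam))).
  by apply/funext => u; rewrite /scaled_error mulmxBr scalerBr scalemxAl.
apply: (measurableT_comp (measurable_affine_mx _ _)).
exact: (measurableT_comp (measurable_restricted_ls _ _) (@measurable_response n)).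
Qed.

(* The two selection events can differ only on B1 (sigma_hat is inaccurate), B2 (the
   statistics are large enough to offset the drift) or B3 (a statistic is close to its
   critical value). *)
Lemma selected_lower_bound (e : R) : 0 < e -> \forall n \near \oo, forall p,
  (pst <= p <= P)%N -> forall B : set 'cV[R]_k, measurable B ->
  (gauss [set z | pattern pst c (z + local_shift Q gam sigma) = p /\
                  B (limit_map Q A gam sigma p z)] <=
   noise n [set u | selected u = p /\ B (scaled_error p u)] + e%:E)%E.
Proof.
move=> e0; have pstP : (pst <= P)%N by rewrite geq_max oP; have [-> ] := theta_orderP th.
pose S := \sum_(i < P) `|c i.+1|.
have S0 : 0 <= S by exact: sumr_ge0.
(* An annulus of half-width [2 d |c|] has probability at most [8 d |c|], so all of them together
   cost at most [8 d S <= e / 4]; [S + 1] avoids a division by 0. *)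
pose d := Num.min 2^-1 (e / 4 / (8 * (S + 1))).
have d0 : 0 < d by rewrite lt_min invr_gt0 ltr0n/= divr_gt0 ?divr_gt0// mulr_gt0// ltr_wpDl.
have d2 : d <= 2^-1 by rewrite ge_min lexx.
have dS : 8 * d * S <= e / 4.
  have h : d * (8 * (S + 1)) <= e / 4.
    by rewrite -ler_pdivlMr ?mulr_gt0 ?ltr_wpDl// ge_min lexx orbT.
  rewrite mulrAC mulrC; apply: le_trans h; apply: ler_wpM2l; first exact: ltW.
  by rewrite ler_pM2l// lerDl.
have e4 : 0 < e / 4 by rewrite divr_gt0.
have [K0 K0P] := sqn_tight P e4.
(* With [K >= 1] a bound [K] on the squared norm also bounds each coordinate by [K]. *)
pose K := Num.max 1 K0; have K1 : 1 <= K by rewrite le_max lexx.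
have KP : (gauss [set z | K <= sqn z]%R <= (e / 4)%:E)%E.
  apply: le_trans _ K0P; apply: le_measure; rewrite ?inE.
  - by apply: measurable_set_ge; exact: measurable_sqn.
  - by apply: measurable_set_ge; exact: measurable_sqn.
  - by move=> z /=; apply: le_trans; rewrite le_max lexx orbT.
have [e1 e10 /(_ K) ratio] := f_ratio d0.
have lln := sqn_lln e10 e4.
have xi1 : \forall n \near \oo, forall i : 'I_P,
    `|s n * xi_inf (Qn n) i.+1 / (sigma * xi_inf Q i.+1) - 1| <= d.
  apply: filter_forall => i.
  have /cvgrPdist_le/(_ d d0) := cvg_xi_ratio QnQ pdQ sigma0 ssigma i.
  by apply: filterS => n; rewrite distrC.
have sh1 : \forall n \near \oo, forall i : 'I_P,
    `|local_shift (Qn n) gam (s n) i 0| <= `|local_shift Q gam sigma i 0| + 1.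
  apply: filter_forall => i.
  have H : mxcvg (fun n => local_shift (Qn n) gam (s n)) (local_shift Q gam sigma) :=
    cvg_shift QnQ pdQ sigma0 ssigma (gam := gam).
  have /cvgrPdist_le/(_ 1 ltr01) := H i 0.
  apply: filterS => n h; rewrite -lerBlDl; apply: le_trans (lerB_dist _ _) _.
  by rewrite distrC.
(* The drift has to leave [2 * c i.+1] after the shift and a statistic of size [K] are
   subtracted. *)
have dr1 : \forall n \near \oo, forall i : 'I_P, i.+1 = theta_order th ->
    2 * c i.+1 + (`|local_shift Q gam sigma i 0| + 1) + K <= `|drift (X n) th (s n) i 0|.
  apply: filter_forall => i; have [ip|ip] := pselect (i.+1 = theta_order th).
    near=> n => _; near: n.
    exact: (drift_infty QnQ pdQ s0 sigma0 ssigma rX _ ip).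
  by near=> n => /ip.
have tv1 : \forall n \near \oo, forall p : 'I_P.+1, forall B : set 'cV[R]_P, measurable B ->
    (gauss B <= gauss [set z | B (transfer Q (Qn n) sigma (s n) p *m z +
      (transfer Q (Qn n) sigma (s n) p *m local_shift (Qn n) gam (s n) - local_shift Q gam sigma))%R]
      + (e / 4)%:E)%E.
  apply: filter_forall => p; have pP : (p <= P)%N by rewrite -ltnS.
  apply: tv_affine => //.
  - by move=> n i j; exact: transfer_trig.
  - move=> i j; have H : mxcvg (fun n => transfer Q (Qn n) sigma (s n) p) 1%:M :=
      cvg_transfer QnQ pdQ sigma0 ssigma pP.
    by have := H i j; rewrite mxE.
  - move=> i; have H : mxcvg (fun n => transfer Q (Qn n) sigma (s n) p *m local_shift (Qn n) gam (s n) -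
      local_shift Q gam sigma) 0 := cvg_transfer_shift QnQ pdQ sigma0 ssigma gam pP.
    by have := H i 0; rewrite mxE.
near=> n; move=> p /andP[pstp pP] B mB.
have nP : (P < n)%N by near: n; exact: nbhs_infty_gt.
set E := [set z | pattern _ _ _ = p /\ _].
have mE : measurable E.
  apply: (measurableI _ _ (measurable_shifted_pattern Q gam sigma c pstP p)).
  exact: (measurable_preimage (measurable_limit_map _ _ _ _ p) mB).
pose M := transfer Q (Qn n) sigma (s n) p.
pose d_ := M *m local_shift (Qn n) gam (s n) - local_shift Q gam sigma.
have tvn : (gauss E <= gauss [set z | E (M *m z + d_)%R] + (e / 4)%:E)%E.
  have pP1 : (p < P.+1)%N by [].
  have tvn : forall p : 'I_P.+1, forall B : set 'cV[R]_P, measurable B ->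
    (gauss B <= gauss [set z | B (transfer Q (Qn n) sigma (s n) p *m z +
      (transfer Q (Qn n) sigma (s n) p *m local_shift (Qn n) gam (s n) - local_shift Q gam sigma))%R]
      + (e / 4)%:E)%E by near: n; exact: tv1.
  exact: (tvn (Ordinal pP1) E mE).
apply: (le_trans tvn).
have mE' : measurable [set z | E (M *m z + d_)].
  exact: (measurable_preimage (measurable_affine_mx _ _) mE).
have lawE := tstar_law nP (rX nP) (s0 n).
rewrite -lawE//.
set G := [set u | selected u = p /\ _].
have mG : measurable G.
  apply: (measurableI [set u : 'cV[R]_n | selected u = p] [set u | B (scaled_error p u)]).
    exact: measurable_selected.
  exact: (measurable_preimage (@measurable_scaled_error n p) mB).
pose B1 := [set u : 'cV[R]_n | e1 * n%:R <= `|sqn ((s n)^-1 *: u) - n%:R| ].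
pose B2 := [set u : 'cV[R]_n | [set z : 'cV[R]_P | K <= sqn z] (tstar (X n) (s n) u)].
(* Up to order [o] the numbers [c] may be negative; absolute values keep the half-widths
   nonnegative. *)
pose C3 := [set z : 'cV[R]_P | exists i : 'I_P,
  `| `|z i 0 + local_shift (Qn n) gam (s n) i 0| - `|c i.+1| | <= 2 * d * `|c i.+1| ].
pose B3 := [set u : 'cV[R]_n | C3 (tstar (X n) (s n) u)].
have mtstar : measurable_fun setT (fun u : 'cV[R]_n => tstar (X n) (s n) u).
  exact: measurable_tstar.
pose D1 : set T := [set x : T | e1 * n%:R <= `|(x : R) - n%:R| ].
have mD1 : measurable D1.
  apply: (@measurable_set_ge R _ _ (fun x : T => `|(x : R) - n%:R| : T)).
  by apply: (measurableT_comp (@normr_measurable R setT)); exact: measurable_funB.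
have mB1 : measurable B1.
  apply: (@measurable_preimage _ _ _ _ (fun u : 'cV[R]_n => sqn ((s n)^-1 *: u) : T) D1) => //.
  by under eq_fun do rewrite sqnZ; apply: measurable_funM => //; exact: measurable_sqn.
have mnB1 : (noise n B1 <= (e / 4)%:E)%E.
  rewrite [leLHS](@noise_sqn R n (s n) (s0 n) D1 mD1).
  have llnn : (std_gaussian n [set z | e1 * n%:R <= `|sqn z - n%:R| ]%R <= (e / 4)%:E)%E.
    by near: n; exact: lln.
  exact: llnn.
have mK : measurable [set z : 'cV[R]_P | K <= sqn z].
  by apply: measurable_set_ge; exact: measurable_sqn.
have mB2 : measurable B2 by exact: (measurable_preimage mtstar mK).
have mnB2 : (noise n B2 <= (e / 4)%:E)%E by rewrite /noise lawE.
have [mC3 C3P] : measurable C3 /\ (gauss C3 <= (e / 4)%:E)%E.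
  pose D i : set T :=
    [set x : T | `| `|(x : R) + local_shift (Qn n) gam (s n) i 0| - `|c i.+1| | <= 2 * d * `|c i.+1| ].
  have mD i : measurable (D i).
    apply: (@measurable_set_le R _ _ (fun x : T =>
      `| `|(x : R) + local_shift (Qn n) gam (s n) i 0| - `|c i.+1| | : T)).
    apply: (measurableT_comp (@normr_measurable R setT)); apply: measurable_funB => //.
    by apply: (measurableT_comp (@normr_measurable R setT)); exact: measurable_funD.
  have gD (i : 'I_P) : (gauss [set z : 'cV[R]_P | D i (z i 0)]%R <= (8 * d * `|c i.+1| )%:E)%E.
    rewrite [leLHS]std_gaussian_entry//; apply: le_trans (normal_prob_annulus _ _ _) _.
      by rewrite !mulr_ge0// ltW.
    by rewrite lee_fin !mulrA -natrM.
  have mDz (i : 'I_P) : measurable [set z : 'cV[R]_P | D i (z i 0)].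
    exact: (measurable_preimage (measurable_entry i 0) (mD i)).
  have [mC3 C3P] := measure_exists mDz gD.
  split; first exact: mC3.
  apply: (le_trans C3P).
  by rewrite lee_fin -mulr_sumr.
have mB3 : measurable B3 by exact: (measurable_preimage mtstar mC3).
have mnB3 : (noise n B3 <= (e / 4)%:E)%E by rewrite /noise lawE.
have sub : [set u : 'cV[R]_n | E (M *m tstar (X n) (s n) u + d_)] `<=` G `|` (B1 `|` (B2 `|` B3)).
  move=> u Eu; have [Bu|nB] := pselect ((B1 `|` (B2 `|` B3)) u); [by right|left].
  have nB1 : `|sqn ((s n)^-1 *: u) - n%:R| < e1 * n%:R.
    by rewrite ltNge; apply/negP => h; apply: nB; left.
  have nB2 : sqn (tstar (X n) (s n) u) < K.
    by rewrite ltNge; apply/negP => h; apply: nB; right; left.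
  have nB3 : ~ B3 u by move=> h; apply: nB; right; right.
  move: Eu; rewrite /E/=.
  have -> : M *m tstar (X n) (s n) u + d_ + local_shift Q gam sigma =
      M *m (tstar (X n) (s n) u + local_shift (Qn n) gam (s n)).
    by rewrite /d_ addrA subrK mulmxDr.
  rewrite (limit_map_transfer _ _ pdQ sigma0)// => -[psel Bu].
  split; last first.
    rewrite /scaled_error (estimator_local nP (rX nP) _ (s0 n))// pP.
    by rewrite (leq_trans _ pstp) ?leq_maxl.
  apply: (select_of_pattern nP (rX nP) pdQ sigma0 (s0 n) oP co c0 (ltW d0) d2 _ _ _ _ psel).
  - have ration : forall u : 'cV[R]_n, sqn (tstar (X n) (s n) u) < K ->
      `|sqn ((s n)^-1 *: u) - n%:R| < e1 * n%:R -> `|s n / f (response u) - 1| <= d.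
      by near: n; exact: ratio.
    exact: ration.
  - by near: n; exact: xi1.
  - move=> i oi; have ci : 0 < c i.+1 by rewrite c0// ltnS oi ltn_ord.
    rewrite ltNge; apply/negP => h; apply: nB3; exists i.
    by rewrite (gtr0_norm ci); move: h; rewrite mxE.
  - move=> i ip oi.
    have drn : forall i : 'I_P, i.+1 = theta_order th ->
      2 * c i.+1 + (`|local_shift Q gam sigma i 0| + 1) + K <= `|drift (X n) th (s n) i 0|.
      by near: n; exact: dr1.
    have shn : forall i : 'I_P, `|local_shift (Qn n) gam (s n) i 0| <= `|local_shift Q gam sigma i 0| + 1.
      by near: n; exact: sh1.
    rewrite mxE; have := drn i ip; have := shn i.
    have zK : `|tstar (X n) (s n) u i 0| <= K.
      have := sqn_coord (tstar (X n) (s n) u) i.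
      by apply: norm_le_sqr => //; exact: ltW.
    move: zK; set z := tstar _ _ _ _ _; set sh := local_shift _ _ _ _ _; set dr := drift _ _ _ _ _.
    move=> zK shK drK.
    have drE : `|dr| <= `|z + sh + dr| + `|z + sh|.
      have {1}-> : dr = z + sh + dr - (z + sh) by rewrite [RHS]addrC addKr.
      exact: ler_normB.
    have zsh := ler_normD z sh; lra.
apply: (@le_trans _ _ (noise n (G `|` (B1 `|` (B2 `|` B3))) + (e / 4)%:E)%E).
  rewrite leeD2r// le_measure ?inE//; last by repeat apply: measurableU.
  exact: (measurable_preimage mtstar mE').
(* One quarter for each of the three bad events and one for the transport. *)
have -> : (e%:E = (e / 4)%:E + ((e / 4)%:E + (e / 4)%:E) + (e / 4)%:E)%E.
  by rewrite -!EFinD; congr (_%:E); field.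
rewrite addeA leeD2r//.
apply: le_trans (measureU2 _ _ _) _ => //; first by repeat apply: measurableU.
rewrite leeD2l//.
apply: le_trans (measureU2 _ _ _) _ => //; first by repeat apply: measurableU.
apply: leeD => //.
by apply: le_trans (measureU2 _ _ _) _ => //; exact: leeD.
Unshelve. all: by end_near. Qed.

End asymptotics.

Lemma tv_dist_cvg (R : realType) k (mu : nat -> probability 'cV[R]_k R)
    (nu : probability 'cV[R]_k R) :
  (forall e : R, 0 < e -> \forall n \near \oo, forall B : set 'cV[R]_k, measurable B ->
    (nu B <= mu n B + e%:E)%E) ->
  tv_dist (mu n) nu @[n --> \oo] --> 0%E.
Proof.
move=> H.
have le_tv (e : R) : 0 < e -> \forall n \near \oo,
    (0 <= tv_dist (mu n) nu)%E /\ (tv_dist (mu n) nu <= e%:E)%E.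
  move=> e0; apply: filterS (H e e0) => n Hn; split.
    apply: ereal_sup_ubound; exists set0; first exact: measurable0.
    by rewrite !measure0 sube0 abse0.
  apply: ge_ereal_sup => _ [B mB <-].
  (* The bound on the complement is the opposite inequality for [B]. *)
  have := Hn _ (measurableC mB); rewrite !probability_setC//.
  have := Hn B mB.
  have [nf mf] : nu B \is a fin_num /\ mu n B \is a fin_num by rewrite !fin_num_measure.
  rewrite -(fineK nf) -(fineK mf) -!EFinB -!EFinD abse_EFin !lee_fin => h1 h2.
  by apply/ler_normlP; split; lra.
apply/fine_cvgP; split.
  apply: filterS (le_tv 1 ltr01) => n [t0 t1].
  by rewrite fin_numElt (lt_le_trans _ t0)//= (le_lt_trans t1)// ltry.
apply/cvgrPdist_le => e e0; apply: filterS (le_tv e e0) => n [t0 t1].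
rewrite sub0r normrN /= ger0_norm ?fine_ge0//.
by rewrite -lee_fin fineK// fin_numElt (lt_le_trans _ t0)//= (le_lt_trans t1)// ltry.
Qed.

(* One-sided bounds suffice when both sides have the same total mass. *)
Lemma sum_one_sided (R : realType) (a b : nat) (x y : nat -> R) (e : R) p :
  0 <= e -> (forall q, (a <= q < b)%N -> y q <= x q + e) ->
  \sum_(a <= q < b) x q = \sum_(a <= q < b) y q -> (a <= p < b)%N ->
  `|y p - x p| <= b%:R * e.
Proof.
move=> e0 yx xy pab; have bp : (0 < b)%N by case/andP: pab => _; exact: leq_ltn_trans.
have S : \sum_(a <= q < b) (x q - y q + e) = (b - a)%:R * e.
  rewrite big_split/= sumrB xy subrr add0r sumr_const_nat mulr_natl.
  by [].
have be : e <= b%:R * e by rewrite ler_peMl// ler1n.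
have ble : (b - a)%:R * e <= b%:R * e by rewrite ler_wpM2r// ler_nat leq_subr.
have := S; rewrite (bigD1_seq p)/= ?mem_index_iota ?iota_uniq// => Sp.
have r0 : 0 <= \sum_(a <= q < b | q != p) (x q - y q + e).
  rewrite big_seq_cond; apply: sumr_ge0 => q; rewrite mem_index_iota => /andP[qab _].
  by have := yx q qab; lra.
have := yx p pab; move: r0 Sp; set r := \sum_(_ <= _ < _ | _) _ => r0 Sp yp.
by apply/ler_normlP; split; lra.
Qed.

(** * Convergence of the laws and of the selection probabilities *)

Section conclusion.
Context {R : realType} {P k : nat}.
Variables (X : forall n, 'M[R]_(n, P)) (Q : 'M[R]_P) (s : nat -> R) (sigma : R).
Let Qn n := n%:R^-1 *: ((X n)^T *m X n).
Hypotheses (QnQ : mxcvg Qn Q) (pdQ : posdef Q).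
Hypotheses (s0 : forall n, 0 < s n) (sigma0 : 0 < sigma).
Hypothesis ssigma : s n @[n --> \oo] --> sigma.
Hypothesis rX : forall n, (P < n)%N -> \rank (X n) = P.
Variables (th gam : 'cV[R]_P) (A : 'M[R]_(k, P)) (o : nat) (c : nat -> R).
Hypotheses (oP : (o <= P)%N) (co : c o = 0) (c0 : forall p, (o < p <= P)%N -> 0 < c p).
Variables (ginv : 'M[R]_k -> 'M[R]_k).
Hypothesis hginv : forall M, is_ginv M (ginv M).
Let pst := maxn (theta_order th) o.
Local Notation T := (measurableTypeR R).
Local Notation gauss := (@std_gaussian R P).
Let th_ n := th + (Num.sqrt n%:R)^-1 *: gam.

Variable f : forall n, 'cV[R]_n -> R.
Hypothesis mf : forall n, measurable_fun setT (@f n : 'cV[R]_n -> T).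
Hypothesis f_ratio : forall d : R, 0 < d -> exists2 e : R, 0 < e & forall K : R,
  \forall n \near \oo, forall u : 'cV[R]_n, sqn (tstar (X n) (s n) u) < K ->
  `|sqn ((s n)^-1 *: u) - n%:R| < e * n%:R ->
  `|s n / f (response X th gam u) - 1| <= d.
Let sel n (y : 'cV[R]_n) := select (X n) o c (f y) y.
Local Notation selected := (selected X th gam o c f).
Local Notation scaled_error := (scaled_error X th gam A).
Local Notation noise := (noise s).

Let pstP : (pst <= P)%N.
Proof. by rewrite geq_max oP; have [-> ] := theta_orderP th. Qed.

Let ope : (o <= pst)%N. Proof. exact: leq_maxr. Qed.

Lemma post_selection_tv : cdf_cvg_tv
  (fun n => pms_cdf (X n) o A (th_ n) (s n) (@sel n))
  (limit_cdf Q A ginv gam sigma c pst).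
Proof.
have [nu [nuE nuS]] := limit_measure A gam c pdQ hginv sigma0 pstP.
pose Hn n (u : 'cV[R]_n) := Num.sqrt n%:R *: (A *m (post_selection (X n) o (@sel n)
  (response X th gam u) - th_ n)).
have HnE n (u : 'cV[R]_n) : Hn n u = scaled_error (selected u) u.
  by rewrite /Hn /post_selection sum_select//; exact: select_ge.
have mH n : measurable_fun setT (Hn n).
  rewrite (_ : Hn n = fun u => \sum_(o <= p < P.+1) (selected u == p)%:R *: scaled_error p u).
    apply: measurable_sum_select; first by move=> p; exact: measurable_selected.
    by move=> p; exact: measurable_scaled_error.
  by apply/funext => u; rewrite HnE sum_select//; exact: select_ge.
have law n := image_law (noise n) (mH n).
pose mu n := sval (cid (law n)).
have muE n B : mu n B = noise n [set u | B (Hn n u)] by rewrite /mu; case: cid.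
exists mu, nu; split => //.
  by apply: nearW => n; apply/funext => t; rewrite /mcdf muE.
apply: tv_dist_cvg => e e0.
have eP : 0 < e / P.+1%:R by rewrite divr_gt0.
have := selected_lower_bound QnQ pdQ s0 sigma0 ssigma rX A oP co c0 mf f_ratio eP.
apply: filterS => n Hlow B mB; rewrite nuS// muE.
have mS p : measurable [set u : 'cV[R]_n | selected u = p].
  exact: measurable_selected.
rewrite (probability_select (noise n) (sel := fun u => selected u) mS (b := o) (n := P.+1)); last 2 first.
- exact: (measurable_preimage (mH n) mB).
- by move=> u; exact: select_ge.
(* Orders below [pst] are absent from the limit and contribute a nonnegative amount to the sample
   side. *)
rewrite (big_cat_nat ope (leqW pstP))/= -addeA.
apply: lee_paddl; first by apply: sume_ge0 => p _.
(* The error is shared among [P.+1] orders, at least as many as occur in the sum. *)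
have -> : e%:E = (\sum_(0 <= q < P.+1) (e / P.+1%:R)%:E)%E.
  by rewrite sumEFin sumr_const_nat subn0 -[X in _ = X%:E]mulr_natr divfK.
apply: (@le_trans _ _ (\sum_(pst <= p < P.+1) (noise n [set u | selected u = p /\ B (Hn n u)] +
   (e / P.+1%:R)%:E))%E).
  rewrite !big_nat; apply: lee_sum => p /andP[pp pP].
  apply: le_trans (Hlow p _ B mB) _; first by rewrite pp.
  rewrite leeD2r// [X in noise n X](_ : _ = [set u | selected u = p /\ B (Hn n u)])//.
  by apply/seteqP; split => u /= [<-]; rewrite HnE.
rewrite big_split/= leeD2l// [leRHS](big_cat_nat (leq0n _) (leqW pstP))/=.
by apply: lee_paddl => //; apply: sume_ge0 => p _; rewrite lee_fin ltW.
Qed.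

(** Lower bounds for all orders and total mass 1 on both sides force convergence. Below [pst] the
    lower bound is trivial, and the vanishing of these probabilities comes from the total mass. *)
Lemma selection_prob_cvg p : (o <= p <= P)%N ->
  lm_prob (X n) (th_ n) (s n) [set y | @sel n y = p] @[n --> \oo]
    --> limit_selection_prob Q gam sigma c pst p.
Proof.
move=> op; pose x n q := fine (noise n [set u : 'cV[R]_n | selected u = q]).
pose y q := limit_selection_prob Q gam sigma c pst q.
apply/cvgrPdist_le => e e0.
have eP : 0 < e / P.+1%:R by rewrite divr_gt0.
have := selected_lower_bound QnQ pdQ s0 sigma0 ssigma rX A oP co c0 mf f_ratio eP.
apply: filterS => n Hlow.
have mS q : measurable [set u : 'cV[R]_n | selected u = q].
  exact: measurable_selected.
have low q : (o <= q < P.+1)%N -> y q <= x n q + e / P.+1%:R.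
  move=> /andP[oq qP]; have [qp|pq] := ltnP q pst.
    by rewrite /y /limit_selection_prob qp addr_ge0 ?fine_ge0// ltW.
  have := Hlow q _ setT measurableT; rewrite pq -ltnS qP => /(_ isT).
  rewrite [X in gauss X](_ : _ = [set z | pattern pst c (z + local_shift Q gam sigma) = q]); last first.
    by apply/seteqP; split => z //= -[].
  rewrite [X in noise n X](_ : _ = [set u | selected u = q]); last first.
    by apply/seteqP; split => z //= -[].
  have mq := measurable_shifted_pattern Q gam sigma c pstP q.
  rewrite -[X in (X <= _)%E]fineK ?fin_num_measure// -[noise n _]fineK ?fin_num_measure//.
  by rewrite -EFinD lee_fin (limit_selectionE A gam c pdQ sigma0 pstP)// pq -ltnS.
have x1 : \sum_(o <= q < P.+1) x n q = 1.
  apply: EFin_inj; rewrite -sumEFin -(probability_setT (noise n)).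
  rewrite (probability_select (noise n) (sel := fun u => selected u) mS (b := o) (n := P.+1))//.
    apply: eq_bigr => q _; rewrite fineK ?fin_num_measure//.
    by congr (noise n _); apply/seteqP; split => u //= -[].
  by move=> u; exact: select_ge.
have y1 : \sum_(o <= q < P.+1) y q = 1.
  rewrite (big_cat_nat ope (leqW pstP))/= big_nat big1 ?add0r; last first.
    by move=> q /andP[_ qp]; rewrite /y /limit_selection_prob qp.
  apply: EFin_inj; rewrite -sumEFin -(probability_setT gauss).
  have mq := measurable_shifted_pattern Q gam sigma c pstP.
  rewrite (probability_select gauss (sel := fun z => pattern pst c (z + local_shift Q gam sigma)) mq
    (b := pst) (n := P.+1))//; last exact: pattern_ge.
  rewrite !big_nat; apply: eq_bigr => q /andP[pq qP].
  rewrite /y -(limit_selectionE A gam c pdQ sigma0 pstP) ?pq// fineK ?fin_num_measure//.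
  by congr (gauss _); apply/seteqP; split => u //= -[].
have := sum_one_sided (ltW eP) low (etrans x1 (esym y1)) op.
by rewrite [_ * (_ / _)]mulrC divfK ?pnatr_eq0.
Qed.

End conclusion.

Lemma sigma_hat_consistent (R : realType) P (X : forall n, 'M[R]_(n, P)) (s : nat -> R)
    (th gam : 'cV[R]_P) :
  (forall n, (P < n)%N -> \rank (X n) = P) -> (forall n, 0 < s n) ->
  forall d : R, 0 < d -> exists2 e : R, 0 < e & forall K : R,
  \forall n \near \oo, forall u : 'cV[R]_n, sqn (tstar (X n) (s n) u) < K ->
  `|sqn ((s n)^-1 *: u) - n%:R| < e * n%:R ->
  `|s n / sigma_hat (X n) (response X th gam u) - 1| <= d.
Proof.
move=> rX s0 d d0; pose d' := Num.min 2^-1 d.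
have d'0 : 0 < d' by rewrite lt_min invr_gt0 ltr0n.
have d'd : d' <= d by rewrite ge_min lexx orbT.
have d'2 : d' <= 2^-1 by rewrite ge_min lexx.
(* The fluctuation of the norm uses half of the allowance [d' / 2]; for large [n] the other half
   absorbs [K] and [P]. *)
exists (d' / 4); first by rewrite divr_gt0.
move=> K; near=> n => u zK un; have nP : (P < n)%N by near: n; exact: nbhs_infty_gt.
apply: le_trans d'd.
apply: (sigma_hat_ratio nP (rX n nP) _ (s0 n) (ltW d'0) d'2 zK un).
have : (K + P%:R + d' / 2 * P%:R) / (d' / 4) <= n%:R by near: n; exact: nbhs_infty_ger.
rewrite ler_pdivrMr ?divr_gt0// natrB; last exact: ltnW.
move=> h.
have -> : d' / 2 * (n%:R - P%:R) = d' / 4 * n%:R + n%:R * (d' / 4) - d' / 2 * P%:R by field.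
lra.
Unshelve. all: by end_near. Qed.

Theorem corollary5p6 (R : realType) (P k o : nat)
    (hP : (1 <= P)%N) (hk : (1 <= k <= P)%N) (ho : (o < P)%N)
    (X : forall n, 'M[R]_(n, P))
    (hX : forall n, (P < n)%N -> \rank (X n) = P)
    (Q : 'M[R]_P)
    (hQ : (n%:R^-1 *: ((X n)^T *m X n)) @[n --> \oo] --> Q)
    (hQu : Q \in unitmx)
    (A : 'M[R]_(k, P)) (hA : \rank A = k)
    (c : nat -> R) (hc : forall p, (o < p <= P)%N -> 0 < c p) (hco : c o = 0)
    (ginv : 'M[R]_k -> 'M[R]_k) (hginv : forall M, is_ginv M (ginv M))
    (th gam : 'cV[R]_P) (s : nat -> R) (sigma : R)
    (hs : forall n, 0 < s n) (hsigma : 0 < sigma)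
    (hslim : s n @[n --> \oo] --> sigma) :
  let pstar := maxn (theta_order th) o in
  let th_ n := th + (Num.sqrt n%:R)^-1 *: gam in
  let sel n := p_hat (X n) o c in
  let sel_star n := select (X n) o c (s n) in
  [/\ cdf_cvg_tv (fun n => pms_cdf (X n) o A (th_ n) (s n) (sel_star n))
        (limit_cdf Q A ginv gam sigma c pstar),
      cdf_cvg_tv (fun n => pms_cdf (X n) o A (th_ n) (s n) (sel n))
        (limit_cdf Q A ginv gam sigma c pstar) &
      forall p, (o <= p <= P)%N ->
        lm_prob (X n) (th_ n) (s n) [set y | sel n y = p] @[n --> \oo]
          --> limit_selection_prob Q gam sigma c pstar p /\
        lm_prob (X n) (th_ n) (s n) [set y | sel_star n y = p] @[n --> \oo]
          --> limit_selection_prob Q gam sigma c pstar p].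
Proof.
move=> pstar th_ sel sel_star.
have QnQ := mxcvgP hQ.
have pdQ : posdef Q.
  apply: posdef_lim QnQ _ hQu; near=> n.
  have nP : (P < n)%N by near: n; exact: nbhs_infty_gt.
  by apply: posdef_gram; [exact: leq_ltn_trans nP|exact: hX].
have oP := ltnW ho.
have m_star n : measurable_fun setT (fun _ : 'cV[R]_n => s n : measurableTypeR R).
  exact: measurable_cst.
have r_star (d : R) : 0 < d -> exists2 e : R, 0 < e & forall K : R,
    \forall n \near \oo, forall u : 'cV[R]_n, sqn (tstar (X n) (s n) u) < K ->
    `|sqn ((s n)^-1 *: u) - n%:R| < e * n%:R -> `|s n / s n - 1| <= d.
  (* With the true scale the ratio is exactly 1, whatever the tolerance on the norm. *)
  move=> d0; exists 1 => // K; apply: nearW => n u _ _.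
  by rewrite divff ?gt_eqF// subrr normr0 ltW.
have m_hat n := measurable_sigma_hat (X n).
have r_hat := sigma_hat_consistent th gam hX hs.
split.
- exact: (post_selection_tv QnQ pdQ hs hsigma hslim hX A oP hco hc hginv m_star r_star).
- exact: (post_selection_tv QnQ pdQ hs hsigma hslim hX A oP hco hc hginv m_hat r_hat).
move=> p op; split.
- exact: (selection_prob_cvg QnQ pdQ hs hsigma hslim hX A oP hco hc m_hat r_hat).
- exact: (selection_prob_cvg QnQ pdQ hs hsigma hslim hX A oP hco hc m_star r_star).
Unshelve. all: by end_near. Qed.
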